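(* Let $G$ be a compact connected Lie group with Lie algebra $\mathfrak{g}$, let $M$ be a compact connected smooth manifold, and let $\pi\colon P\to M$ be a (smooth) principal $G$-bundle. Fix a bi-invariant metric $\langle -,-\rangle$ on $G$, a Riemannian metric $g_M$ on $M$, a real number $T>0$ and a continuous function $f\colon[0,T)\to\mathbb{R}$ with $f>0$. Let $\theta\in\Omega^1(P,\mathfrak{g})$ be a principal connection and let $u\in P$ be such that the holonomy group $\mathrm{Hol}_u(\theta)\subset G$ is a closed subgroup. Define the Riemannian metrics $g_t:=f(t)\,\pi^*g_M+\langle\theta,\theta\rangle$, $t\in[0,T)$, on $P$, and let $g_T$ be the $G$-invariant Riemannian metric on $G/\mathrm{Hol}_u(\theta)$ induced by $\langle-,-\rangle$ which makes the projection $G\to G/\mathrm{Hol}_u(\theta)$ a Riemannian submersion. If $\lim_{t\to T}f(t)=0$, then $$\lim_{t\to T}d_{GH}\big((P,d_{g_t}),(G/\mathrm{Hol}_u(\theta),d_{g_T})\big)=0.$$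
   Context: $G$ acts smoothly and freely on $P$ on the right, with $R_g(x)=xg$. A principal connection is a $\mathfrak{g}$-valued 1-form $\theta$ on $P$ with $R_g^*\theta=\mathrm{Ad}(g^{-1})\theta$ for all $g\in G$ and $\theta(\xi_* )=\xi$ for all $\xi\in\mathfrak{g}$, where $\xi_*$ is the vector field on $P$ generated by $\xi$. A curve in $P$ is $\theta$-horizontal if its velocity lies in $\ker\theta$. Write $p\sim q$ if $p,q\in P$ can be joined by a piecewise smooth $\theta$-horizontal path. The holonomy group is $\mathrm{Hol}_u(\theta)=\{g\in G: u\sim ug\}$. In $\langle\theta,\theta\rangle$, the symbol $\langle-,-\rangle$ denotes the corresponding $\mathrm{Ad}$-invariant inner product on $\mathfrak{g}$, so $\langle\theta,\theta\rangle(V,W)=\langle\theta(V),\theta(W)\rangle$. For a Riemannian metric $g$, $d_g$ denotes its Riemannian distance. $d_{GH}$ is the Gromov-Hausdorff distance between compact metric spaces: $d_{GH}((X,d_X),(Y,d_Y))=\frac12\inf_{\mathscr R}\mathrm{dis}(\mathscr R)$, where $\mathscr R$ ranges over correspondences between $X$ and $Y$ (subsets of $X\times Y$ projecting onto both factors) and $\mathrm{dis}(\mathscr R)=\sup\{|d_X(x,x')-d_Y(y,y')|:(x,y),(x',y')\in\mathscr R\}$. *)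

(* Defs.v *)
(* MathComp / MathComp-Analysis.

   Smooth manifolds, Lie groups, principal bundles and connections, Riemannian
   metrics and distances, and the Gromov-Hausdorff distance.  A tangent vector
   at x is written as its coordinate vector in the preferred chart at x, so
   that every tangent space of an n-manifold has carrier 'rV[R]_n. *)
From HB Require Import structures.
From mathcomp Require Import all_boot all_order all_algebra.
From mathcomp Require Import all_classical all_reals all_analysis.

Set Implicit Arguments.
Unset Strict Implicit.
Unset Printing Implicit Defensive.
Import Order.TTheory GRing.Theory Num.Theory.
Import numFieldNormedType.Exports.
Local Open Scope classical_set_scope.
Local Open Scope ring_scope.

Fixpoint Ck_on {R : realType} {V W : normedModType R} (k : nat)
    (U : set V) (f : V -> W) : Prop :=
  match k with
  | 0%N => forall x, U x -> {for x, continuous f}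
  | k'.+1 => (forall x, U x -> differentiable f x) /\
             (forall v, Ck_on k' U (fun x => 'D_v f x))
  end.

(* Only used for open U. *)
Definition smooth_on {R : realType} {V W : normedModType R}
    (U : set V) (f : V -> W) : Prop := forall k, Ck_on k U f.

(* The smooth structure is given by an atlas consisting of one preferred chart
   around each point; [chart_inv x] is meaningful on [chart_img x] only. *)
HB.mixin Record isManifold (R : realType) (n : nat) M of Topological M := {
  chart_dom : M -> set M;
  chart : M -> M -> 'rV[R]_n;
  chart_inv : M -> 'rV[R]_n -> M;
  mfd_hausdorff : hausdorff_space M;
  mfd_second_countable : @second_countable M;
  chart_dom_open : forall x, open (chart_dom x);
  chart_dom_base : forall x, chart_dom x x;
  chart_img_open : forall x, open (chart x @` chart_dom x);
  chartK : forall x y, chart_dom x y -> chart_inv x (chart x y) = y;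
  chart_cont : forall x y, chart_dom x y -> {for y, continuous (chart x)};
  chart_inv_cont : forall x a, (chart x @` chart_dom x) a ->
    {for a, continuous (chart_inv x)};
  chart_transition : forall x y,
    smooth_on (chart x @` (chart_dom x `&` chart_dom y))
              (chart y \o chart_inv x)
}.

#[short(type="manifoldType")]
HB.structure Definition Manifold (R : realType) (n : nat) :=
  {M of Topological M & isManifold R n M}.

Definition chart_img {R : realType} {n} {M : manifoldType R n} (x : M) :
    set 'rV[R]_n :=
  chart x @` chart_dom x.

(* Smoothness of a map from an open subset of a normed space to a manifold. *)
Definition smooth_into {R : realType} {V : normedModType R} {n}
    {N : manifoldType R n} (U : set V) (f : V -> N) : Prop :=
  (forall a, U a -> {for a, continuous f}) /\
  (forall y : N, smooth_on (U `&` f @^-1` chart_dom y) (chart y \o f)).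

Definition smooth_map {R : realType} {m n} {M : manifoldType R m}
    {N : manifoldType R n} (U : set M) (f : M -> N) : Prop :=
  forall x : M, smooth_into (chart x @` (chart_dom x `&` U)) (f \o chart_inv x).

(* Smoothness on an open U of the product manifold M * N, in product charts. *)
Definition smooth_map2 {R : realType} {m n k} {M : manifoldType R m}
    {N : manifoldType R n} {Q : manifoldType R k}
    (U : set (M * N)) (f : M -> N -> Q) : Prop :=
  forall (x : M) (y : N),
    smooth_into
      [set ab : 'rV[R]_m * 'rV[R]_n |
        [/\ chart_img x ab.1, chart_img y ab.2 &
            U (chart_inv x ab.1, chart_inv y ab.2)]]
      (fun ab => f (chart_inv x ab.1) (chart_inv y ab.2)).

Definition tangent_map {R : realType} {m n} {M : manifoldType R m}
    {N : manifoldType R n} (f : M -> N) (x : M) (v : 'rV[R]_m) : 'rV[R]_n :=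
  'd (chart (f x) \o f \o chart_inv x) (chart x x) v.

(* The tangent vector at [chart_inv x a] with coordinates v in the chart at x,
   i.e. the value there of a constant-coefficient coordinate vector field. *)
Definition coord_field {R : realType} {n} {M : manifoldType R n} (x : M)
    (v a : 'rV[R]_n) : 'rV[R]_n :=
  'd (chart (chart_inv x a) \o chart_inv x) a v.

Definition velocity {R : realType} {n} {M : manifoldType R n} (c : R -> M)
    (t : R) : 'rV[R]_n :=
  derive1 (chart (c t) \o c) t.

(* [s] lists the breakpoints of c : [0,1] -> M, without the initial 0.  On each
   closed piece, c is smooth up to and including the endpoints. *)
Definition piecewise_smooth {R : realType} {n} {M : manifoldType R n}
    (c : R -> M) (s : seq R) : Prop :=
  [/\ path <%R 0 s, last 0 s = 1 &
    forall i, (i < size s)%N ->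
      exists (U : set R) (e : R -> M),
        [/\ open U, `[nth 0 (0 :: s) i, nth 0 s i] `<=` U,
            @smooth_into R R n M U e &
            {in `[nth 0 (0 :: s) i, nth 0 s i], c =1 e}]].

Definition riemannian_metric {R : realType} {n} {M : manifoldType R n}
    (g : M -> 'rV[R]_n -> 'rV[R]_n -> R) : Prop :=
  [/\ forall x v, scalar (g x v),
      forall x v w, g x v w = g x w v,
      forall x v, v != 0 -> 0 < g x v v &
      forall (x : M) (v w : 'rV[R]_n),
        @smooth_on R 'rV[R]_n R (chart_img x)
          (fun a => g (chart_inv x a) (coord_field x v a) (coord_field x w a))].

(* At the finitely many breakpoints [velocity c] may be meaningless, which does
   not affect the integral. *)
Definition curve_length {R : realType} {n} {M : manifoldType R n}
    (g : M -> 'rV[R]_n -> 'rV[R]_n -> R) (c : R -> M) : R :=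
  (\int[@lebesgue_measure R]_(t in `[0, 1])
     Num.sqrt (g (c t) (velocity c t) (velocity c t)))%R.

Definition riemannian_dist {R : realType} {n} {M : manifoldType R n}
    (g : M -> 'rV[R]_n -> 'rV[R]_n -> R) (p q : M) : R :=
  inf [set L | exists (c : R -> M) (s : seq R),
    [/\ piecewise_smooth c s, c 0 = p, c 1 = q & L = curve_length g c]].

Definition isometric_map {R : realType} {m n} {M : manifoldType R m}
    {N : manifoldType R n} (gM : M -> 'rV[R]_m -> 'rV[R]_m -> R)
    (gN : N -> 'rV[R]_n -> 'rV[R]_n -> R) (f : M -> N) : Prop :=
  forall x v w, gN (f x) (tangent_map f x v) (tangent_map f x w) = gM x v w.

Definition submersion {R : realType} {m n} {M : manifoldType R m}
    {N : manifoldType R n} (f : M -> N) : Prop :=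
  smooth_map setT f /\ forall x w, exists v, tangent_map f x v = w.

(* df_x is isometric on the orthogonal complement of its kernel. *)
Definition riemannian_submersion {R : realType} {m n} {M : manifoldType R m}
    {N : manifoldType R n} (gM : M -> 'rV[R]_m -> 'rV[R]_m -> R)
    (gN : N -> 'rV[R]_n -> 'rV[R]_n -> R) (f : M -> N) : Prop :=
  submersion f /\
  forall x v w,
    (forall k, tangent_map f x k = 0 -> gM x v k = 0) ->
    (forall k, tangent_map f x k = 0 -> gM x w k = 0) ->
    gN (f x) (tangent_map f x v) (tangent_map f x w) = gM x v w.

HB.mixin Record isLieGroup (R : realType) (n : nat) G
    of Group G & Manifold R n G := {
  mulg_smooth : smooth_map2 [set: G * G] (fun x y : G => (x * y)%g);
  invg_smooth : smooth_map [set: G] (fun x : G => (x^-1)%g)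
}.

(* The Lie algebra is the tangent space at 1, hence 'rV[R]_n. *)
#[short(type="lieGroupType")]
HB.structure Definition LieGroup (R : realType) (n : nat) :=
  {G of Group G & Manifold R n G & isLieGroup R n G}.

Definition Ad {R : realType} {n} {G : lieGroupType R n} (g : G)
    (xi : 'rV[R]_n) : 'rV[R]_n :=
  tangent_map (fun x : G => (g * x * g^-1)%g) 1%g xi.

Definition bi_invariant_metric {R : realType} {n} {G : lieGroupType R n}
    (g : G -> 'rV[R]_n -> 'rV[R]_n -> R) : Prop :=
  [/\ riemannian_metric g,
      forall h : G, isometric_map g g (fun x => (h * x)%g) &
      forall h : G, isometric_map g g (fun x => (x * h)%g)].

(* Local trivializations over U are written as p |-> (proj p, phi p), with
   inverse (x, g) |-> sigma x g. *)
Definition principal_bundle {R : realType} {m d k} {M : manifoldType R m}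
    {G : lieGroupType R d} {P : manifoldType R k}
    (proj : P -> M) (act : P -> G -> P) : Prop :=
  [/\ smooth_map setT proj /\ smooth_map2 setT act,
      (forall p, act p 1%g = p) /\
      (forall p g h, act (act p g) h = act p (g * h)%g),
      forall p g, act p g = p -> g = 1%g,
      forall p g, proj (act p g) = proj p &
      forall x : M, exists (U : set M) (phi : P -> G) (sigma : M -> G -> P),
        [/\ open U /\ U x,
            smooth_map (proj @^-1` U) phi /\
            smooth_map2 [set xg | U xg.1] sigma,
            forall p, U (proj p) -> sigma (proj p) (phi p) = p,
            forall y g, U y -> proj (sigma y g) = y /\ phi (sigma y g) = g &
            forall p g, U (proj p) -> phi (act p g) = (phi p * g)%g]].

Definition fundamental_field {R : realType} {d k} {G : lieGroupType R d}
    {P : manifoldType R k} (act : P -> G -> P) (xi : 'rV[R]_d) (p : P) :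
    'rV[R]_k :=
  tangent_map (act p) 1%g xi.

Definition principal_connection {R : realType} {d k} {G : lieGroupType R d}
    {P : manifoldType R k} (act : P -> G -> P)
    (theta : P -> 'rV[R]_k -> 'rV[R]_d) : Prop :=
  [/\ forall p, linear (theta p),
      forall (x : P) (v : 'rV[R]_k),
        smooth_on (chart_img x)
          (fun a => theta (chart_inv x a) (coord_field x v a)),
      forall p g v,
        theta (act p g) (tangent_map (act^~ g) p v) = Ad g^-1%g (theta p v) &
      forall p xi, theta p (fundamental_field act xi p) = xi].

(* At the breakpoints the one-sided velocities are then in ker theta as well,
   by continuity. *)
Definition horizontally_joined {R : realType} {d k} {P : manifoldType R k}
    (theta : P -> 'rV[R]_k -> 'rV[R]_d) (p q : P) : Prop :=
  exists (c : R -> P) (s : seq R),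
    [/\ piecewise_smooth c s, c 0 = p, c 1 = q &
        forall t, 0 < t < 1 -> t \notin s -> theta (c t) (velocity c t) = 0].

Definition holonomy {R : realType} {d k} {G : lieGroupType R d}
    {P : manifoldType R k} (act : P -> G -> P)
    (theta : P -> 'rV[R]_k -> 'rV[R]_d) (u : P) : set G :=
  [set g | horizontally_joined theta u (act u g)].

(* rho : G -> Q presents the manifold Q as the homogeneous space G/H of left
   cosets: a smooth submersion onto Q whose fibres are the cosets xH.  For H a
   closed subgroup such a pair exists and is unique up to a unique
   diffeomorphism compatible with the projections. *)
Definition homogeneous_space {R : realType} {d l} {G : lieGroupType R d}
    {Q : manifoldType R l} (H : set G) (rho : G -> Q) : Prop :=
  [/\ submersion rho,
      forall q, exists x, rho x = q &
      forall x y, rho x = rho y <-> H (x^-1 * y)%g].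

(* tau is the translation xH |-> hxH of Q = G/H. *)
Definition G_invariant_metric {R : realType} {d l} {G : lieGroupType R d}
    {Q : manifoldType R l} (rho : G -> Q)
    (gQ : Q -> 'rV[R]_l -> 'rV[R]_l -> R) : Prop :=
  forall (h : G) (tau : Q -> Q),
    (forall x, tau (rho x) = rho (h * x)%g) -> isometric_map gQ gQ tau.

(* a * pi^* gM + <theta, theta> *)
Definition connection_metric {R : realType} {m d k} {M : manifoldType R m}
    {P : manifoldType R k} (proj : P -> M)
    (gM : M -> 'rV[R]_m -> 'rV[R]_m -> R) (ip : 'rV[R]_d -> 'rV[R]_d -> R)
    (theta : P -> 'rV[R]_k -> 'rV[R]_d) (a : R) :
    P -> 'rV[R]_k -> 'rV[R]_k -> R :=
  fun p v w =>
    a * gM (proj p) (tangent_map proj p v) (tangent_map proj p w)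
    + ip (theta p v) (theta p w).

Definition correspondence {X Y : Type} (C : set (X * Y)) : Prop :=
  (forall x, exists y, C (x, y)) /\ (forall y, exists x, C (x, y)).

Definition distortion {R : realType} {X Y : Type} (dX : X -> X -> R)
    (dY : Y -> Y -> R) (C : set (X * Y)) : \bar R :=
  ereal_sup [set e | exists a b,
    [/\ C a, C b & e = (`|dX a.1 b.1 - dY a.2 b.2|)%:E]].

Definition GH_dist {R : realType} {X Y : Type} (dX : X -> X -> R)
    (dY : Y -> Y -> R) : \bar R :=
  ((2^-1)%:E * ereal_inf [set distortion dX dY C | C in correspondence])%E.

(* Main.v *)
(* Write p ~ q when p and q are joined by a horizontal path, and let u be the
   base point.  The correspondence {(p, rho g) | u ~ p g} between P and Q has
   small distortion near T, for two reasons.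

   A curve e in P has near each parameter s a horizontal lift e x, where x
   solves x' x^-1 = - theta(e') in G with x(s) = 1; so u ~ e(s) g implies
   u ~ e(r) x(r) g.  As rho does not increase lengths and |x'| is at most the
   g_t-speed of e at s, rho(x g) moves no faster than e.  Hence
   d_Q(rho g, rho g') <= d_t(p, p') for every t.

   Conversely a curve in Q lifts to G with the same speed up to an arbitrarily
   small error, and x |-> u x^-1 maps G isometrically into a fibre of P for every
   g_t.  Horizontal paths have g_t-length O(sqrt(f t)), so such lifts can be
   joined at no cost in the limit, and d_t(p, p') <= d_Q(rho g, rho g') + eps for
   t close to T.  This is uniform in (p, p') because P is compact and
   d_t <= d_1 as soon as f t <= 1, where d_1 is the distance for f = 1.

   In both directions the estimate is additive along curves and holds
   infinitesimally, hence integrates by induction on intervals. *)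

Require Import Defs.
From HB Require Import structures.
From mathcomp Require Import all_boot all_order all_algebra.
From mathcomp Require Import all_classical all_reals all_analysis.
From mathcomp Require Import measurable_realfun ring lra.

Set Implicit Arguments.
Unset Strict Implicit.
Unset Printing Implicit Defensive.
Import Order.TTheory GRing.Theory Num.Theory.
Import numFieldNormedType.Exports.
Local Open Scope classical_set_scope.
Local Open Scope ring_scope.

(** * Smooth maps between normed spaces *)

Section Ck.
Context {R : realType}.
Implicit Types V W Z : normedModType R.

(** A Riemannian distance is the infimum of a set of reals that may be empty, and inequalities
    between such infima are worthless unless connecting paths exist. Most of the proof therefore
    handles [len_le g K p q], the existence of a path of speed at most [K], and turns to distances
    last.

    One principle, [length_subadditive], makes every passage from infinitesimal to global: a
    relation between two points and a number that is additive, monotone in the number and bounded to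
    first order by the speed is bounded by the length. It is applied to [len_le] itself, to
    horizontal reachability, and to the two comparisons of P with Q. Lifts are thus needed only near
    a single parameter: the equation for x is solved only locally, and a lift through rho has to be
    differentiable at that parameter only, so that an open mapping theorem with a linear estimate
    replaces smooth local sections.

    A further obstacle is the coordinate form of tangent vectors: the preferred chart may jump from
    point to point, so [velocity] need not be continuous even along a smooth curve. Continuity and
    smoothness are always tested in one fixed chart. *)

Lemma Ck_on_pointwise V W k (U : set V) (f : V -> W) :
  Ck_on k U f <-> forall x, U x -> Ck_on k [set x] f.
Proof.
elim: k f => [|k IH] f /=.
  split=> [H x Ux _ ->|H x Ux]; first exact: H.
  exact: (H x Ux x erefl).
split=> [[df cf] x Ux|H].
  split=> [_ ->|v]; first exact: df.
  exact: ((IH _).1 (cf v)).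
split=> [x /H[dx _]|v]; first exact: dx.
by apply/IH => x /H[_].
Qed.

Lemma near_eq_diff V W (f g : V -> W) x :
  (\near x, f x = g x) -> differentiable f x ->
  differentiable g x /\ forall v, 'd g x v = 'd f x v.
Proof.
move=> fg df.
have dfc : continuous ('d f x) by exact: diff_continuous.
have gx : g \o shift x = cst (g x) + 'd f x +o_ 0 id.
  apply/eqaddoP => e e0.
  have /eqaddoP/(_ e e0) := diff_locally df.
  have : \forall h \near 0, f (h + x) = g (h + x).
    move: (fg); rewrite (near_shift 0) /=; apply: filterS => h /=.
    by rewrite subr0.
  apply: filterS2 => h /= fgh.
  by rewrite !fctE /= -fgh -(nbhs_singleton fg).
have dg : 'd g x = 'd f x :> (V -> W) by exact: diff_unique.
split; last by move=> v; exact: (congr1 (fun F : V -> W => F v) dg).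
apply/diff_locallyP; rewrite dg.
by split.
Qed.

(** [Ck_on k [set x]] depends only on the germ at [x]: directional derivatives of germ-equal
    functions are germ-equal, which keeps the induction going. *)
Lemma Ck_on_near V W k (f g : V -> W) x : (\near x, f x = g x) ->
  Ck_on k [set x] f -> Ck_on k [set x] g.
Proof.
elim: k f g => [|k IH] f g fg /=.
  move=> /(_ x erefl) cf _ ->.
  rewrite /prop_for /continuous_at -(nbhs_singleton fg).
  exact/(cvg_trans _ cf)/near_eq_cvg.
move=> [/(_ x erefl) df cf]; split=> [_ ->|v].
  by have [] := near_eq_diff fg df.
apply: IH (cf v); move/nbhs_interior: fg; apply: filterS => y.
exact: near_eq_derive.
Qed.

Lemma Ck_on_eq V W k (U : set V) (f g : V -> W) : open U ->
  (forall x, U x -> f x = g x) -> Ck_on k U f -> Ck_on k U g.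
Proof.
move=> oU fg /Ck_on_pointwise cf; apply/Ck_on_pointwise => x Ux.
apply: Ck_on_near (cf x Ux).
by near=> y; apply: fg; near: y; exact: open_nbhs_nbhs.
Unshelve. all: by end_near. Qed.

Lemma Ck_on_sub V W k (U U' : set V) (f : V -> W) : U' `<=` U ->
  Ck_on k U f -> Ck_on k U' f.
Proof.
move=> UU' /Ck_on_pointwise cf; apply/Ck_on_pointwise => x /UU'.
exact: cf.
Qed.

Lemma Ck_onS V W k (U : set V) (f : V -> W) : Ck_on k.+1 U f -> Ck_on k U f.
Proof.
elim: k f => [|k IH] f /=.
  by move=> [df _] x Ux; apply/differentiable_continuous/df.
by move=> [df cf]; split => // v; apply: IH; exact: cf.
Qed.

Lemma Ck_on_cst V W k (U : set V) (c : W) : Ck_on k U (cst c).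
Proof.
elim: k c => [|k IH] c /=; first by move=> x _; exact: cst_continuous.
split=> [x _|v]; first exact: differentiable_cst.
rewrite (_ : (fun x => _) = cst 0); first exact: IH.
by apply/funext => x; rewrite derive_cst.
Qed.

Lemma Ck_onD V W k (U : set V) (f g : V -> W) : open U ->
  Ck_on k U f -> Ck_on k U g -> Ck_on k U (fun x => f x + g x).
Proof.
move=> oU; elim: k f g => [|k IH] f g /=.
  by move=> cf cg x Ux; apply: continuousD; [exact: cf|exact: cg].
move=> [df cf] [dg cg]; split=> [x Ux|v].
  by apply: differentiableD; [exact: df|exact: dg].
apply: (Ck_on_eq (f := fun x => 'D_v f x + 'D_v g x)) => //; last exact: IH.
move=> x Ux; rewrite -deriveD //; apply: diff_derivable; [exact: df|exact: dg].
Qed.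

(** The Leibniz rule is the chain rule for the continuous bilinear map [B], scalar multiplication,
    composed with the pair of [a] and [f]. *)
Lemma scale_diff V W (a : V -> R) (f : V -> W) x :
  differentiable a x -> differentiable f x ->
  differentiable (fun x => a x *: f x) x /\
  'd (fun x => a x *: f x) x = (fun v => 'd a x v *: f x + a x *: 'd f x v) :> (V -> W).
Proof.
move=> da df.
pose sc (a : R) (w : W) := a *: w.
have bsc : bilinear_for (GRing.Scale.Law.clone _ _ *:%R _)
    (GRing.Scale.Law.clone _ _ *:%R _) sc.
  split=> [w|b] c y z; rewrite /sc /=; first by rewrite scalerDl scalerA.
  by rewrite scalerDr !scalerA mulrC.
pose B : {bilinear R -> W -> W} :=
  HB.pack sc (bilinear_isBilinear.Build R R W W _ _ sc bsc).
have cB : continuous (fun p : R * W => B p.1 p.2) by exact: scale_continuous.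
have dB := differentiable_bilin (f := B) (a x, f x) cB.
have dp := differentiable_pair da df.
split; first by apply: (differentiable_comp dp dB).
have := diff_comp dp dB; rewrite (diff_bilin _ cB) diff_pair // => H.
rewrite -[LHS]/('d ((fun p => B p.1 p.2) \o (fun y => (a y, f y))) x : V -> W) H.
by apply/funext => v /=; rewrite addrC.
Qed.

Lemma Ck_on_scale V W k (U : set V) (a : V -> R) (f : V -> W) : open U ->
  Ck_on k U a -> Ck_on k U f -> Ck_on k U (fun x => a x *: f x).
Proof.
move=> oU; elim: k a f => [|k IH] a f /=.
  by move=> ca cf x Ux; apply: continuousZ; [exact: ca|exact: cf].
move=> [da ca] [df cf]; split=> [x Ux|v].
  by have [] := scale_diff (da _ Ux) (df _ Ux).
apply: (Ck_on_eq (f := fun x => 'D_v a x *: f x + a x *: 'D_v f x)) => //.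
  move=> x Ux; have [dx eqx] := scale_diff (da _ Ux) (df _ Ux).
  rewrite [RHS]deriveE // eqx !deriveE //; [exact: df|exact: da].
apply: Ck_onD => //; apply: IH => //.
- by apply: (@Ck_onS _ _ k); split.
- by apply: (@Ck_onS _ _ k); split.
Qed.

Lemma Ck_on_lin V W Z k (U : set V) (L : {linear W -> Z}) (f : V -> W) :
  open U -> continuous L -> Ck_on k U f -> Ck_on k U (fun x => L (f x)).
Proof.
move=> oU cL; elim: k f => [|k IH] f /=.
  by move=> cf x Ux; apply: continuous_comp; [exact: cf|exact: cL].
move=> [df cf]; split=> [x Ux|v].
  by apply: differentiable_comp; [exact: df|exact: linear_differentiable].
apply: (Ck_on_eq (f := fun x => L ('D_v f x))) => //; last exact: IH.
move=> x Ux.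
have dL : differentiable L (f x) by exact: linear_differentiable.
rewrite [RHS]deriveE; last by apply: differentiable_comp => //; exact: df.
rewrite -[X in 'd X x](_ : L \o f = _) // diff_comp //=; last exact: df.
by rewrite diff_lin // deriveE //; exact: df.
Qed.

Lemma Ck_on_sum V W k n (U : set V) (f : 'I_n -> V -> W) : open U ->
  (forall i, Ck_on k U (f i)) -> Ck_on k U (fun x => \sum_(i < n) f i x).
Proof.
move=> oU; elim: n f => [|n IH] f cf.
  rewrite (_ : (fun x => _) = cst 0); first exact: Ck_on_cst.
  by apply/funext => x; rewrite big_ord0.
rewrite (_ : (fun x => _) = fun x => f ord0 x + \sum_(i < n) f (lift ord0 i) x).
  by apply: Ck_onD => //; apply: IH.
by apply/funext => x; rewrite big_ord_recl.
Qed.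

Lemma Ck_on_pair V W Z k (U : set V) (f : V -> W) (g : V -> Z) : open U ->
  Ck_on k U f -> Ck_on k U g -> Ck_on k U (fun x => (f x, g x)).
Proof.
move=> oU; elim: k f g => [|k IH] f g /=.
  by move=> cf cg x Ux; apply: cvg_pair; [exact: cf|exact: cg].
move=> [df cf] [dg cg]; split=> [x Ux|v].
  by apply: differentiable_pair; [exact: df|exact: dg].
apply: (Ck_on_eq (f := fun x => ('D_v f x, 'D_v g x))) => //; last exact: IH.
move=> x Ux; have dfx := df x Ux; have dgx := dg x Ux.
rewrite [RHS]deriveE; last exact: differentiable_pair.
by rewrite diff_pair //= !deriveE.
Qed.

(** Finite-dimensionality in the form used by the chain rule: continuous coordinate functionals with
    a reconstruction formula. Independence of the [b i] is not part of it, so products are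
    immediate. *)
Definition has_basis (W : normedModType R) : Prop :=
  exists n (phi : 'I_n -> {linear W -> R}) (b : 'I_n -> W),
    (forall i, continuous (phi i)) /\ forall w, w = \sum_i phi i w *: b i.

(** [Ck_on] differentiates along fixed vectors, while the chain rule differentiates [g] along the
    moving vector ['D_v f x]. Expanding that vector in a basis of [W] leaves only the fixed
    directions [b i], to which the induction applies. *)
Lemma Ck_on_comp V W Z k (U : set V) (U' : set W) (f : V -> W) (g : W -> Z) :
  has_basis W -> open U -> (forall x, U x -> U' (f x)) ->
  Ck_on k U f -> Ck_on k U' g -> Ck_on k U (g \o f).
Proof.
move=> [n [phi [b [cphi Hb]]]] oU UU'; elim: k g => [|k IH] g.
  by move=> cf cg x Ux; apply: continuous_comp; [exact: cf|exact: cg (UU' _ Ux)].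
move=> cf0 [dg cg]; have [df cf] := cf0; split=> [x Ux|v].
  by apply: differentiable_comp; [exact: df|exact/dg/UU'].
apply: (Ck_on_eq (f := fun x => \sum_i phi i ('D_v f x) *: ('D_(b i) g \o f) x)) => //.
  move=> x Ux; have dfx := df x Ux; have dgx := dg _ (UU' _ Ux).
  rewrite [RHS]deriveE; last exact: differentiable_comp.
  rewrite diff_comp //= -(deriveE v dfx) {2}(Hb ('D_v f x)) linear_sum.
  by apply: eq_bigr => i _; rewrite linearZ (deriveE (b i) dgx).
apply: Ck_on_sum => // i; apply: Ck_on_scale => //; first by apply: (Ck_on_lin (L := phi i)) => //; exact: cf.
exact: (IH _ (Ck_onS cf0) (cg (b i))).
Qed.

Lemma has_basis_rV n : has_basis 'rV[R]_n.
Proof.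
pose phi (i : 'I_n) (w : 'rV[R]_n) := w 0 i.
have lphi i : linear (phi i) by move=> a u w; rewrite /phi !mxE.
pose phiL i : {linear 'rV[R]_n -> R} := HB.pack (phi i) (GRing.isLinear.Build _ _ _ _ _ (lphi i)).
exists n, phiL, (delta_mx 0); split; first by move=> i; exact: coord_continuous.
by move=> w; exact: row_sum_delta.
Qed.

Lemma has_basis_R : has_basis R.
Proof.
pose phi : {linear R -> R} := idfun.
exists 1%N, (fun=> phi), (fun=> 1); split; first by move=> i x; exact: cvg_id.
by move=> w; rewrite big_ord1 /= [RHS]mulr1.
Qed.

Lemma has_basis_prod V W : has_basis V -> has_basis W -> has_basis (V * W)%type.
Proof.
move=> [n [phi [b [cphi Hb]]]] [m [psi [c [cpsi Hc]]]].
pose F (i : 'I_(n + m)) (p : V * W) : R :=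
  match fintype.split i with inl j => phi j p.1 | inr j => psi j p.2 end.
have lF i : linear (F i).
  by rewrite /F; case: (fintype.split i) => j a u w /=; rewrite linearP.
pose FL i : {linear (V * W)%type -> R} := HB.pack (F i) (GRing.isLinear.Build _ _ _ _ _ (lF i)).
exists (n + m)%N, FL, (fun i => match fintype.split i with inl j => (b j, 0) | inr j => (0, c j) end).
split.
  move=> i; rewrite /FL /= /F; case: (fintype.split i) => j x /=.
    by apply: (continuous_comp (f := fst)); [exact: cvg_fst|exact: cphi].
  by apply: (continuous_comp (f := snd)); [exact: cvg_snd|exact: cpsi].
move=> [v w]; rewrite big_split_ord /=.
under eq_bigr => i _ do rewrite /F (unsplitK (inl i)) /=.
under [X in _ + X]eq_bigr => i _ do rewrite /F (unsplitK (inr i)) /=.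
rewrite [RHS]surjective_pairing /= !(big_morph fst (fun=> fun=> erefl) erefl).
rewrite !(big_morph snd (fun=> fun=> erefl) erefl) /=.
congr pair.
  by rewrite [X in _ = _ + X]big1 ?addr0 => [|i _]; rewrite ?scaler0 // -Hb.
by rewrite [X in _ = X + _]big1 ?add0r => [|i _]; rewrite ?scaler0 // -Hc.
Qed.

End Ck.

(** * Germs of smooth maps *)

Section Germs.
Context {R : realType}.
Implicit Types V W Z : normedModType R.

(* [smooth_near] and [msmooth] are the germ forms of [smooth_on] and
   [smooth_into]: they compose without any bookkeeping of domains. *)
Definition smooth_near V W (f : V -> W) (t : V) : Prop :=
  \forall x \near t, forall k, Ck_on k [set x] f.

Lemma smooth_on_near V W (U : set V) (f : V -> W) t :
  open U -> smooth_on U f -> U t -> smooth_near f t.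
Proof.
move=> oU sf Ut; near=> x => k.
have Ux : U x by near: x; exact: open_nbhs_nbhs.
exact: ((Ck_on_pointwise _ _ _).1 (sf k)).
Unshelve. all: by end_near. Qed.

Lemma near_smooth_on V W (U : set V) (f : V -> W) :
  (forall t, U t -> smooth_near f t) -> smooth_on U f.
Proof.
move=> sf k; apply/Ck_on_pointwise => x /sf/nbhs_singleton; exact.
Qed.

Lemma smooth_near_open V W (f : V -> W) t : smooth_near f t ->
  exists U, [/\ open U, U t & smooth_on U f].
Proof.
move=> sf; exists (interior [set x | forall k, Ck_on k [set x] f]).
split; [exact: open_interior|exact: sf|move=> k; apply/Ck_on_pointwise => x].
by move/interior_subset; exact.
Qed.

Lemma smooth_near_near V W (f : V -> W) t : smooth_near f t ->
  \forall x \near t, smooth_near f x.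
Proof. exact: nbhs_interior. Qed.

Lemma smooth_near_diff V W (f : V -> W) t : smooth_near f t -> differentiable f t.
Proof. by move=> /nbhs_singleton/(_ 1%N)[+ _]; exact. Qed.

Lemma smooth_near_cont V W (f : V -> W) t :
  smooth_near f t -> {for t, continuous f}.
Proof. by move=> /smooth_near_diff/differentiable_continuous. Qed.

Lemma eq_smooth_near V W (f g : V -> W) t : (\near t, f t = g t) ->
  smooth_near f t -> smooth_near g t.
Proof.
move=> /nbhs_interior; apply: filterS2 => x /= fg sf k.
exact: Ck_on_near fg (sf k).
Qed.

Lemma smooth_near_cst V W (c : W) (t : V) : smooth_near (fun=> c) t.
Proof. by apply: nearW => x k; exact: Ck_on_cst. Qed.

Lemma smooth_nearD V W (f g : V -> W) t : smooth_near f t -> smooth_near g t ->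
  smooth_near (fun x => f x + g x) t.
Proof.
move=> /smooth_near_open[U [oU Ut sf]] /smooth_near_open[U' [oU' Ut' sg]].
have oI : open (U `&` U') by exact: openI.
apply: (smooth_on_near oI) => // k; apply: Ck_onD => //.
  by apply: Ck_on_sub (sf k) => ? [].
by apply: Ck_on_sub (sg k) => ? [].
Qed.

Lemma smooth_near_pair V W Z (f : V -> W) (g : V -> Z) t :
  smooth_near f t -> smooth_near g t -> smooth_near (fun x => (f x, g x)) t.
Proof.
move=> /smooth_near_open[U [oU Ut sf]] /smooth_near_open[U' [oU' Ut' sg]].
have oI : open (U `&` U') by exact: openI.
apply: (smooth_on_near oI) => // k; apply: Ck_on_pair => //.
  by apply: Ck_on_sub (sf k) => ? [].
by apply: Ck_on_sub (sg k) => ? [].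
Qed.

Lemma smooth_near_scale V W (a : V -> R) (f : V -> W) t :
  smooth_near a t -> smooth_near f t -> smooth_near (fun x => a x *: f x) t.
Proof.
move=> /smooth_near_open[U [oU Ut sf]] /smooth_near_open[U' [oU' Ut' sg]].
have oI : open (U `&` U') by exact: openI.
apply: (smooth_on_near oI) => // k; apply: Ck_on_scale => //.
  by apply: Ck_on_sub (sf k) => ? [].
by apply: Ck_on_sub (sg k) => ? [].
Qed.

Lemma smooth_near_sum V W n (f : 'I_n -> V -> W) t :
  (forall i, smooth_near (f i) t) -> smooth_near (fun x => \sum_(i < n) f i x) t.
Proof.
elim: n f => [|n IH] f sf.
  rewrite (_ : (fun x => _) = fun=> 0); first exact: smooth_near_cst.
  by apply/funext => x; rewrite big_ord0.
rewrite (_ : (fun x => _) = fun x => f ord0 x + \sum_(i < n) f (lift ord0 i) x).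
  by apply: smooth_nearD => //; apply: IH.
by apply/funext => x; rewrite big_ord_recl.
Qed.

Lemma smooth_near_lin V W Z (L : {linear W -> Z}) (f : V -> W) t :
  continuous L -> smooth_near f t -> smooth_near (fun x => L (f x)) t.
Proof.
move=> cL /smooth_near_open[U [oU Ut sf]].
by apply: (smooth_on_near oU) => // k; exact: Ck_on_lin.
Qed.

Lemma smooth_near_id V (t : V) : smooth_near (fun x => x) t.
Proof.
apply: nearW => x; elim=> [|k IH] /=; first by move=> y _; exact: cvg_id.
split=> [y _|v]; first by [apply: ex_diff | apply: (@linear_differentiable R V V idfun) => z; exact: cvg_id].
rewrite (_ : (fun y => _) = cst v); first exact: Ck_on_cst.
by apply/funext => y; rewrite derive_id.
Qed.

Lemma smooth_near_comp V W Z (f : V -> W) (g : W -> Z) t : has_basis W ->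
  smooth_near f t -> smooth_near g (f t) -> smooth_near (g \o f) t.
Proof.
move=> bW sf0 sg0; have cf := smooth_near_cont sf0.
have [U [oU Ut sf]] := smooth_near_open sf0.
have [U' [oU' Ut' sg]] := smooth_near_open sg0.
have nU : nbhs t (U `&` f @^-1` U').
  apply: filterI; first exact: open_nbhs_nbhs.
  by apply: cf; exact: open_nbhs_nbhs.
have oI := open_interior (U `&` f @^-1` U').
apply: (smooth_on_near oI) => // k; apply: (Ck_on_comp bW oI) (sg k).
  by move=> x /interior_subset[].
by apply: Ck_on_sub (sf k) => x /interior_subset[].
Qed.

Lemma smooth_near_derive V W (f : V -> W) v t : smooth_near f t ->
  smooth_near ('D_v f) t.
Proof. by apply: filterS => x sf k; have [_] := sf k.+1; exact. Qed.

Lemma smooth_near_fst V W (t : V * W) : smooth_near fst t.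
Proof.
have lf : linear (@fst V W) by [].
pose L : {linear (V * W)%type -> V} := HB.pack (@fst V W) (GRing.isLinear.Build _ _ _ _ _ lf).
by apply: (smooth_near_lin (L := L)) (smooth_near_id t) => x; exact: cvg_fst.
Qed.

Lemma smooth_near_snd V W (t : V * W) : smooth_near snd t.
Proof.
have lf : linear (@snd V W) by [].
pose L : {linear (V * W)%type -> W} := HB.pack (@snd V W) (GRing.isLinear.Build _ _ _ _ _ lf).
by apply: (smooth_near_lin (L := L)) (smooth_near_id t) => x; exact: cvg_snd.
Qed.

Lemma smooth_near_coord V n (f : V -> 'rV[R]_n) i t : smooth_near f t ->
  smooth_near (fun x => f x 0 i) t.
Proof.
pose phi (w : 'rV[R]_n) := w 0 i.
have lphi : linear phi by move=> a u w; rewrite /phi !mxE.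
pose L : {linear 'rV[R]_n -> R} := HB.pack phi (GRing.isLinear.Build _ _ _ _ _ lphi).
by apply: (@smooth_near_lin _ _ _ L); exact: coord_continuous.
Qed.

End Germs.

(** * Smooth maps into manifolds and their differentials *)

Section Manifold.
Context {R : realType}.
Implicit Types V W : normedModType R.

Definition smooth_at V n (N : manifoldType R n) (c : V -> N) (t : V) : Prop :=
  {for t, continuous c} /\ forall y, chart_dom y (c t) ->
    forall k, Ck_on k [set t] (chart y \o c).

Definition msmooth V n (N : manifoldType R n) (c : V -> N) (t : V) : Prop :=
  \forall x \near t, smooth_at c x.

Lemma smooth_intoP V n (N : manifoldType R n) (U : set V) (c : V -> N) :
  smooth_into U c <-> forall t, U t -> smooth_at c t.
Proof.
split=> [[cc sc] t Ut|sc].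
  split=> [|y yt k]; first exact: cc.
  by apply: ((Ck_on_pointwise _ _ _).1 (sc y k)); split.
split=> [t /sc[]//|y k]; apply/Ck_on_pointwise => x [Ux dx].
by have [_] := sc x Ux; exact.
Qed.

Lemma smooth_into_msmooth V n (N : manifoldType R n) (U : set V) (c : V -> N) t :
  open U -> smooth_into U c -> U t -> msmooth c t.
Proof.
move=> oU /smooth_intoP sc Ut; near=> x; apply: sc; near: x.
exact: open_nbhs_nbhs.
Unshelve. all: by end_near. Qed.

Lemma msmooth_smooth_into V n (N : manifoldType R n) (U : set V) (c : V -> N) :
  (forall t, U t -> msmooth c t) -> smooth_into U c.
Proof. by move=> sc; apply/smooth_intoP => t /sc/nbhs_singleton. Qed.

Lemma msmooth_near V n (N : manifoldType R n) (c : V -> N) t : msmooth c t ->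
  \forall x \near t, msmooth c x.
Proof. exact: nbhs_interior. Qed.

Lemma msmooth_cont V n (N : manifoldType R n) (c : V -> N) t : msmooth c t ->
  {for t, continuous c}.
Proof. by move=> /nbhs_singleton[]. Qed.

Lemma eq_msmooth V n (N : manifoldType R n) (c e : V -> N) t :
  (\near t, c t = e t) -> msmooth c t -> msmooth e t.
Proof.
move=> /nbhs_interior; apply: filterS2 => x ce [cc sc]; split.
  rewrite /prop_for /continuous_at -(nbhs_singleton ce).
  exact/(cvg_trans _ cc)/near_eq_cvg.
rewrite -(nbhs_singleton ce) => y dy k; apply: Ck_on_near (sc y dy k).
by apply: filterS ce => z /= ->.
Qed.

Lemma near_chart_dom V n (N : manifoldType R n) (c : V -> N) t y :
  {for t, continuous c} -> chart_dom y (c t) ->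
  \forall x \near t, chart_dom y (c x).
Proof.
by move=> cc dy; apply: cc; apply: open_nbhs_nbhs; split => //; exact: chart_dom_open.
Qed.

Lemma msmooth_chart V n (N : manifoldType R n) (c : V -> N) t y :
  msmooth c t -> chart_dom y (c t) -> smooth_near (chart y \o c) t.
Proof.
move=> sc dy; have := near_chart_dom (msmooth_cont sc) dy.
by move: sc; apply: filterS2 => x [_ sc] dx k; exact: sc.
Qed.

Lemma chart_invP n (N : manifoldType R n) (x : N) a : chart_img x a ->
  chart_dom x (chart_inv x a) /\ chart x (chart_inv x a) = a.
Proof. by move=> [y dy <-]; rewrite chartK. Qed.

Lemma chart_img_chart n (N : manifoldType R n) (x y : N) :
  chart_dom x y -> chart_img x (chart x y).
Proof. by exists y. Qed.

Lemma chart_img_base n (N : manifoldType R n) (x : N) : chart_img x (chart x x).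
Proof. by apply: chart_img_chart; exact: chart_dom_base. Qed.

Lemma chart_inv_base n (N : manifoldType R n) (x : N) : chart_inv x (chart x x) = x.
Proof. by rewrite chartK //; exact: chart_dom_base. Qed.

Lemma near_chart_img n (N : manifoldType R n) (x : N) a : chart_img x a ->
  \forall b \near a, chart_img x b.
Proof. by move=> xa; apply: open_nbhs_nbhs; split => //; exact: chart_img_open. Qed.

Lemma msmooth_chart_inv n (N : manifoldType R n) (x : N) a :
  chart_img x a -> msmooth (chart_inv x) a.
Proof.
move=> xa; have : \forall b \near a, chart_img x b.
  by apply: open_nbhs_nbhs; split => //; exact: chart_img_open.
apply: filterS => b xb; split; first exact: chart_inv_cont.
move=> y dy k; apply: ((Ck_on_pointwise _ _ _).1 (chart_transition x y k)).
have [dx eb] := chart_invP xb; exists (chart_inv x b); last by [].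
by split.
Qed.

(** One chart suffices because transition maps are smooth. Continuity is assumed separately:
    [chart x] is a total function with arbitrary values outside [chart_dom x], so its values alone
    do not locate [c]. *)
Lemma msmooth_of_chart V n (N : manifoldType R n) (c : V -> N) t x :
  (\near t, {for t, continuous c}) -> chart_dom x (c t) ->
  smooth_near (chart x \o c) t -> msmooth c t.
Proof.
move=> cc dx sc; have ct := nbhs_singleton cc.
have := near_chart_dom ct dx; have := smooth_near_near sc; move: cc.
apply: filterS3 => s cs ss ds; split => // y dy.
suff : smooth_near (chart y \o c) s by exact: nbhs_singleton.
have xs := chart_img_chart ds.
have sy : smooth_near (chart y \o chart_inv x) (chart x (c s)).
  by apply: msmooth_chart; [exact: msmooth_chart_inv|rewrite chartK].
apply: eq_smooth_near (smooth_near_comp (@has_basis_rV R n) ss sy).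
have := near_chart_dom cs ds; apply: filterS => z dz /=.
by rewrite chartK.
Qed.

Lemma msmooth_precomp V W n (N : manifoldType R n) (f : V -> W) (c : W -> N) t :
  has_basis W -> smooth_near f t -> msmooth c (f t) -> msmooth (c \o f) t.
Proof.
move=> bW sf sc; apply: (@msmooth_of_chart _ _ _ _ _ (c (f t))).
- have cf := smooth_near_cont sf.
  have := cf _ (msmooth_near sc); rewrite nbhs_simpl /=.
  have := smooth_near_near sf; apply: filterS2 => x sx scx.
  by apply: continuous_comp; [exact: smooth_near_cont|exact: msmooth_cont].
- exact: chart_dom_base.
- apply: (smooth_near_comp bW sf (g := chart (c (f t)) \o c)).
  by apply: msmooth_chart => //; exact: chart_dom_base.
Qed.

Lemma msmooth_cst V n (N : manifoldType R n) (x : N) (t : V) :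
  msmooth (fun=> x) t.
Proof.
apply: nearW => s; split; first exact: cst_continuous.
by move=> y dy k; exact: Ck_on_cst.
Qed.

Lemma smooth_mapP m n (M : manifoldType R m) (N : manifoldType R n) (f : M -> N) :
  smooth_map setT f <-> forall x a, chart_img x a -> msmooth (f \o chart_inv x) a.
Proof.
split=> sf x; last first.
  by rewrite setIT; apply: msmooth_smooth_into => t xt; exact: sf.
move=> a xa; have := sf x; rewrite setIT => sx.
by apply: smooth_into_msmooth sx xa; exact: chart_img_open.
Qed.

Lemma chart_inv_chart_near V n (N : manifoldType R n) (c : V -> N) t x :
  {for t, continuous c} -> chart_dom x (c t) ->
  \forall s \near t, chart_inv x (chart x (c s)) = c s.
Proof.
by move=> ct dx; have := near_chart_dom ct dx; apply: filterS => s ds; rewrite chartK.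
Qed.

Lemma msmooth_map V m n (M : manifoldType R m) (N : manifoldType R n)
    (f : M -> N) (c : V -> M) t :
  smooth_map setT f -> msmooth c t -> msmooth (f \o c) t.
Proof.
move=> /smooth_mapP sf sc.
have dx := chart_dom_base (c t); set x := c t in dx *.
have sxc := msmooth_chart sc dx.
apply: eq_msmooth (msmooth_precomp (@has_basis_rV R m) sxc (sf x _ _)).
- have := chart_inv_chart_near (msmooth_cont sc) dx.
  by apply: filterS => s /= ->.
- exact: chart_img_base.
Qed.

Lemma msmooth_map2 V m n k (M : manifoldType R m) (N : manifoldType R n)
    (Q : manifoldType R k) (f : M -> N -> Q) (c : V -> M) (e : V -> N) t :
  smooth_map2 setT f -> msmooth c t -> msmooth e t ->
  msmooth (fun s => f (c s) (e s)) t.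
Proof.
move=> sf sc se.
have dx := chart_dom_base (c t); set x := c t in dx *.
have dy := chart_dom_base (e t); set y := e t in dy *.
have sp := smooth_near_pair (msmooth_chart sc dx) (msmooth_chart se dy).
have bp := has_basis_prod (@has_basis_rV R m) (@has_basis_rV R n).
apply: eq_msmooth (msmooth_precomp (c := fun ab : 'rV[R]_m * 'rV[R]_n =>
  f (chart_inv x ab.1) (chart_inv y ab.2)) bp sp _).
  have := chart_inv_chart_near (msmooth_cont sc) dx.
  have := chart_inv_chart_near (msmooth_cont se) dy.
  by apply: filterS2 => s /= -> ->.
apply: (smooth_into_msmooth _ (sf x y)).
  rewrite (_ : [set _ | _] = chart_img x `*` chart_img y); last first.
    by apply/seteqP; split => [ab []|ab []].
  rewrite openE => -[a b] [/= xa yb].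
  by exists (chart_img x, chart_img y); [split; exact: near_chart_img|].
by split => //=; exact: chart_img_base.
Qed.

End Manifold.

Section Mdiff.
Context {R : realType}.
Implicit Types V W : normedModType R.

(** [velocity], [tangent_map] and [coord_field] are all of this form, so one chain rule serves the
    three. *)
Definition mdiff V n (N : manifoldType R n) (c : V -> N) (t : V) (v : V) : 'rV[R]_n :=
  'd (chart (c t) \o c) t v.

Arguments mdiff : simpl never.

Lemma mdiffZ V n (N : manifoldType R n) (c : V -> N) t a v :
  mdiff c t (a *: v) = a *: mdiff c t v.
Proof. exact: linearZ. Qed.

Lemma mdiffD V n (N : manifoldType R n) (c : V -> N) t v w :
  mdiff c t (v + w) = mdiff c t v + mdiff c t w.
Proof. exact: linearD. Qed.

Lemma tangent_mapZ m n (M : manifoldType R m) (N : manifoldType R n)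
  (f : M -> N) x a v : tangent_map f x (a *: v) = a *: tangent_map f x v.
Proof. exact: linearZ. Qed.

Lemma tangent_mapD m n (M : manifoldType R m) (N : manifoldType R n)
  (f : M -> N) x v w :
  tangent_map f x (v + w) = tangent_map f x v + tangent_map f x w.
Proof. exact: linearD. Qed.

Lemma tangent_map0 m n (M : manifoldType R m) (N : manifoldType R n)
  (f : M -> N) x : tangent_map f x 0 = 0.
Proof. exact: linear0. Qed.

Lemma msmooth_diff V n (N : manifoldType R n) (c : V -> N) t y :
  msmooth c t -> chart_dom y (c t) -> differentiable (chart y \o c) t.
Proof. by move=> sc dy; exact/smooth_near_diff/msmooth_chart. Qed.

Lemma eq_mdiff V n (N : manifoldType R n) (c e : V -> N) t v :
  (\near t, c t = e t) -> msmooth c t -> mdiff e t v = mdiff c t v.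
Proof.
move=> ce sc; rewrite /mdiff -(nbhs_singleton ce).
have H : \forall s \near t, (chart (c t) \o c) s = (chart (c t) \o e) s.
  by apply: filterS ce => s /= ->.
by have [_] := near_eq_diff H (msmooth_diff sc (chart_dom_base _)); exact.
Qed.

Lemma mdiff_precomp V W n (N : manifoldType R n) (f : V -> W) (c : W -> N) t v :
  differentiable f t -> msmooth c (f t) ->
  mdiff (c \o f) t v = mdiff c (f t) ('d f t v).
Proof.
move=> df sc; rewrite /mdiff /=.
have dc := msmooth_diff sc (chart_dom_base _).
by rewrite -[chart _ \o (c \o f)]/((chart (c (f t)) \o c) \o f) diff_comp.
Qed.

Lemma velocityE n (N : manifoldType R n) (c : R -> N) t : msmooth c t ->
  velocity c t = mdiff c t 1.
Proof.
move=> sc; rewrite /velocity /mdiff derive1E'//.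
exact: msmooth_diff sc (chart_dom_base _).
Qed.

(** Passage from the varying preferred chart at [c t] to a fixed chart at [x]; every continuity
    argument along curves goes through it. *)
Lemma mdiff_chart V n (N : manifoldType R n) (c : V -> N) t x v :
  msmooth c t -> chart_dom x (c t) ->
  mdiff c t v = coord_field x ('d (chart x \o c) t v) (chart x (c t)).
Proof.
move=> sc dx.
have xi := chart_img_chart dx.
rewrite -[coord_field _ _ _]/(mdiff (chart_inv x) _ _).
rewrite -[chart x (c t)]/((chart x \o c) t) -mdiff_precomp.
- apply/esym/eq_mdiff => //.
  have := chart_inv_chart_near (msmooth_cont sc) dx.
  by apply: filterS => s /= ->.
- exact: msmooth_diff.
- exact: msmooth_chart_inv.
Qed.

Lemma tangent_mapE m n (M : manifoldType R m) (N : manifoldType R n)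
  (f : M -> N) x v :
  tangent_map f x v = mdiff (f \o chart_inv x) (chart x x) v.
Proof. by rewrite /mdiff /tangent_map /= chart_inv_base. Qed.

Lemma mdiff_map V m n (M : manifoldType R m) (N : manifoldType R n)
    (f : M -> N) (c : V -> M) t v :
  smooth_map setT f -> msmooth c t ->
  mdiff (f \o c) t v = tangent_map f (c t) (mdiff c t v).
Proof.
move=> sf sc; have dx := chart_dom_base (c t).
rewrite tangent_mapE /mdiff -[LHS]/(mdiff (f \o c) t v).
rewrite -[chart (c t) (c t)]/((chart (c t) \o c) t).
rewrite -[RHS]/(mdiff _ _ _) -mdiff_precomp.
- apply: eq_mdiff; last first.
    apply: msmooth_precomp => //; first exact: has_basis_rV.
      exact: msmooth_chart.
    by apply: ((smooth_mapP f).1 sf); exact: chart_img_base.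
  have := chart_inv_chart_near (msmooth_cont sc) dx.
  by apply: filterS => s /= ->.
- exact: msmooth_diff.
- by apply: ((smooth_mapP f).1 sf); exact: chart_img_base.
Qed.

Lemma tangent_map_mdiff m n (M : manifoldType R m) (N : manifoldType R n)
    (f : M -> N) x a v : smooth_map setT f -> chart_img x a ->
  tangent_map f (chart_inv x a) (coord_field x v a) = mdiff (f \o chart_inv x) a v.
Proof. by move=> sf xa; rewrite mdiff_map//; exact: msmooth_chart_inv. Qed.

Lemma coord_field_base n (N : manifoldType R n) (x : N) v :
  coord_field x v (chart x x) = v.
Proof.
rewrite /coord_field chart_inv_base.
have H : \forall a \near chart x x, id a = (chart x \o chart_inv x) a.
  by apply: filterS (near_chart_img (chart_img_base x)) => a /chart_invP[_ /= ->].
have did : differentiable (@id 'rV[R]_n) (chart x x) by exact: ex_diff.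
by have [_ E] := near_eq_diff H did; apply: etrans (E v) _; rewrite diff_val.
Qed.

Lemma smooth_map_comp m n k (M : manifoldType R m) (N : manifoldType R n)
    (Q : manifoldType R k) (f : M -> N) (g : N -> Q) :
  smooth_map setT f -> smooth_map setT g -> smooth_map setT (g \o f).
Proof.
move=> /smooth_mapP sf sg; apply/smooth_mapP => x a xa.
by apply: (msmooth_map sg (c := f \o chart_inv x)); exact: sf.
Qed.

Lemma tangent_map_comp m n k (M : manifoldType R m) (N : manifoldType R n)
    (Q : manifoldType R k) (f : M -> N) (g : N -> Q) x v :
  smooth_map setT f -> smooth_map setT g ->
  tangent_map (g \o f) x v = tangent_map g (f x) (tangent_map f x v).
Proof.
move=> sf sg; have sx := (smooth_mapP f).1 sf x _ (chart_img_base x).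
have E : (f \o chart_inv x) (chart x x) = f x by rewrite /= chart_inv_base.
rewrite tangent_mapE; apply: etrans (mdiff_map v sg sx) _.
by rewrite E -tangent_mapE.
Qed.

Lemma smooth_map_cst m n (M : manifoldType R m) (N : manifoldType R n) (y : N) :
  smooth_map setT (fun _ : M => y).
Proof. by apply/smooth_mapP => x a _; exact: msmooth_cst. Qed.

Lemma smooth_map_id m (M : manifoldType R m) : smooth_map setT (fun x : M => x).
Proof. by apply/smooth_mapP => x a; exact: msmooth_chart_inv. Qed.

Lemma mdiff_cst V n (N : manifoldType R n) (x : N) (t v : V) :
  mdiff (fun=> x) t v = 0.
Proof. exact: (congr1 (fun F : V -> 'rV[R]_n => F v) (diff_cst (chart x x) t)). Qed.

Lemma tangent_map_cst m n (M : manifoldType R m) (N : manifoldType R n) (y : N) x v :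
  tangent_map (fun _ : M => y) x v = 0.
Proof. by rewrite tangent_mapE mdiff_cst. Qed.

Lemma tangent_map_id m (M : manifoldType R m) (x : M) v :
  tangent_map (fun x : M => x) x v = v.
Proof. by rewrite tangent_mapE; exact: coord_field_base. Qed.

Lemma smooth_map2_comp m n k l (L : manifoldType R l) (M : manifoldType R m)
    (N : manifoldType R n) (Q : manifoldType R k)
    (h : M -> N -> Q) (f : L -> M) (g : L -> N) : smooth_map2 setT h ->
  smooth_map setT f -> smooth_map setT g -> smooth_map setT (fun x => h (f x) (g x)).
Proof.
move=> sh /smooth_mapP sf /smooth_mapP sg; apply/smooth_mapP => x a xa.
by apply: (msmooth_map2 sh (c := f \o chart_inv x) (e := g \o chart_inv x));
  [exact: sf|exact: sg].
Qed.

(** In product charts the differential of [H] is linear, and the pair of differentials splits as (v,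
    0) + (0, w); each summand comes from freezing one argument of [h]. *)
Lemma mdiff_map2 V m n k (M : manifoldType R m) (N : manifoldType R n)
    (Q : manifoldType R k) (h : M -> N -> Q) (c : V -> M) (e : V -> N) t v :
  smooth_map2 setT h -> msmooth c t -> msmooth e t ->
  mdiff (fun s => h (c s) (e s)) t v =
  tangent_map (h^~ (e t)) (c t) (mdiff c t v) +
  tangent_map (h (c t)) (e t) (mdiff e t v).
Proof.
move=> sh sc se.
set x := c t; set y := e t.
have dx : chart_dom x (c t) := chart_dom_base (c t).
have dy : chart_dom y (e t) := chart_dom_base (e t).
pose H (ab : 'rV[R]_m * 'rV[R]_n) := h (chart_inv x ab.1) (chart_inv y ab.2).
have dcx := msmooth_diff sc dx; have dey := msmooth_diff se dy.
have sH : msmooth H (chart x x, chart y y).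
  apply: (msmooth_map2 sh (c := chart_inv x \o fst) (e := chart_inv y \o snd)).
    apply: msmooth_precomp; first exact: has_basis_rV.
      exact: smooth_near_fst.
    by apply: msmooth_chart_inv; exact: chart_img_base.
  apply: msmooth_precomp; first exact: has_basis_rV.
    exact: smooth_near_snd.
  by apply: msmooth_chart_inv; exact: chart_img_base.
have dp : differentiable (fun s => ((chart x \o c) s, (chart y \o e) s)) t.
  exact: differentiable_pair.
have sHp : msmooth (H \o (fun s => ((chart x \o c) s, (chart y \o e) s))) t.
  apply: msmooth_precomp sH; first exact/has_basis_prod/has_basis_rV/has_basis_rV.
  by apply: smooth_near_pair; exact: msmooth_chart.
have near_h : \forall s \near t,
    (H \o (fun s => ((chart x \o c) s, (chart y \o e) s))) s = h (c s) (e s).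
  have := chart_inv_chart_near (msmooth_cont sc) dx.
  have := chart_inv_chart_near (msmooth_cont se) dy.
  by rewrite /H; apply: filterS2 => s /= -> ->.
apply: etrans (eq_mdiff v near_h sHp) _.
apply: etrans (mdiff_precomp v dp sH) _.
have -> : 'd (fun s => ((chart x \o c) s, (chart y \o e) s)) t v =
    (mdiff c t v, 0) + (0, mdiff e t v).
  apply: etrans (congr1 (fun F : V -> _ => F v) (diff_pair dcx dey)) _.
  by rewrite /= -[RHS]/(_ + _, _ + _) addr0 add0r.
rewrite mdiffD; congr (_ + _).
  pose i1 (a : 'rV[R]_m) := (a, chart y y).
  have di1 : differentiable i1 (chart x x) by exact: differentiable_pair.
  have -> : (mdiff c t v, 0 : 'rV[R]_n) = 'd i1 (chart x x) (mdiff c t v).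
    have dx1 : differentiable (@id 'rV[R]_m) (chart x x) by exact: ex_diff.
    have dy1 : differentiable (cst (chart y y) : 'rV[R]_m -> _) (chart x x).
      exact: differentiable_cst.
    apply/esym; apply: etrans (congr1 (fun F : 'rV[R]_m -> _ => F _) (diff_pair dx1 dy1)) _.
    by rewrite /= diff_val diff_cst.
  rewrite tangent_mapE; apply: etrans (esym (mdiff_precomp _ di1 sH)) _.
  by rewrite /i1 /H /comp /= chart_inv_base.
pose i2 (b : 'rV[R]_n) := (chart x x, b).
have di2 : differentiable i2 (chart y y) by exact: differentiable_pair.
have -> : (0 : 'rV[R]_m, mdiff e t v) = 'd i2 (chart y y) (mdiff e t v).
  have dx1 : differentiable (@id 'rV[R]_n) (chart y y) by exact: ex_diff.
  have dy1 : differentiable (cst (chart x x) : 'rV[R]_n -> _) (chart y y).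
    exact: differentiable_cst.
  apply/esym; apply: etrans (congr1 (fun F : 'rV[R]_n -> _ => F _) (diff_pair dy1 dx1)) _.
  by rewrite /= diff_cst diff_val.
rewrite tangent_mapE; apply: etrans (esym (mdiff_precomp _ di2 sH)) _.
by rewrite /i2 /H /comp /= chart_inv_base.
Qed.

End Mdiff.

(** * Piecewise smooth curves and Riemannian length *)

Section Curves.
Context {R : realType} {n : nat} {N : manifoldType R n}.
Implicit Types (c e : R -> N) (s : seq R) (x y t : R).

Definition piece c x y : Prop := exists (U : set R) (e : R -> N),
  [/\ open U, `[x, y] `<=` U, @smooth_into R R n N U e & {in `[x, y], c =1 e}].

(** The recursive form of [piecewise_smooth] with an arbitrary starting point [x], which makes
    inductions on the breakpoints possible. *)
Fixpoint pieces c x s : Prop :=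
  if s is y :: s' then [/\ x < y, piece c x y & pieces c y s'] else True.

Lemma piecesP c x s : pieces c x s <-> path <%R x s /\
  forall i, (i < size s)%N -> piece c (nth 0 (x :: s) i) (nth 0 s i).
Proof.
elim: s x => [|y s IH] x /=; first by [].
split=> [[xy pxy /IH[-> H]]|[/andP[xy ps] H]].
  by rewrite xy; split => // -[|i] /=; [|exact: H].
split => //; first exact: (H 0%N).
by apply/IH; split => // i; exact: (H i.+1).
Qed.

Lemma piecewise_smoothE c s :
  piecewise_smooth c s <-> pieces c 0 s /\ last 0 s = 1.
Proof.
split=> [[ps l1 H]|[/piecesP[ps H] l1]]; first by split => //; apply/piecesP.
by split.
Qed.

Lemma pieces_cat c x s1 s2 :
  pieces c x (s1 ++ s2) <-> pieces c x s1 /\ pieces c (last x s1) s2.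
Proof.
elim: s1 x => [|y s1 IH] x /=; first by split => // -[].
by split=> [[xy p /IH[]]|[[xy p p1] p2]]; split => //; apply/IH.
Qed.

Lemma pieces_le c x s : pieces c x s -> x <= last x s.
Proof.
by elim: s x => [|y s IH] x //= [/ltW xy _ /IH]; exact: le_trans.
Qed.

Lemma eq_piece c e x y : (forall t, x <= t <= y -> c t = e t) ->
  piece c x y -> piece e x y.
Proof.
move=> ce [U [d [oU xyU sd cd]]]; exists U, d; split => // t txy.
by rewrite -(cd t txy) ce//; move: txy; rewrite in_itv.
Qed.

Lemma eq_pieces c e x s : (forall t, x <= t <= last x s -> c t = e t) ->
  pieces c x s -> pieces e x s.
Proof.
elim: s x => [|y s IH] x //= ce [xy p ps]; have yl := pieces_le ps.
split => //.
  by apply: eq_piece p => t /andP[xt ty]; apply: ce; rewrite xt (le_trans ty).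
by apply: IH ps => t /andP[yt tl]; apply: ce; rewrite tl (le_trans (ltW xy)).
Qed.

Lemma smooth_near_affine (a b t : R) : smooth_near (fun t => a * t + b) t.
Proof.
apply: smooth_nearD; last exact: smooth_near_cst.
by apply: (@smooth_near_scale R R R (fun=> a) id); [exact: smooth_near_cst|exact: smooth_near_id].
Qed.

Lemma diff_affine (a b t v : R) : 'd (fun t : R => a * t + b) t v = a * v.
Proof.
pose L := *%R a : R -> R.
have lL : linear L by move=> k u w; rewrite /L mulrDr -[k *: u]/(k * u) mulrCA.
pose LL : {linear R -> R} := HB.pack L (GRing.isLinear.Build _ _ _ _ _ lL).
have cL : continuous LL by exact: mulrl_continuous.
have dL : differentiable LL t by exact: linear_differentiable.
have dc : differentiable (cst b : R -> R) t by exact: differentiable_cst.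
apply: etrans (congr1 (fun F : R -> R => F v) (diffD dL dc)) _.
have e1 : 'd LL t v = a * v by rewrite diff_lin.
have e2 : 'd (cst b : R -> R) t v = 0 by rewrite diff_cst.
by rewrite -[LHS]/('d LL t v + 'd (cst b : R -> R) t v) e1 e2 addr0.
Qed.

Lemma msmooth_affine c (a b t : R) : msmooth c (a * t + b) ->
  msmooth (fun t => c (a * t + b)) t.
Proof.
move=> sc; apply: (msmooth_precomp (f := fun t => a * t + b) (@has_basis_R R)) => //.
exact: smooth_near_affine.
Qed.

Lemma velocity_affine c (a b t : R) : msmooth c (a * t + b) ->
  velocity (fun t => c (a * t + b)) t = a *: velocity c (a * t + b).
Proof.
move=> sc; rewrite (velocityE (msmooth_affine sc)) (velocityE sc) -mdiffZ.
have da := smooth_near_diff (smooth_near_affine a b t).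
have E := mdiff_precomp (c := c) (f := fun t => a * t + b) 1 da sc.
by rewrite -[LHS]/(mdiff (c \o (fun t => a * t + b)) t 1) E diff_affine.
Qed.

Lemma open_msmooth c : open [set t | msmooth c t].
Proof. exact: open_interior. Qed.

Lemma msmooth_piece c x y : (forall t, x <= t <= y -> msmooth c t) -> piece c x y.
Proof.
move=> sc; exists [set t | msmooth c t], c; split => //.
- exact: open_msmooth.
- exact: msmooth_smooth_into.
Qed.

Lemma pieceP c x y : piece c x y <-> exists e,
  (forall t, x <= t <= y -> msmooth e t) /\ forall t, x <= t <= y -> c t = e t.
Proof.
split=> [[U [e [oU xyU se ce]]]|[e [se ce]]].
  exists e; split=> t txy; last by apply: ce; rewrite in_itv.
  by apply: smooth_into_msmooth oU se _; apply: xyU; rewrite /= in_itv.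
apply: eq_piece (msmooth_piece se) => t txy; exact/esym/ce.
Qed.

Lemma piece_affine c (a b x y x' y' : R) :
  (forall t, x' <= t <= y' -> x <= a * t + b <= y) ->
  piece c x y -> piece (fun t => c (a * t + b)) x' y'.
Proof.
move=> H /pieceP[e [se ce]]; apply/pieceP; exists (fun t => e (a * t + b)).
by split=> t /H xy; [exact/msmooth_affine/se|exact: ce].
Qed.

Lemma pieces_affine c (a b x : R) s : 0 < a -> pieces c x s ->
  pieces (fun t => c (a * t + b)) ((x - b) / a) [seq (y - b) / a | y <- s].
Proof.
move=> a0; elim: s x => [|y s IH] x //= [xy p ps]; split; last exact: IH.
  by rewrite ltr_pM2r ?invr_gt0// ltrD2r.
apply: piece_affine p => t.
by rewrite ler_pdivrMr// ler_pdivlMr// lerBlDr lerBrDr mulrC.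
Qed.

(** The list of breakpoints contains the final point but omits the initial one. Reversal exchanges
    the two, hence [belast x s]. *)
Lemma pieces_rev c x s : pieces c x s ->
  pieces (fun t => c (-1 * t + 1)) (1 - last x s) (rev [seq 1 - y | y <- belast x s]) /\
  last (1 - last x s) (rev [seq 1 - y | y <- belast x s]) = 1 - x.
Proof.
elim: s x => [|y s IH] x /=; first by [].
move=> [xy p /IH[ps lps]].
rewrite rev_cons last_rcons; split => //; rewrite -cats1; apply/pieces_cat; split => //=.
rewrite lps; split => //; first by rewrite ltrD2l ltrN2.
by apply: piece_affine p => t; lra.
Qed.

Lemma pieces_msmooth c x s t : pieces c x s -> x < t < last x s -> t \notin s ->
  msmooth c t.
Proof.
elim: s x => [|y s IH] x /=; first by move=> _ /andP[xt]; move/(lt_trans xt); rewrite ltxx.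
move=> [xy /pieceP[e [se ce]] ps] /andP[xt tl]; rewrite inE negb_or => /andP[ty ts].
have [yt|yt] := ltP y t; first by apply: IH ps _ ts; rewrite yt.
have {yt} ty' : t < y by rewrite lt_neqAle ty.
apply: eq_msmooth (se t _); last by rewrite !ltW.
near=> r; apply/esym/ce; rewrite !ltW//.
  by near: r; exact: lt_nbhsl.
by near: r; exact: lt_nbhsr.
Unshelve. all: by end_near. Qed.

(** At a corner the curve still agrees, on one side, with a curve [e] that is smooth on both sides
    of [t]; local estimates are made for [e]. *)
Lemma pieces_right c x s t : pieces c x s -> x <= t < last x s ->
  exists e, msmooth e t /\ exists2 d, 0 < d & forall r, t <= r < t + d -> c r = e r.
Proof.
elim: s x => [|y s IH] x /=; first by move=> _ /andP[xt]; move/(le_lt_trans xt); rewrite ltxx.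
move=> [xy /pieceP[e [se ce]] ps] /andP[xt tl].
have [yt|ty] := leP y t; first by apply: IH ps _; rewrite yt.
exists e; split; first by apply: se; rewrite xt ltW.
exists (y - t); first by rewrite subr_gt0.
move=> r /andP[tr]; rewrite addrC subrK => ry; apply: ce.
by rewrite (le_trans xt) // ltW.
Qed.

Lemma pieces_left c x s t : pieces c x s -> x < t <= last x s ->
  exists e, msmooth e t /\ exists2 d, 0 < d & forall r, t - d < r <= t -> c r = e r.
Proof.
elim: s x => [|y s IH] x /=; first by move=> _ /andP[xt]; move/(lt_le_trans xt); rewrite ltxx.
move=> [xy /pieceP[e [se ce]] ps] /andP[xt tl].
have [yt|ty] := ltP y t; first by apply: IH ps _; rewrite yt.
exists e; split; first by apply: se; rewrite ty ltW.
exists (t - x); first by rewrite subr_gt0.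
move=> r /andP[tr rt]; apply: ce.
by rewrite (le_trans rt) // andbT ltW//; move: tr; lra.
Qed.

(** Both [horizontally_joined] and the speed bound in [len_le] are instances, so reversal,
    concatenation and images of paths are treated once. *)
Definition joined (Phi : N -> 'rV[R]_n -> Prop) (p q : N) : Prop :=
  exists c s, [/\ piecewise_smooth c s, c 0 = p, c 1 = q &
    forall t, 0 < t < 1 -> t \notin s -> Phi (c t) (velocity c t)].

Lemma joined_seg (Phi : N -> 'rV[R]_n -> Prop) e (a b : R) : a < b ->
  (forall t, a <= t <= b -> msmooth e t) ->
  (forall t, a < t < b -> Phi (e t) ((b - a) *: velocity e t)) ->
  joined Phi (e a) (e b).
Proof.
move=> ab se H; have ba : 0 < b - a by rewrite subr_gt0.
exists (fun t => e ((b - a) * t + a)), [:: 1]; split.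
- apply/piecewise_smoothE; split => //=; split => //.
  by apply: msmooth_piece => t /andP[t0 t1]; apply/msmooth_affine/se; apply/andP; split; nra.
- by rewrite mulr0 add0r.
- by rewrite mulr1 subrK.
- move=> t /andP[t0 t1] _.
  have /andP[H1 H2] : a < (b - a) * t + a < b by apply/andP; split; nra.
  rewrite velocity_affine; last by apply: se; rewrite !ltW.
  by apply: H; rewrite H1.
Qed.

Lemma joined_sub (Phi Psi : N -> 'rV[R]_n -> Prop) p q :
  (forall (x : N) v, Phi x v -> Psi x v) -> joined Phi p q -> joined Psi p q.
Proof.
by move=> H [c [s [ps c0 c1 Hc]]]; exists c, s; split => // t t01 ts; exact/H/Hc.
Qed.

Lemma joined_rev (Phi Psi : N -> 'rV[R]_n -> Prop) p q :
  (forall (x : N) v, Phi x v -> Psi x (- v)) -> joined Phi p q -> joined Psi q p.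
Proof.
move=> H [c [s [/piecewise_smoothE[ps l1] c0 c1 Hc]]].
have [prev lrev] := pieces_rev ps; rewrite l1 subrr in prev lrev.
exists (fun t => c (-1 * t + 1)), (rev [seq 1 - y | y <- belast 0 s]); split.
- by apply/piecewise_smoothE; split => //; rewrite lrev subr0.
- by rewrite mulr0 add0r.
- by rewrite mulr1 addrC subrr.
- move=> t /andP[t0 t1] ts.
  have t01' : 0 < -1 * t + 1 < 1 by apply/andP; split; lra.
  have ts' : -1 * t + 1 \notin s.
    apply: contra ts => ts'.
    have : -1 * t + 1 \in 0 :: s by rewrite inE ts' orbT.
    rewrite lastI l1 mem_rcons inE => /orP[/eqP|tb]; first by lra.
    by rewrite mem_rev; apply/mapP; exists (-1 * t + 1) => //; lra.
  have sc : msmooth c (-1 * t + 1) by apply: pieces_msmooth ps _ ts'; rewrite l1.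
  by rewrite velocity_affine// scaleN1r; apply: H; exact: Hc.
Qed.

(** The break time [l] is left free because rescaling multiplies velocities by [l^-1] and
    [(1 - l)^-1]: for horizontal paths any [l] will do, for speed bounds it has to balance the two
    halves. *)
Lemma joined_cat (Phi1 Phi2 Phi : N -> 'rV[R]_n -> Prop) (l : R) p q r : 0 < l < 1 ->
  (forall (x : N) v, Phi1 x v -> Phi x (l^-1 *: v)) ->
  (forall (x : N) v, Phi2 x v -> Phi x ((1 - l)^-1 *: v)) ->
  joined Phi1 p q -> joined Phi2 q r -> joined Phi p r.
Proof.
move=> /andP[l0 l1] H1 H2 [c1 [s1 [/piecewise_smoothE[ps1 ls1] c10 c11 Hc1]]].
move=> [c2 [s2 [/piecewise_smoothE[ps2 ls2] c20 c21 Hc2]]].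
(* The offset for which [(1 - l)^-1 * t + b2] equals (t - l) / (1 - l), so that the second curve
   starts at time [l]. *)
pose b2 := - (l / (1 - l)).
have l1' : 0 < 1 - l by lra.
have iv : 0 < (1 - l)^-1 by rewrite invr_gt0.
have il : 0 < l^-1 by rewrite invr_gt0.
pose d1 t := c1 (l^-1 * t + 0); pose d2 t := c2 ((1 - l)^-1 * t + b2).
pose c t := if t <= l then d1 t else d2 t.
have a2 x : (x - b2) / (1 - l)^-1 = (1 - l) * x + l by rewrite /b2; field; lra.
have a1 x : (x - 0) / l^-1 = l * x by field; lra.
have pd1 := @pieces_affine _ _ 0 _ _ il ps1.
have pd2 := @pieces_affine _ _ b2 _ _ iv ps2.
have l12 : last ((0 - 0) / l^-1) [seq (y - 0) / l^-1 | y <- s1] = l.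
  by rewrite (last_map (fun y => (y - 0) / l^-1)) ls1 a1 mulr1.
have l22 : last ((0 - b2) / (1 - l)^-1) [seq (y - b2) / (1 - l)^-1 | y <- s2] = 1.
  by rewrite (last_map (fun y => (y - b2) / (1 - l)^-1)) ls2 a2; lra.
have z1 : (0 - 0) / l^-1 = 0 :> R by rewrite a1 mulr0.
have z2 : (0 - b2) / (1 - l)^-1 = l by rewrite a2 mulr0 add0r.
rewrite z1 in pd1 l12; rewrite z2 in pd2 l22.
have dl : d1 l = d2 l.
  rewrite /d1 /d2 mulVf ?gt_eqF// addr0 c11 -c20; congr c2.
  by rewrite /b2 mulrC subrr.
exists c, ([seq (y - 0) / l^-1 | y <- s1] ++ [seq (y - b2) / (1 - l)^-1 | y <- s2]).
split.
- apply/piecewise_smoothE; split; last by rewrite last_cat l12 l22.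
  apply/pieces_cat; rewrite l12; split.
    apply: eq_pieces pd1 => t /andP[t0]; rewrite l12 /c => ->; by [].
  apply: eq_pieces pd2 => t /andP[lt _]; rewrite /c; case: ifPn => // tl.
  by have -> : t = l by apply/eqP; rewrite eq_le tl lt.
- by rewrite /c (ltW l0) /d1 mulr0 addr0.
- rewrite /c leNgt l1 /= /d2 mulr1 /b2 -c21; congr c2; field; lra.
- move=> t /andP[t0 t1]; rewrite mem_cat negb_or => /andP[ts1 ts2].
  have [tl|lt|tl] := ltgtP t l.
  + have [e1 e2] : 0 < l^-1 * t /\ l^-1 * t < 1.
      by rewrite mulrC ltr_pdivrMr// mul1r divr_gt0.
    have nt : l^-1 * t + 0 \notin s1.
      apply: contra ts1 => H; apply/mapP; exists (l^-1 * t + 0) => //.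
      by rewrite a1 addr0 mulrA divff ?mul1r ?gt_eqF.
    have sc : msmooth c1 (l^-1 * t + 0).
      by apply: pieces_msmooth ps1 _ nt; rewrite ls1 addr0 e1.
    have cd : \forall z \near t, d1 z = c z.
      by near=> z; rewrite /c ifT// ltW//; near: z; exact: lt_nbhsl.
    have sd := msmooth_affine sc.
    rewrite velocityE; last exact: eq_msmooth cd sd.
    rewrite (eq_mdiff _ cd sd) -velocityE// -(nbhs_singleton cd) velocity_affine//.
    by apply/H1/Hc1 => //; rewrite addr0 e1.
  + have [e1 e2] : 0 < (1 - l)^-1 * t + b2 /\ (1 - l)^-1 * t + b2 < 1.
      have -> : (1 - l)^-1 * t + b2 = (t - l) / (1 - l) by rewrite /b2; field; lra.
      by rewrite ltr_pdivrMr// mul1r divr_gt0 ?subr_gt0//; split => //; lra.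
    have nt : (1 - l)^-1 * t + b2 \notin s2.
      apply: contra ts2 => H; apply/mapP; exists ((1 - l)^-1 * t + b2) => //.
      by rewrite a2 /b2; field; lra.
    have sc : msmooth c2 ((1 - l)^-1 * t + b2).
      by apply: pieces_msmooth ps2 _ nt; rewrite ls2 e1.
    have cd : \forall z \near t, d2 z = c z.
      near=> z; rewrite /c ifF//; apply/negbTE; rewrite -ltNge.
      by near: z; exact: lt_nbhsr.
    have sd := msmooth_affine sc.
    rewrite velocityE; last exact: eq_msmooth cd sd.
    rewrite (eq_mdiff _ cd sd) -velocityE// -(nbhs_singleton cd) velocity_affine//.
    by apply/H2/Hc2 => //; rewrite e1.
  (* Time [l] itself is the last breakpoint of the first half, so nothing is required there. *)
  + have := mem_last 0 [seq (y - 0) / l^-1 | y <- s1].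
    by rewrite l12 inE gt_eqF//= => lm; move: ts1; rewrite {1}tl lm.
Unshelve. all: by end_near. Qed.

End Curves.

(** Induction along the real interval: the supremum of the [t] with [P 0 t] is reached by the
    left-hand hypothesis, and if it were below 1 the right-hand one would pass it. *)
Lemma interval_ind {R : realType} (P : R -> R -> Prop) :
  (forall a b c, a < b < c -> P a b -> P b c -> P a c) ->
  (forall t, 0 <= t < 1 -> exists2 d, 0 < d & forall r, t < r < t + d -> r <= 1 -> P t r) ->
  (forall t, 0 < t <= 1 -> exists2 d, 0 < d & forall r, t - d < r < t -> 0 <= r -> P r t) ->
  P 0 1.
Proof.
move=> tr Hr Hl.
pose S := [set t | 0 < t <= 1 /\ P 0 t].
have ub1 : ubound S 1 by move=> t [/andP[]].
have S0 : S !=set0.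
  have [|d d0 Hd] := Hr 0; first by rewrite lexx ltr01.
  exists (Num.min (d / 2) 1); split.
    by rewrite lt_min ltr01 divr_gt0//= ge_min lexx orbT.
  apply: Hd; last by rewrite ge_min lexx orbT.
  by rewrite lt_min ltr01 divr_gt0//= add0r gt_min; apply/orP; left; lra.
have hs : has_sup S by split => //; exists 1.
have s1 : sup S <= 1 by exact: ge_sup.
have s0 : 0 < sup S.
  by have [t St] := S0; apply: lt_le_trans (sup_upper_bound hs St); case: St => /andP[].
have Ps : P 0 (sup S).
  have [|d d0 Hd] := Hl (sup S); first by rewrite s0.
  have [t St dt] := sup_adherent d0 hs.
  have := sup_upper_bound hs St; rewrite le_eqVlt => /orP[/eqP <-|ts].
    by case: St.
  case: St => /andP[t0 t1] Pt; apply: tr Pt _; first by rewrite t0.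
  by apply: Hd; [rewrite dt|exact: ltW].
have [s1'|s1'] := leP 1 (sup S).
  by have <- : sup S = 1 by apply/eqP; rewrite eq_le s1.
have [|d d0 Hd] := Hr (sup S); first by rewrite (ltW s0).
pose r := Num.min (sup S + d / 2) 1.
have sr : sup S < r by rewrite lt_min s1' andbT; lra.
have rd : r < sup S + d by rewrite gt_min; apply/orP; left; lra.
have r1 : r <= 1 by rewrite ge_min lexx orbT.
have Pr : P (sup S) r by apply: Hd => //; rewrite sr.
have Sr : S r.
  split; first by rewrite (lt_trans s0 sr).
  by apply: tr Ps Pr; rewrite s0.
by have := sup_upper_bound hs Sr; rewrite leNgt sr.
Qed.

(** * Continuous semidefinite metrics and the speed of curves *)

Section Metrics.
Context {R : realType} {n : nat} {N : manifoldType R n}.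
Implicit Types (g : N -> 'rV[R]_n -> 'rV[R]_n -> R) (c e : R -> N).

(** Continuous positive semidefinite forms. This class contains [connection_metric] for every
    [0 <= a], including the degenerate case [a = 0]. *)
Definition regular_metric g : Prop :=
  [/\ forall x v, scalar (g x v),
      forall x v w, g x v w = g x w v,
      forall x v, 0 <= g x v v &
      forall (x : N) v w a, chart_img x a -> {for a, continuous
        (fun a => g (chart_inv x a) (coord_field x v a) (coord_field x w a))}].

Lemma riemannian_regular g : riemannian_metric g -> regular_metric g.
Proof.
move=> [lg sg pg cg]; split => //.
  move=> x v; have [->|v0] := eqVneq v 0; last exact/ltW/pg.
  by have := lg x 0 1 0 0; rewrite scaler0 addr0 mul1r; lra.
move=> x v w a xa; have := cg x v w 0%N; exact.
Qed.

Lemma metricZr g x v a w : regular_metric g -> g x v (a *: w) = a * g x v w.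
Proof.
move=> [lg _ _ _]; have := lg x v a w 0; have := lg x v 1 0 0.
by rewrite scaler0 !addr0 mul1r => E ->; lra.
Qed.

Lemma metricDr g x v u w : regular_metric g -> g x v (u + w) = g x v u + g x v w.
Proof. by move=> [lg _ _ _]; have := lg x v 1 u w; rewrite scale1r mul1r. Qed.

Lemma metricC g x v w : regular_metric g -> g x v w = g x w v.
Proof. by case. Qed.

Lemma metric0r g x v : regular_metric g -> g x v 0 = 0.
Proof. by move=> rg; rewrite -(scale0r 0) metricZr// mul0r. Qed.

Lemma metricZl g x v a w : regular_metric g -> g x (a *: w) v = a * g x w v.
Proof. by move=> rg; rewrite metricC// metricZr// metricC. Qed.

Lemma metricDl g x v u w : regular_metric g -> g x (u + w) v = g x u v + g x w v.
Proof. by move=> rg; rewrite metricC// metricDr// !(metricC _ v). Qed.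

Lemma metricZ2 g x a v : regular_metric g -> g x (a *: v) (a *: v) = a ^+ 2 * g x v v.
Proof. by move=> rg; rewrite metricZl// metricZr// mulrA. Qed.

Lemma metricN2 g x v : regular_metric g -> g x (- v) (- v) = g x v v.
Proof. by move=> rg; rewrite -scaleN1r metricZ2// sqrrN expr1n mul1r. Qed.

Lemma metric_sumr g x v k (F : 'I_k -> 'rV[R]_n) : regular_metric g ->
  g x v (\sum_i F i) = \sum_i g x v (F i).
Proof.
move=> rg; elim: k F => [|k IH] F; first by rewrite !big_ord0 metric0r.
by rewrite !big_ord_recl metricDr// IH.
Qed.

Lemma metric_suml g x v k (F : 'I_k -> 'rV[R]_n) : regular_metric g ->
  g x (\sum_i F i) v = \sum_i g x (F i) v.
Proof.
by move=> rg; rewrite metricC// metric_sumr//; apply: eq_bigr => i _; rewrite metricC.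
Qed.

Lemma coord_field_sum (x : N) (v a : 'rV[R]_n) :
  coord_field x v a = \sum_i v 0 i *: coord_field x (delta_mx 0 i) a.
Proof.
rewrite {1}/coord_field [X in 'd _ _ X](row_sum_delta v) linear_sum.
by apply: eq_bigr => i _; rewrite linearZ.
Qed.

Lemma continuous_sum (T : topologicalType) k (F : 'I_k -> T -> R) (t : T) :
  (forall i, {for t, continuous (F i)}) ->
  {for t, continuous (fun s => \sum_i F i s)}.
Proof.
elim: k F => [|k IH] F cF.
  rewrite (_ : (fun s => _) = cst 0); first exact: cst_continuous.
  by apply/funext => s; rewrite big_ord0.
rewrite (_ : (fun s => _) = F ord0 \+ (fun s => \sum_(i < k) F (lift ord0 i) s)).
  by apply: continuousD; [exact: cF|exact: IH].
by apply/funext => s; rewrite big_ord_recl.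
Qed.

Lemma metric_continuous (T : topologicalType) g (x : N) (a v w : T -> 'rV[R]_n) (t : T) :
  regular_metric g -> chart_img x (a t) ->
  {for t, continuous a} -> {for t, continuous v} -> {for t, continuous w} ->
  {for t, continuous (fun s => g (chart_inv x (a s)) (coord_field x (v s) (a s))
     (coord_field x (w s) (a s)))}.
Proof.
move=> rg xa ca cv cw.
rewrite (_ : (fun s => _) = fun s => \sum_i \sum_j (v s 0 i * (w s 0 j *
  g (chart_inv x (a s)) (coord_field x (delta_mx 0 i) (a s)) (coord_field x (delta_mx 0 j) (a s))))).
  apply: continuous_sum => i; apply: continuous_sum => j.
  have cc (u : T -> 'rV[R]_n) k : {for t, continuous u} -> {for t, continuous (fun s => u s 0 k)}.
    by move=> cu; exact: (@continuous_comp _ _ _ u (fun w : 'rV[R]_n => w 0 k) t cu (@coord_continuous _ _ _ _ _ _)).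
  apply: continuousM; first exact: cc.
  apply: continuousM; first exact: cc.
  have [_ _ _ cg] := rg; exact: (@continuous_comp _ _ _ a _ t ca (cg x _ _ _ xa)).
apply/funext => s; rewrite (coord_field_sum x (v s)) metric_suml//.
apply: eq_bigr => i _; rewrite (coord_field_sum x (w s)) metric_sumr//.
by apply: eq_bigr => j _; rewrite metricZl// metricZr.
Qed.

(** The vectors [mdiff c s v] are written in charts that may jump with [s], so they need not be
    continuous themselves. Rewritten in the fixed chart at [c t], the expression becomes a finite
    sum of products of continuous functions. *)
Lemma metric_mdiff_continuous (V : normedModType R) g (c : V -> N) (v w t : V) :
  regular_metric g -> msmooth c t ->
  {for t, continuous (fun s => g (c s) (mdiff c s v) (mdiff c s w))}.
Proof.
move=> rg sc; have dx := chart_dom_base (c t); set x := c t in dx *.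
have sxc := msmooth_chart sc dx.
have cD u : {for t, continuous (fun s => 'd (chart x \o c) s u)}.
  have cDu := smooth_near_cont (smooth_near_derive u sxc).
  rewrite /prop_for /continuous_at -deriveE; last exact: smooth_near_diff.
  apply: cvg_trans cDu; apply: near_eq_cvg.
  by have := smooth_near_near sxc; apply: filterS => s ss; rewrite deriveE//; exact: smooth_near_diff.
have H : \forall s \near t, g (chart_inv x ((chart x \o c) s))
    (coord_field x ('d (chart x \o c) s v) ((chart x \o c) s))
    (coord_field x ('d (chart x \o c) s w) ((chart x \o c) s)) =
    g (c s) (mdiff c s v) (mdiff c s w).
  have := near_chart_dom (msmooth_cont sc) dx; have := msmooth_near sc.
  apply: filterS2 => s ss ds /=; rewrite chartK//.
  by rewrite -!mdiff_chart.
have K := @metric_continuous _ g x (chart x \o c) _ _ t rg (chart_img_base x)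
   (smooth_near_cont sxc) (cD v) (cD w).
rewrite /prop_for /continuous_at -(nbhs_singleton H).
exact/(cvg_trans _ K)/near_eq_cvg.
Qed.

Definition speed g c t : R := Num.sqrt (g (c t) (velocity c t) (velocity c t)).

Lemma speed_continuous g c t : regular_metric g -> msmooth c t ->
  {for t, continuous (speed g c)}.
Proof.
move=> rg sc; have K := @metric_mdiff_continuous R g c 1 1 t rg sc.
have K2 : {for t, continuous (fun s => Num.sqrt (g (c s) (mdiff c s 1) (mdiff c s 1)))}.
  exact: (@continuous_comp _ _ _ _ (@Num.sqrt R) t K (@sqrt_continuous R _)).
have H : \forall s \near t,
    Num.sqrt (g (c s) (mdiff c s 1) (mdiff c s 1)) = speed g c s.
  by have := msmooth_near sc; apply: filterS => s ss; rewrite /speed velocityE.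
rewrite /prop_for /continuous_at -(nbhs_singleton H).
exact/(cvg_trans _ K2)/near_eq_cvg.
Qed.

Lemma eq_speed g c e t : (\near t, c t = e t) -> msmooth e t -> speed g c t = speed g e t.
Proof.
move=> ce se; have ec : \forall s \near t, e s = c s by apply: filterS ce.
rewrite /speed (velocityE se) velocityE; last exact: eq_msmooth ec se.
by rewrite (eq_mdiff _ ec se) (nbhs_singleton ce).
Qed.

Lemma near_seq (s : seq R) (t : R) : exists2 d, 0 < d & forall r, r != t -> `|r - t| < d -> r \notin s.
Proof.
elim: s => [|x s [d d0 Hd]]; first by exists 1.
have [->|xt] := eqVneq x t.
  by exists d => // r rt rd; rewrite inE negb_or rt Hd.
exists (Num.min d `|x - t|); first by rewrite lt_min d0 normr_gt0 subr_eq0.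
move=> r rt; rewrite lt_min => /andP[rd rx]; rewrite inE negb_or Hd// andbT.
by apply: contraTneq rx => ->; rewrite ltxx.
Qed.

Lemma pieces_right_speed g c s t : regular_metric g -> pieces c 0 s -> last 0 s = 1 ->
  0 <= t < 1 -> exists e, [/\ msmooth e t, c t = e t & exists2 d, 0 < d &
    forall r, t < r < t + d -> [/\ c r = e r, msmooth e r, r \notin s, msmooth c r & speed g c r = speed g e r]].
Proof.
move=> rg ps l1 t01; have [|e [se [d d0 Hd]]] := pieces_right (t := t) ps; first by rewrite l1.
exists e; split => //; first by apply: Hd; rewrite lexx ltrDl.
have [d1 d10 Hd1] := near_seq s t.
have /nbhs_ballP[d2 d20 Hd2] := msmooth_near se.
have m0 : 0 < Num.min d (Num.min d1 d2) by rewrite !lt_min d0 d10.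
exists (Num.min d (Num.min d1 d2)); [exact: m0|move=> r /andP[tr rd]].
have /and3P[rd' rd1 rd2] : [&& r < t + d, r < t + d1 & r < t + d2].
  move: rd; rewrite -!ltrBlDl !lt_min; by [].
have ser : msmooth e r by apply: Hd2; rewrite /ball /= ltr_distlC; apply/andP; split; lra.
have cer : \forall z \near r, c z = e z.
  near=> z; apply: Hd; apply/andP; split.
    by rewrite ltW//; near: z; exact: lt_nbhsr.
  by near: z; exact: lt_nbhsl.
have ecr : \forall z \near r, e z = c z by apply: filterS cer.
split.
- exact: nbhs_singleton cer.
- exact: ser.
- by apply: Hd1; [rewrite gt_eqF|rewrite ltr_norml; apply/andP; split; lra].
- exact: eq_msmooth ecr ser.
- exact: (eq_speed _ cer ser).
Unshelve. all: by end_near. Qed.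

Lemma pieces_left_speed g c s t : regular_metric g -> pieces c 0 s -> last 0 s = 1 ->
  0 < t <= 1 -> exists e, [/\ msmooth e t, c t = e t & exists2 d, 0 < d &
    forall r, t - d < r < t -> [/\ c r = e r, msmooth e r, r \notin s, msmooth c r & speed g c r = speed g e r]].
Proof.
move=> rg ps l1 t01; have [|e [se [d d0 Hd]]] := pieces_left (t := t) ps; first by rewrite l1.
exists e; split => //; first by apply: Hd; rewrite lexx andbT; lra.
have [d1 d10 Hd1] := near_seq s t.
have /nbhs_ballP[d2 d20 Hd2] := msmooth_near se.
have m0 : 0 < Num.min d (Num.min d1 d2) by rewrite !lt_min d0 d10.
exists (Num.min d (Num.min d1 d2)); [exact: m0|move=> r /andP[rd tr]].
have /and3P[rd' rd1 rd2] : [&& t - r < d, t - r < d1 & t - r < d2].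
  by rewrite -!lt_min ltrBlDr -ltrBlDl.
have ser : msmooth e r by apply: Hd2; rewrite /ball /= ltr_distlC; apply/andP; split; lra.
have cer : \forall z \near r, c z = e z.
  near=> z; apply: Hd; apply/andP; split.
    by near: z; apply: lt_nbhsr; lra.
  by rewrite ltW//; near: z; exact: lt_nbhsl.
have ecr : \forall z \near r, e z = c z by apply: filterS cer.
split.
- exact: nbhs_singleton cer.
- exact: ser.
- by apply: Hd1; [rewrite lt_eqF|rewrite ltr_norml; apply/andP; split; lra].
- exact: eq_msmooth ecr ser.
- exact: (eq_speed _ cer ser).
Unshelve. all: by end_near. Qed.

End Metrics.

(** * Integrals of bounded measurable functions over half-open intervals *)

Section Integrals.
Context {R : realType}.
Notation mu := (@lebesgue_measure R).
Implicit Types v w : R -> R.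

(** Half-open intervals concatenate without overlap, which makes the integral additive with no
    discussion of end points. *)
Definition tame v (a b : R) : Prop :=
  measurable_fun `]a, b] v /\ exists B, forall x, a < x <= b -> `|v x| <= B.

Lemma tame_integrable v a b : tame v a b -> mu.-integrable `]a, b] (EFin \o v).
Proof.
move=> [mv [B vB]]; apply: measurable_bounded_integrable => //.
  rewrite /= lebesgue_measure_itv /=; case: ifP => _; last exact: ltry.
  by rewrite -EFinD ltry.
exists B; split; first exact: num_real.
move=> M BM x /=; rewrite in_itv /= => xab.
exact: le_trans (vB _ xab) (ltW BM).
Qed.

Lemma itvoc_setU (a b c : R) : a <= b -> b <= c ->
  `]a, c]%classic = `]a, b] `|` `]b, c].
Proof. by move=> ab bc; apply: itv_bndbnd_setU; rewrite bnd_simp. Qed.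

Lemma tame_cat v a b c : a <= b -> b <= c -> tame v a b -> tame v b c -> tame v a c.
Proof.
move=> ab bc [m1 [B1 b1]] [m2 [B2 b2]]; split.
  rewrite (itvoc_setU ab bc); apply/measurable_funU; [exact: measurable_itv..|by split].
exists (Num.max B1 B2) => x /andP[ax xc]; rewrite le_max.
have [xb|xb] := leP x b; first by rewrite b1// ax.
by rewrite (b2 x) ?orbT// xb.
Qed.

Lemma tame_Rintegral_cat v a b c : a <= b -> b <= c -> tame v a b -> tame v b c ->
  (\int[mu]_(x in `]a, c]) v x = \int[mu]_(x in `]a, b]) v x + \int[mu]_(x in `]b, c]) v x)%R.
Proof.
move=> ab bc t1 t2; have := tame_integrable (tame_cat ab bc t1 t2).
rewrite (itvoc_setU ab bc) => it; apply: Rintegral_setU it _; [exact: measurable_itv..|].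
apply/disj_set2P/seteqP; split => // x [/=]; rewrite !in_itv /= => /andP[_ xb] /andP[bx _].
by rewrite leNgt bx in xb.
Qed.

(** The end point [b] may be a breakpoint, where the speed has an arbitrary value; it is split off
    as a singleton for measurability and entered into the bound by [Num.max]. *)
Lemma tame_continuous v w (a b B : R) : a < b ->
  (forall r, a < r < b -> {for r, continuous w} /\ v r = w r) ->
  (forall r, a < r < b -> `|w r| <= B) -> tame v a b.
Proof.
move=> ab cw wB; split; last first.
  exists (Num.max B `|v b|) => x /andP[ax]; rewrite le_eqVlt => /orP[/eqP ->|xb].
    by rewrite le_max lexx orbT.
  by rewrite le_max (cw x _).2 ?ax// wB ?ax.
have -> : `]a, b]%classic = `]a, b[ `|` [set b].
  by rewrite setUitv1// bnd_simp.
apply/measurable_funU; [exact: measurable_itv|exact: measurable_set1|split; last exact: measurable_fun_set1].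
apply: (eq_measurable_fun w).
  by move=> x; rewrite inE /= in_itv /= => /cw[].
apply: open_continuous_measurable_fun; first exact: interval_open.
by move=> x; rewrite inE /= in_itv /= => /cw[].
Qed.

Lemma tame_ge v a b k : a < b -> tame v a b -> (forall x, a < x < b -> k <= v x) ->
  (k * (b - a) <= \int[mu]_(x in `]a, b]) v x)%R.
Proof.
move=> ab tv kv; have it := tame_integrable tv.
have sub : `]a, b[ `<=` `]a, b] by apply: subset_itvl; rewrite bnd_simp.
have it' : mu.-integrable `]a, b[ (EFin \o v).
  by apply: integrableS it => //; exact: measurable_itv.
rewrite -Rintegral_itv_bndo_bndc//.
have -> : k * (b - a) = (\int[mu]_(x in `]a, b[) k)%R.
  rewrite Rintegral_cst; last exact: measurable_itv.
  by rewrite /= lebesgue_measure_itv /= lte_fin ab.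
have ik : mu.-integrable `]a, b[ (EFin \o (fun=> k)).
  apply: measurable_bounded_integrable; [exact: measurable_itv| | |].
  - by rewrite /= lebesgue_measure_itv /= lte_fin ab -EFinD ltry.
  - exact: measurable_cst.
  - exact: bounded_cst.
apply: le_Rintegral => [|//|//|x /=]; first exact: measurable_itv.
by rewrite in_itv /=; exact: kv.
Qed.

Lemma tame_le v a b k : a < b -> tame v a b -> (forall x, a < x < b -> v x <= k) ->
  (\int[mu]_(x in `]a, b]) v x <= k * (b - a))%R.
Proof.
move=> ab tv kv; have it := tame_integrable tv.
have sub : `]a, b[ `<=` `]a, b] by apply: subset_itvl; rewrite bnd_simp.
have it' : mu.-integrable `]a, b[ (EFin \o v).
  by apply: integrableS it => //; exact: measurable_itv.
rewrite -Rintegral_itv_bndo_bndc//.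
have -> : k * (b - a) = (\int[mu]_(x in `]a, b[) k)%R.
  rewrite Rintegral_cst; last exact: measurable_itv.
  by rewrite /= lebesgue_measure_itv /= lte_fin ab.
have ik : mu.-integrable `]a, b[ (EFin \o (fun=> k)).
  apply: measurable_bounded_integrable; [exact: measurable_itv| | |].
  - by rewrite /= lebesgue_measure_itv /= lte_fin ab -EFinD ltry.
  - exact: measurable_cst.
  - exact: bounded_cst.
apply: le_Rintegral => [|//|//|x /=]; first exact: measurable_itv.
by rewrite in_itv /=; exact: kv.
Qed.

End Integrals.

Lemma minmaxP {R : realType} (r t : R) : r != t ->
  (Num.min r t = r /\ Num.max r t = t /\ r < t) \/
  (Num.min r t = t /\ Num.max r t = r /\ t < r).
Proof.
move=> rt; have [rlt|tlr|ert] := ltgtP r t.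
- by left.
- by right.
- by rewrite ert eqxx in rt.
Qed.

(** * Lengths and paths of bounded speed *)

Section Length.
Context {R : realType} {n : nat} {N : manifoldType R n}.
Implicit Types (g : N -> 'rV[R]_n -> 'rV[R]_n -> R) (c e : R -> N).
Notation mu := (@lebesgue_measure R).

Lemma curve_lengthE g c : tame (speed g c) 0 1 ->
  curve_length g c = (\int[mu]_(x in `]0, 1]) speed g c x)%R.
Proof.
by move=> tv; rewrite Rintegral_itv_obnd_cbnd//; exact: tame_integrable.
Qed.

(** Here [e] is a smooth extension of one piece of [c] across [t], so the local hypothesis can be
    two-sided although [c] may have a corner at [t]. [Num.min] and [Num.max] treat the intervals to
    the left and to the right of [t] together. *)
Lemma speed_ind g c s (P : R -> R -> Prop) :
  regular_metric g -> piecewise_smooth c s ->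
  (forall a b d, a < b < d -> P a b -> P b d -> P a d) ->
  (forall e t, msmooth e t -> \forall r \near t, r != t ->
     let a := Num.min r t in let b := Num.max r t in
     c a = e a -> c b = e b -> tame (speed g c) a b ->
     (forall x, a < x < b -> [/\ x \notin s, msmooth c x, 0 < x < 1 & speed g c x = speed g e x]) -> P a b) ->
  P 0 1.
Proof.
move=> rg /piecewise_smoothE[ps l1] tr loc; apply: interval_ind => // t t01.
- have [e [se cet [d d0 Hd]]] := pieces_right_speed rg ps l1 t01.
  have /nbhs_ballP[d1 d10 Hd1] := loc e t se.
  have /(@cvgrPdist_lt) /(_ 1 ltr01) /nbhs_ballP[d2 d20 Hd2] := speed_continuous rg se.
  exists (Num.min d (Num.min d1 d2)) => [|r]; first by rewrite !lt_min d0 d10.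
  rewrite -ltrBlDl !lt_min => /and4P[tr' rd rd1 rd2] r1.
  have := Hd1 r; rewrite (max_idPl _) ?(min_idPr _) ?ltW//; apply.
  + by rewrite /ball /= ltr_distlC; apply/andP; split; lra.
  + by rewrite gt_eqF.
  + exact: cet.
  + by have [|] := Hd r; first by apply/andP; split; lra.
  + apply: (@tame_continuous _ _ (speed g e) _ _ (speed g e t + 1)).
    * exact: tr'.
    * move=> x /andP[tx xr].
      have [|_ sx _ _ ->] := Hd x; first by apply/andP; split; lra.
      by split; [exact: speed_continuous|].
    * move=> x /andP[tx xr]; rewrite ger0_norm ?sqrtr_ge0//.
      have tx2 : `|t - x| < d2 by rewrite ltr_distlC; apply/andP; split; lra.
      by have := Hd2 x tx2; rewrite /= ltr_distlC => /andP[_ /ltW].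
  + move=> x /andP[tx xr]; have [|_ _ xs sx ->] := Hd x; first by apply/andP; split; lra.
    by split => //; apply/andP; split; lra.
- have [e [se cet [d d0 Hd]]] := pieces_left_speed rg ps l1 t01.
  have /nbhs_ballP[d1 d10 Hd1] := loc e t se.
  have /(@cvgrPdist_lt) /(_ 1 ltr01) /nbhs_ballP[d2 d20 Hd2] := speed_continuous rg se.
  exists (Num.min d (Num.min d1 d2)) => [|r]; first by rewrite !lt_min d0 d10.
  rewrite ltrBlDl -ltrBlDr !lt_min => /andP[/and3P[rd rd1 rd2] tr'] r0.
  have := Hd1 r; rewrite (max_idPr _) ?(min_idPl _) ?ltW//; apply.
  + by rewrite /ball /= ltr_distlC; apply/andP; split; lra.
  + by rewrite lt_eqF.
  + by have [|] := Hd r; first by apply/andP; split; lra.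
  + exact: cet.
  + apply: (@tame_continuous _ _ (speed g e) _ _ (speed g e t + 1)).
    * exact: tr'.
    * move=> x /andP[tx xr].
      have [|_ sx _ _ ->] := Hd x; first by apply/andP; split; lra.
      by split; [exact: speed_continuous|].
    * move=> x /andP[tx xr]; rewrite ger0_norm ?sqrtr_ge0//.
      have tx2 : `|t - x| < d2 by rewrite ltr_distlC; apply/andP; split; lra.
      by have := Hd2 x tx2; rewrite /= ltr_distlC => /andP[_ /ltW].
  + move=> x /andP[tx xr]; have [|_ _ xs sx ->] := Hd x; first by apply/andP; split; lra.
    by split => //; apply/andP; split; lra.
Qed.

Lemma tame_speed g c s : regular_metric g -> piecewise_smooth c s ->
  tame (speed g c) 0 1.
Proof.
move=> rg ps; apply: (speed_ind rg ps); last first.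
  by move=> e t _; near=> r => _ /= _ _ tv _; exact: tv.
by move=> a b d /andP[ab bd]; apply: tame_cat; exact: ltW.
Unshelve. all: by end_near. Qed.

(** On a short interval around [t] the speed is nearly constant, so the first-order bound exceeds
    the integral of the speed by an error proportional to the interval length; such errors add
    up. *)
Lemma length_subadditive g (Psi : N -> N -> R -> Prop) : regular_metric g ->
  (forall x y z L L', Psi x y L -> Psi y z L' -> Psi x z (L + L')) ->
  (forall x y L L', Psi x y L -> L <= L' -> Psi x y L') ->
  (forall e t k, msmooth e t -> speed g e t < k -> \forall r \near t, r != t ->
     Psi (e t) (e r) (k * `|r - t|) /\ Psi (e r) (e t) (k * `|r - t|)) ->
  forall c s k, piecewise_smooth c s -> curve_length g c < k -> Psi (c 0) (c 1) k.
Proof.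
move=> rg tr mono loc c s k ps ck.
have arith (x y z w : R) : (x - w / 2) * y <= z -> (x + w / 2) * y <= z + w * y by lra.
pose eps := k - curve_length g c; have eps0 : 0 < eps by rewrite subr_gt0.
(* The allowance [eps * (b - a)] is additive and totals [eps] on the unit interval. Half of it pays
   for exceeding the speed at [t] strictly, half for the variation of the speed. Tameness is carried
   along because additivity of the integral needs it. *)
pose P a b := tame (speed g c) a b /\
  Psi (c a) (c b) ((\int[mu]_(x in `]a, b]) speed g c x)%R + eps * (b - a)).
have [tv] : P 0 1.
  apply: (speed_ind rg ps).
    move=> a b d /andP[/ltW ab /ltW bd] [t1 P1] [t2 P2]; split.
      exact: tame_cat t1 t2.
    rewrite (tame_Rintegral_cat ab bd)//; by apply: mono (tr _ _ _ _ _ P1 P2) _; lra.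
  move=> e t se.
  have := loc e t (speed g e t + eps / 2) se; rewrite ltrDl divr_gt0// => /(_ isT).
  have : 0 < eps / 2 by rewrite divr_gt0.
  move/(@cvgrPdist_lt): (speed_continuous rg se) => /[apply] /nbhs_ballP[h h0 Hc].
  move=> Hl; near=> r => rt /=; set a := Num.min r t; set b := Num.max r t.
  move=> cea ceb tab Hx; split; first exact: tab.
  have rab : (a = r /\ b = t /\ r < t) \/ (a = t /\ b = r /\ t < r).
    exact: minmaxP rt.
  have ab : a < b by case: rab => -[-> [->]].
  have Eab : `|r - t| = b - a.
    case: rab => -[-> [-> H]]; first by rewrite ltr0_norm ?opprB// subr_lt0.
    by rewrite gtr0_norm// subr_gt0.
  have [H1 H2] : Psi (e t) (e r) ((speed g e t + eps / 2) * `|r - t|) /\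
      Psi (e r) (e t) ((speed g e t + eps / 2) * `|r - t|) by apply: (near Hl r).
  have K : Psi (c a) (c b) ((speed g e t + eps / 2) * (b - a)).
    by rewrite -Eab cea ceb; case: rab => -[-> [-> _]].
  apply: mono K _.
  have : (speed g e t - eps / 2) * (b - a) <= (\int[mu]_(x in `]a, b]) speed g c x)%R.
    apply: tame_ge => // x xab; have [_ _ _ ->] := Hx x xab.
    have hr : ball t h r by near: r; exact: nbhsx_ballx.
    have : ball t h x.
      move: hr; rewrite /ball /= !ltr_distlC => /andP[hr rh].
      by case: rab xab => -[-> [-> _]] /andP[xa xb]; apply/andP; split; lra.
    by move/Hc => /=; rewrite ltr_distlC => /andP[/ltW].
  exact: arith.
rewrite -(curve_lengthE tv) => K; apply: mono K _; rewrite /eps; lra.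
Unshelve. all: by end_near. Qed.

(* For K > 0 this says that p and q are joined by a curve of length at most K,
   parametrized so that the pointwise bound on the speed replaces the integral. *)
Definition len_le g (K : R) (p q : N) : Prop :=
  0 < K /\ joined (fun x v => g x v v <= K ^+ 2) p q.

Lemma len_le_mono g K K' p q : len_le g K p q -> K <= K' -> len_le g K' p q.
Proof.
move=> [K0 J] KK'; split; first exact: lt_le_trans KK'.
by apply: joined_sub J => x v /le_trans; apply; rewrite lerXn2r// nnegrE ltW// (lt_le_trans K0).
Qed.

Lemma len_le_rev g K p q : regular_metric g -> len_le g K p q -> len_le g K q p.
Proof.
by move=> rg [K0 J]; split => //; apply: joined_rev J => x v; rewrite metricN2.
Qed.

Lemma len_le_trans g K K' p q r : regular_metric g ->
  len_le g K p q -> len_le g K' q r -> len_le g (K + K') p r.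
Proof.
move=> rg [K0 J] [K0' J']; have KK : 0 < K + K' by rewrite addr_gt0.
(* Time is shared in proportion to the lengths, so that both rescaled halves have speed at most
   [K + K']. *)
have l01 : 0 < K / (K + K') < 1 by rewrite divr_gt0//= ltr_pdivrMr// mul1r ltrDl.
split; first exact: KK.
apply: (joined_cat l01 _ _ J J') => x v H; rewrite metricZ2//.
  have -> : (K + K') ^+ 2 = (K / (K + K'))^-1 ^+ 2 * K ^+ 2 by field; lra.
  by rewrite ler_wpM2l// sqr_ge0.
have -> : (K + K') ^+ 2 = (1 - K / (K + K'))^-1 ^+ 2 * K' ^+ 2 by field; lra.
by rewrite ler_wpM2l// sqr_ge0.
Qed.

Lemma len_le_dist g K p q : regular_metric g -> len_le g K p q ->
  riemannian_dist g p q <= K.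
Proof.
move=> rg [K0 [c [s [ps c0 c1 H]]]].
(* A real infimum is a lower bound only for sets bounded below; lengths are nonnegative. *)
have lb0 : has_lbound [set L | exists c s, [/\ piecewise_smooth c s, c 0 = p, c 1 = q & L = curve_length g c]].
  by exists 0 => L [d [r [_ _ _ ->]]]; apply: Rintegral_ge0 => t _; exact: sqrtr_ge0.
apply: (@le_trans _ _ (curve_length g c)).
  by apply: ge_inf => //; exists c, s; split.
have tv := tame_speed rg ps.
rewrite (curve_lengthE tv) -[K]mulr1 -[X in _ * X](subr0 1).
pose P a b := tame (speed g c) a b /\
  (\int[mu]_(x in `]a, b]) speed g c x)%R <= K * (b - a).
suff [] : P 0 1 by [].
apply: (speed_ind rg ps).
  move=> a b d /andP[/ltW ab /ltW bd] [t1 P1] [t2 P2]; split.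
    exact: tame_cat t1 t2.
  by rewrite (tame_Rintegral_cat ab bd)//; lra.
move=> e t se; near=> r => rt /=; set a := Num.min r t; set b := Num.max r t.
move=> _ _ tab Hx; split; first exact: tab.
have ab : a < b.
  have := minmaxP rt; rewrite -/a -/b.
  by case=> -[-> [->]].
apply: tame_le => // x xab; have [xs sx x01 _] := Hx x xab.
have : speed g c x <= Num.sqrt (K ^+ 2) by rewrite ler_wsqrtr// H.
by rewrite sqrtr_sqr (ger0_norm (ltW K0)).
Unshelve. all: by end_near. Qed.

End Length.

Section JoinedMap.
Context {R : realType} {m n : nat} {M : manifoldType R m} {N : manifoldType R n}.

Lemma pieces_map (f : M -> N) c x s : smooth_map setT f -> pieces c x s ->
  pieces (f \o c) x s.
Proof.
move=> sf; elim: s x => [|y s IH] x //= [xy /pieceP[e [se ce]] ps].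
split; [exact: xy| |exact: IH].
apply/pieceP; exists (f \o e); split=> t txy; last by rewrite /= ce.
by apply: msmooth_map => //; exact: se.
Qed.

Lemma velocity_map (f : M -> N) (c : R -> M) t : smooth_map setT f -> msmooth c t ->
  velocity (f \o c) t = tangent_map f (c t) (velocity c t).
Proof.
move=> sf sc; rewrite (velocityE sc) velocityE; last exact: msmooth_map.
exact: mdiff_map.
Qed.

Lemma joined_map (f : M -> N) (Phi : M -> 'rV[R]_m -> Prop) (Psi : N -> 'rV[R]_n -> Prop) p q :
  smooth_map setT f -> (forall x v, Phi x v -> Psi (f x) (tangent_map f x v)) ->
  joined Phi p q -> joined Psi (f p) (f q).
Proof.
move=> sf H [c [s [/piecewise_smoothE[ps l1] c0 c1 Hc]]].
exists (f \o c), s; split.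
- by apply/piecewise_smoothE; split; [exact: pieces_map|].
- by rewrite /= c0.
- by rewrite /= c1.
- move=> t t01 ts; rewrite velocity_map//; first by apply/H/Hc.
  by apply: pieces_msmooth ps _ ts; rewrite l1.
Qed.

Lemma len_le_map (f : M -> N) (g : M -> 'rV[R]_m -> 'rV[R]_m -> R)
    (h : N -> 'rV[R]_n -> 'rV[R]_n -> R) K p q :
  smooth_map setT f ->
  (forall x v, h (f x) (tangent_map f x v) (tangent_map f x v) <= g x v v) ->
  len_le g K p q -> len_le h K (f p) (f q).
Proof.
move=> sf H [K0 J]; split; first exact: K0.
by apply: joined_map J => // x v; exact: le_trans.
Qed.

End JoinedMap.

(** * Short coordinate segments, and reachability at finite length *)

Section Lines.
Context {R : realType} {n : nat} {N : manifoldType R n}.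
Implicit Types (g : N -> 'rV[R]_n -> 'rV[R]_n -> R) (c e : R -> N).

Lemma diff_line (a w : 'rV[R]_n) (r : R) :
  smooth_near (fun t : R => a + t *: w) r /\ 'd (fun t : R => a + t *: w) r 1 = w.
Proof.
have sl : smooth_near (fun t : R => a + t *: w) r.
  apply: smooth_nearD; first exact: smooth_near_cst.
  by apply: smooth_near_scale; [exact: smooth_near_id|exact: smooth_near_cst].
split => //; rewrite -deriveE; last exact: smooth_near_diff.
have di : differentiable (@id R) r by exact: ex_diff.
have dc : differentiable (cst w : R -> _) r by exact: differentiable_cst.
have [ds E] := scale_diff di dc.
have dv : derivable (fun t : R => t *: w) r 1 by exact: diff_derivable.
apply: etrans (deriveD (derivable_cst a r 1) dv) _.
rewrite derive_cst add0r; apply: etrans (deriveE _ ds) _.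
apply: etrans (congr1 (fun F : R -> 'rV[R]_n => F 1) E) _.
by rewrite diff_cst scaler0 addr0 diff_val scale1r.
Qed.

(** The metric is continuous in base point and vector jointly, so short chart segments in directions
    close to [w0] have speed below [k]. Uniformity in [w] is essential: the lemma will be applied to
    difference quotients, which only converge to [w0]. *)
Lemma len_le_line g (x : N) (w0 : 'rV[R]_n) k : regular_metric g ->
  Num.sqrt (g x w0 w0) < k -> exists2 d, 0 < d & forall tau w, 0 < tau < d ->
    `|w - w0| < d -> len_le g (k * tau) x (chart_inv x (chart x x + tau *: w)).
Proof.
move=> rg gk; have k0 : 0 < k by apply: le_lt_trans gk; exact: sqrtr_ge0.
pose T := ('rV[R]_n * 'rV[R]_n)%type.
have cf : {for (chart x x, w0) : T, continuous fst} by exact: cvg_fst.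
have cs : {for (chart x x, w0) : T, continuous snd} by exact: cvg_snd.
have cG := @metric_continuous _ _ _ T g x fst snd snd (chart x x, w0) rg (chart_img_base x)
  cf cs cs.
have Gk : g (chart_inv x (chart x x)) (coord_field x w0 (chart x x)) (coord_field x w0 (chart x x)) < k ^+ 2.
  rewrite chart_inv_base !coord_field_base.
  have [_ _ pg _] := rg; rewrite -(sqr_sqrtr (pg x w0)) ltrXn2r// nnegrE ?sqrtr_ge0//.
have /nbhs_ballP[d0 d00 H0] : \forall p \near (chart x x, w0) : T,
    g (chart_inv x p.1) (coord_field x p.2 p.1) (coord_field x p.2 p.1) < k ^+ 2.
  exact: (cG _ (lt_nbhsl Gk)).
have /nbhs_ballP[d1 d10 H1] := near_chart_img (chart_img_base x).
pose dm := Num.min d0 d1; have dm0 : 0 < dm by rewrite lt_min d00.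
have w1 : 0 < `|w0| + dm + 1 by have := normr_ge0 w0; lra.
(* Since [w] has norm at most [|w0| + dm], the second bound keeps the whole segment within [dm] of
   its start; the summand 1 keeps the inequality strict. *)
exists (Num.min dm (dm / (`|w0| + dm + 1))); first by rewrite lt_min dm0 divr_gt0.
move=> tau w /andP[tau0]; rewrite [_ < Num.min dm _]lt_min => /andP[_].
rewrite ltr_pdivlMr// => taud; rewrite [_ < Num.min dm _]lt_min => /andP[wd _].
have near0 r : 0 <= r <= tau -> `|r *: w| < dm.
  move=> /andP[r0 rt]; rewrite normrZ ger0_norm//.
  have : `|w| <= `|w0| + dm.
    by rewrite -[w](subrK w0) (le_trans (ler_normD _ _))// addrC lerD2l ltW.
  have := normr_ge0 w; move: `|w| (`|w0|) r0 rt tau0 taud dm0; clear.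
  by move=> y z r0 rt tau0 taud dm0 y0 yz; nra.
pose e (r : R) := chart_inv x (chart x x + r *: w).
have img r : 0 <= r <= tau -> chart_img x (chart x x + r *: w).
  move/near0 => H; apply: H1; rewrite /ball_ /=.
  by rewrite -ball_normE /= opprD addrA subrr add0r normrN; move: H; rewrite lt_min => /andP[].
have se r : 0 <= r <= tau -> msmooth e r.
  move=> /img H; apply: (msmooth_precomp (f := fun r : R => chart x x + r *: w) (@has_basis_rV R n)).
    by have [] := diff_line (chart x x) w r.
  exact: msmooth_chart_inv.
have E0 : e 0 = x by rewrite /e scale0r addr0 chart_inv_base.
split; first by rewrite mulr_gt0.
rewrite -{1}E0 -/(e tau).
apply: joined_seg => // t /andP[t0 tt].
have t01 : 0 <= t <= tau by rewrite !ltW.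
have [st dt] := diff_line (chart x x) w t.
rewrite velocityE; last exact: se.
have -> : mdiff e t 1 = coord_field x w (chart x x + t *: w).
  have ci := msmooth_chart_inv (img _ t01).
  have E := mdiff_precomp (f := fun r : R => chart x x + r *: w) 1 (smooth_near_diff st) ci.
  by apply: etrans E _; rewrite dt.
rewrite subr0 metricZ2// exprMn mulrC ler_wpM2r ?sqr_ge0// ltW//.
have := H0 (chart x x + t *: w, w); apply; split => /=.
  rewrite -ball_normE /= opprD addrA subrr add0r normrN.
  by have := near0 _ t01; rewrite lt_min => /andP[].
by rewrite -ball_normE /= distrC (lt_le_trans wd)// ge_min lexx.
Qed.

(** The end point is joined to [x] by a straight chart segment rather than along [a], so
    differentiability at the single parameter [s] suffices. This is what makes curves produced by
    the open mapping theorem usable. *)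
Lemma len_le_derive g (x : N) (a : R -> 'rV[R]_n) (s : R) (w0 : 'rV[R]_n) k :
  regular_metric g -> a s = chart x x -> is_derive s 1 a w0 ->
  Num.sqrt (g x w0 w0) < k ->
  \forall r \near s, r != s -> len_le g (k * `|r - s|) x (chart_inv x (a r)).
Proof.
move=> rg as_ [da <-] gk; set w1 := 'D_1 a s in gk *.
have [d d0 Hd] := len_le_line rg gk.
have gk' : Num.sqrt (g x (- w1) (- w1)) < k by rewrite metricN2.
have [d' d0' Hd'] := len_le_line rg gk'.
have m0 : 0 < Num.min d d' by rewrite lt_min d0.
have /(@cvgrPdist_lt) /(_ _ m0) /nbhs_ballP[h h0 Hh] := da.
near=> r => rs.
have rh : `|r - s| < Num.min h (Num.min d d').
  near: r; apply/nbhs_ballP; exists (Num.min h (Num.min d d')); first by rewrite /= lt_min h0.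
  by move=> r; rewrite /ball /= distrC.
move: rh; rewrite !lt_min => /and3P[rh rd rd'].
have rs0 : r - s != 0 by rewrite subr_eq0.
(* [w] is the difference quotient, hence [a r] is exactly [a s + (r - s) *: w]. For [r < s] the
   segment is traversed with direction [- w]. *)
have := Hh (r - s); rewrite /ball /= sub0r normrN => /(_ rh rs0).
rewrite [(r - s)%:A]mulr1 subrK; set w := _ *: (a r - a s); rewrite lt_min distrC => /andP[wd wd'].
have ar : a r = chart x x + (r - s) *: w.
  by rewrite /w scalerA divff// scale1r as_ addrC subrK.
rewrite ar; case/lt_total/orP : rs => rs.
  rewrite ltr0_norm ?subr_lt0// in rd'; rewrite ltr0_norm ?subr_lt0//.
  rewrite -[(r - s) *: w]opprK -scaleNr -scalerN; apply: Hd'.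
    by rewrite rd' andbT opprB subr_gt0.
  by rewrite -opprD normrN.
rewrite gtr0_norm ?subr_gt0// in rd; rewrite gtr0_norm ?subr_gt0//.
by apply: Hd => //; rewrite rd andbT subr_gt0.
Unshelve. all: by end_near. Qed.

Lemma len_le_curve g e t k : regular_metric g -> msmooth e t -> speed g e t < k ->
  \forall r \near t, r != t ->
    len_le g (k * `|r - t|) (e t) (e r) /\ len_le g (k * `|r - t|) (e r) (e t).
Proof.
move=> rg se sk; have dx := chart_dom_base (e t).
have dch := msmooth_diff se dx.
have gk : Num.sqrt (g (e t) (mdiff e t 1) (mdiff e t 1)) < k.
  by rewrite -(velocityE se).
have da : is_derive t 1 (chart (e t) \o e) (mdiff e t 1).
  by split; [exact: diff_derivable|rewrite deriveE].
have := len_le_derive rg erefl da gk.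
have := chart_inv_chart_near (msmooth_cont se) dx.
apply: filterS2 => r /= -> H /H{}H; split; [exact: H|exact: len_le_rev H].
Qed.

(** This replaces reparametrization by arc length, which could fail to be smooth where the velocity
    vanishes: the path obtained is a chain of segments, not [c] itself. *)
Lemma length_len_le g c s k : regular_metric g -> piecewise_smooth c s ->
  curve_length g c < k -> len_le g k (c 0) (c 1).
Proof.
move=> rg ps; move: c s k ps.
apply: (@length_subadditive _ _ _ g (fun x y L => len_le g L x y) rg).
- by move=> x y z L L'; exact: len_le_trans.
- by move=> x y L L' H LL; exact: len_le_mono H LL.
- by move=> e t k se; exact: len_le_curve.
Qed.

(** The bound [K] serves to show that some path exists, without which the infimum would say
    nothing. *)
Lemma dist_len_le g k p q K : regular_metric g -> len_le g K p q ->
  riemannian_dist g p q < k -> len_le g k p q.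
Proof.
move=> rg [_ [c [s [ps c0 c1 _]]]] dk.
have [|L [d [r [pd d0 d1 ->]]] Lk] := inf_lt _ dk.
  by exists (curve_length g c), c, s; split.
by rewrite -d0 -d1; exact: length_len_le pd Lk.
Qed.

(** [len_le_line] at direction 0: with the time [tau] fixed, the directions of norm less than [d]
    sweep out a neighbourhood of [x] by paths of length [tau]. *)
Lemma near_len_le g (x : N) eps : regular_metric g -> 0 < eps ->
  \forall y \near x, len_le g eps x y /\ len_le g eps y x.
Proof.
move=> rg e0; have g1 : Num.sqrt (g x 0 0) < 1 by rewrite metric0r// sqrtr0.
have [d d0 Hd] := len_le_line rg g1.
pose tau := Num.min (d / 2) eps.
have t0 : 0 < tau by rewrite lt_min e0 divr_gt0.
have td : tau < d by rewrite gt_min; apply/orP; left; lra.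
have tde : 0 < tau * d by rewrite mulr_gt0.
have cx := @chart_cont _ _ N _ _ (chart_dom_base x).
have Hc : \forall y \near x, `|chart x x - chart x y| < tau * d.
  by move/(@cvgrPdist_lt): cx => /(_ _ tde).
have Hx : \forall y \near x, chart_dom x y.
  by apply: open_nbhs_nbhs; split; [exact: chart_dom_open|exact: chart_dom_base].
apply: filterS2 Hc Hx => y yc yx.
have : len_le g (1 * tau) x (chart_inv x (chart x x + tau *: (tau^-1 *: (chart x y - chart x x)))).
  apply: Hd; first by rewrite t0.
  by rewrite subr0 normrZ gtr0_norm ?invr_gt0// distrC ltr_pdivrMl.
rewrite scalerA divff ?gt_eqF// scale1r addrC subrK chartK// mul1r => H.
have te : tau <= eps by rewrite ge_min lexx orbT.
have H' := len_le_mono H te.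
by split; [exact: H'|exact: len_le_rev].
Qed.

Lemma connected_len_le g (p q : N) : connected [set: N] -> regular_metric g ->
  exists K, len_le g K p q.
Proof.
move=> cN rg; pose S := [set y | exists K, len_le g K p y].
have near1 x : \forall y \near x, len_le g 1 x y /\ len_le g 1 y x.
  exact: near_len_le.
have oS : open S.
  rewrite openE => x [K Kx]; rewrite /interior; apply: filterS (near1 x) => y [xy _].
  by exists (K + 1); exact: len_le_trans Kx xy.
have oC : open (~` S).
  rewrite openE => x nx; rewrite /interior; apply: filterS (near1 x) => y [_ yx] [K Ky].
  by apply: nx; exists (K + 1); exact: len_le_trans Ky yx.
suff ST : S = setT by rewrite -[exists K, _]/(S q) ST.
apply: cN.
- by exists p, 1; have [] := nbhs_singleton (near1 p).
- by exists S; rewrite ?setTI.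
- by exists S; rewrite ?setTI // -openC.
Qed.

End Lines.

HB.instance Definition _ (R : realType) n := Complete.on 'rV[R]_n.

(** * Open mapping theorem and ordinary differential equations *)

Section RowNorm.
Context {R : realType} {n : nat}.

Lemma coord_norm_le (v : 'rV[R]_n) j : `|v 0 j| <= `|v|.
Proof.
rewrite [leRHS]/Num.Def.normr /= mx_normrE.
exact: (le_bigmax _ (fun ij : 'I_1 * 'I_n => `|v ij.1 ij.2|) (0, j)).
Qed.

Lemma row_norm_le (v : 'rV[R]_n) (K : R) : 0 <= K ->
  (forall j, `|v 0 j| <= K) -> `|v| <= K.
Proof.
move=> K0 H; rewrite /Num.Def.normr /= mx_normrE; apply: bigmax_le => // -[i j] _ /=.
by rewrite (ord1 i).
Qed.

(** Banach's fixed point theorem with ratio 1/2; the ball is preserved because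
    [|f z| <= |f 0| + r / 2]. *)
Lemma half_contraction (f : 'rV[R]_n -> 'rV[R]_n) (r : R) : 0 <= r ->
  (forall z z', `|z| <= r -> `|z'| <= r -> `|f z - f z'| <= `|z - z'| / 2) ->
  `|f 0| <= r / 2 -> exists2 z, `|z| <= r & f z = z.
Proof.
move=> r0 fl f0; pose U := [set z : 'rV[R]_n | `|z| <= r].
have U0 : U 0 by rewrite /U /= normr0.
have fU : set_fun U U f.
  move=> z zU; rewrite /U /= -[f z](subrK (f 0)) (le_trans (ler_normD _ _))//.
  have := fl z 0 zU U0; rewrite subr0 => H.
  by rewrite [leRHS](splitr r) lerD// (le_trans H)// ler_pM2r// invr_gt0.
pose F : {fun U >-> U} := HB.pack f (isFun.Build _ _ U U f fU).
have h0 : 0 <= (2^-1 : R) by rewrite invr_ge0.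
have cF : is_contraction F.
  exists (NngNum h0); split => /=; first by rewrite invf_lt1// ltr1n.
  move=> [z z'] [/= Uz Uz']; rewrite mulrC; exact: fl.
have cU : closed U.
  apply: (closed_comp (f := fun z : 'rV[R]_n => `|z|) (D := [set x | x <= r])).
    by move=> z _; exact: norm_continuous.
  exact: closed_le.
have [|z zU zE] := banach_fixed_point cF cU; first by exists 0.
by exists z.
Qed.

(** The explicit rate, a tail of the geometric series, is the point: applied at each parameter it
    gives uniform convergence of the Picard iterates. *)
Lemma geometric_limit (u : nat -> 'rV[R]_n) (M : R) :
  (forall k, `|u k.+1 - u k| <= M / 2 ^+ k) ->
  exists l, forall k, `|u k - l| <= 2 * M / 2 ^+ k.
Proof.
move=> Hu; have M0 : 0 <= M.
  by have := Hu 0%N; rewrite expr0 divr1; exact: le_trans.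
have p2 k : 0 < (2 : R) ^+ k by rewrite exprn_gt0.
have step k j : `|u (k + j)%N - u k| <= 2 * M / 2 ^+ k - 2 * M / 2 ^+ (k + j).
  elim: j => [|j IH]; first by rewrite addn0 !subrr normr0.
  rewrite addnS -[u _.+1](subrK (u (k + j)%N)) -addrA (le_trans (ler_normD _ _))//.
  rewrite (le_trans (lerD (Hu _) IH))//.
  have -> : 2 * M / 2 ^+ (k + j).+1 = M / 2 ^+ (k + j).
    by rewrite exprS; field; rewrite gt_eqF.
  by rewrite -[2 * M / 2 ^+ (k + j)]mulrA; lra.
have step' k j : (k <= j)%N -> `|u j - u k| <= 2 * M / 2 ^+ k.
  move=> kj; rewrite -(subnKC kj) (le_trans (step _ _))// lerBlDr lerDl.
  by rewrite divr_ge0 ?mulr_ge0// ltW.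
have small e : 0 < e -> exists k, 2 * M / 2 ^+ k < e.
  move=> e0; have q1 : `|2^-1 : R| < 1 by rewrite ger0_norm ?invr_ge0// invf_lt1// ltr1n.
  have /(@cvgrPdist_lt) /(_ _ e0) [k _ Hk] := cvg_geometric (2 * M) q1.
  exists k; have := Hk k (leqnn k); rewrite /geometric /= sub0r normrN exprVn.
  by rewrite ger0_norm ?divr_ge0 ?mulr_ge0 ?(ltW (p2 k)).
have cu : cvgn u.
  apply/cauchy_cvgP/cauchy_exP => e e0; have [k Hk] := small e e0.
  exists (u k); exists k => // j /= kj; rewrite -ball_normE /= distrC.
  exact: le_lt_trans (step' _ _ kj) Hk.
exists (limn u) => k; rewrite distrC.
have cl : (fun j => `|u j - u k|) @ \oo --> `|limn u - u k|.
  by apply: cvg_norm; apply: cvgB => //; exact: cvg_cst.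
apply: (ler_cvg_to cl (@cvg_cst _ (2 * M / 2 ^+ k) _ _ _)).
by exists k => // j /= kj; exact: step'.
Qed.

End RowNorm.

(** * Strict differentiability and the open mapping theorem *)

Section StrictDiff.
Context {R : realType}.

Lemma convex_lt (t a b d : R) : 0 <= t <= 1 -> a < d -> b < d ->
  (1 - t) * a + t * b < d.
Proof. by move=> /andP[t0 t1] ad bd; have [h|h] := leP t (1 / 2); nra. Qed.

Lemma is_derive_coord (V : normedModType R) n (f : V -> 'rV[R]_n) t v (df : 'rV[R]_n) j :
  is_derive t v f df -> is_derive t v (fun s => f s 0 j) (df 0 j).
Proof.
move=> [dv <-]; split; first exact: ((derivable_mxP _ _ _).1 dv).
by rewrite derive_mx// mxE.
Qed.

Lemma is_derive_row (V : normedModType R) n (f : V -> 'rV[R]_n) t v (df : 'rV[R]_n) :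
  (forall j, is_derive t v (fun s => f s 0 j) (df 0 j)) -> is_derive t v f df.
Proof.
move=> H; have dv : derivable f t v.
  by apply/derivable_mxP => i j; rewrite (ord1 i); have [] := H j.
split => //; rewrite derive_mx//; apply/rowP => j; rewrite mxE.
by have [_ <-] := H j.
Qed.

Lemma linear_diff_bound m n (A B : {linear 'rV[R]_m -> 'rV[R]_n}) (e : R) w :
  0 <= e -> (forall i, `|A (delta_mx 0 i) - B (delta_mx 0 i)| <= e) ->
  `|A w - B w| <= m%:R * e * `|w|.
Proof.
move=> e0 H.
have lsum (C : {linear 'rV[R]_m -> 'rV[R]_n}) : C w = \sum_i w 0 i *: C (delta_mx 0 i).
  by rewrite {1}(row_sum_delta w) linear_sum; apply: eq_bigr => i _; rewrite linearZ.
rewrite (lsum A) (lsum B) -sumrB (le_trans (ler_norm_sum _ _ _))//.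
apply: (@le_trans _ _ (\sum_(i < m) e * `|w|)).
  apply: ler_sum => i _; rewrite -scalerBr normrZ mulrC.
  by rewrite ler_pM// coord_norm_le.
by rewrite sumr_const card_ord -mulrA mulr_natl.
Qed.

Lemma linear_bound m n (A : {linear 'rV[R]_m -> 'rV[R]_n}) :
  exists2 K, 0 <= K & forall w, `|A w| <= K * `|w|.
Proof.
exists (\sum_(i < m) `|A (delta_mx 0 i)|); first exact: sumr_ge0.
move=> w; rewrite {1}(row_sum_delta w) linear_sum (le_trans (ler_norm_sum _ _ _))//.
rewrite mulr_suml ler_sum// => i _; rewrite linearZ /= normrZ mulrC ler_wpM2l//.
exact: coord_norm_le.
Qed.

Lemma linear_right_inverse m n (A : {linear 'rV[R]_m -> 'rV[R]_n}) :
  (forall v, exists w, A w = v) -> exists (B : 'rV[R]_n -> 'rV[R]_m) (beta : R),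
    [/\ 0 < beta, forall z, A (B z) = z, forall z z', B z - B z' = B (z - z'),
        B 0 = 0 & forall z, `|B z| <= beta * `|z|].
Proof.
move=> surj.
pose w (i : 'I_n) : 'rV[R]_m := sval (cid (surj (delta_mx 0 i))).
have Hw i : A (w i) = delta_mx 0 i by rewrite /w; case: cid.
(* Preimages of the basis vectors are extended linearly. The summand 1 keeps [beta] positive even if
   all [w i] vanish. *)
exists (fun z => \sum_i z 0 i *: w i), (\sum_i `|w i| + 1); split.
- by rewrite ltr_wpDl// sumr_ge0.
- move=> z; rewrite linear_sum {2}(row_sum_delta z); apply: eq_bigr => i _.
  by rewrite linearZ /= Hw.
- move=> z z'; rewrite -sumrB; apply: eq_bigr => i _.
  by rewrite -scalerBl !mxE.
- by rewrite big1// => i _; rewrite mxE scale0r.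
- move=> z; rewrite (le_trans (ler_norm_sum _ _ _))// mulrDl mul1r mulr_suml.
  rewrite ler_wpDr// ler_sum// => i _; rewrite normrZ mulrC ler_wpM2l//.
  exact: coord_norm_le.
Qed.

Lemma dist_swap (V : normedModType R) (a b a' b' : V) (e : R) :
  a = a' -> b = b' -> `|a - b| <= e -> `|b' - a'| <= e.
Proof. by move=> -> ->; rewrite distrC. Qed.

(** The mean value theorem, one coordinate at a time, for [f (y' + t *: w) - t *: 'd f y0 w]: its
    derivative is a difference of differentials at nearby points, small because the partial
    derivatives are continuous at [y0]. *)
Lemma strict_diff m n (f : 'rV[R]_m -> 'rV[R]_n) y0 (eps : R) :
  smooth_near f y0 -> 0 < eps -> exists2 d, 0 < d & forall y y',
    `|y - y0| < d -> `|y' - y0| < d ->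
    `|f y - f y' - 'd f y0 (y - y')| <= eps * `|y - y'|.
Proof.
move=> sf e0.
(* The [m] basis directions each contribute one error in [linear_diff_bound]; the summand 1 covers
   [m = 0]. *)
have e1 : 0 < eps / (m%:R + 1) by rewrite divr_gt0// ltr_wpDl.
have nD (i : 'I_m) : \forall z \near y0,
    `|'D_(delta_mx 0 i) f y0 - 'D_(delta_mx 0 i) f z| <= eps / (m%:R + 1).
  have cD := smooth_near_cont (smooth_near_derive (delta_mx 0 i) sf).
  exact: ((cvgrPdist_le _ _).1 cD _ e1).
have nDa : \forall z \near y0, forall i : 'I_m,
    `|'D_(delta_mx 0 i) f y0 - 'D_(delta_mx 0 i) f z| <= eps / (m%:R + 1).
  exact: (@filter_forall _ _ (fun (i : 'I_m) z =>
    `|'D_(delta_mx 0 i) f y0 - 'D_(delta_mx 0 i) f z| <= eps / (m%:R + 1)) _ _ nD).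
have /nbhs_ballP[d d0 Hd] : \forall z \near y0, smooth_near f z /\ forall i : 'I_m,
    `|'D_(delta_mx 0 i) f y0 - 'D_(delta_mx 0 i) f z| <= eps / (m%:R + 1).
  by apply: filterS2 (smooth_near_near sf) nDa => z.
exists d => // y y' yd yd'.
pose w := y - y'.
have wsum : w = \sum_i w 0 i *: delta_mx 0 i by exact: row_sum_delta.
apply: row_norm_le => [|j]; first by rewrite mulr_ge0// ltW.
pose phi (t : R) : R := (f (y' + t *: w) - t *: 'd f y0 w) 0 j.
have zd (t : R) : 0 <= t <= 1 -> ball y0 d (y' + t *: w).
  move=> /andP[t0 t1]; rewrite -ball_normE /= distrC.
  have -> : y' + t *: w - y0 = (1 - t) *: (y' - y0) + t *: (y - y0).
    rewrite /w scalerBl scale1r !scalerBr; apply/rowP => i; rewrite !mxE; ring.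
  rewrite (le_lt_trans (ler_normD _ _))// !normrZ !ger0_norm ?subr_ge0//.
  by apply: convex_lt => //; rewrite t0.
have dphi (t : R) : 0 <= t <= 1 ->
    is_derive t 1 phi (('d f (y' + t *: w) w - 'd f y0 w) 0 j).
  move=> t01; have [sl dl] := diff_line y' w t.
  have [sz _] := Hd _ (zd t t01).
  have dfl : differentiable (f \o (fun t : R => y' + t *: w)) t.
    by apply: differentiable_comp; [exact: smooth_near_diff|exact: smooth_near_diff].
  have i1 : is_derive t 1 (f \o (fun t : R => y' + t *: w)) ('d f (y' + t *: w) w).
    split; first exact: diff_derivable.
    rewrite deriveE// (diff_comp (smooth_near_diff sl) (smooth_near_diff sz)) /=.
    by rewrite dl.
  have [s2 d2] := diff_line 0 ('d f y0 w) t.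
  have i2 : is_derive t 1 (fun t : R => t *: 'd f y0 w) ('d f y0 w).
    have -> : (fun t : R => t *: 'd f y0 w) = (fun t : R => 0 + t *: 'd f y0 w).
      by apply/funext => r; rewrite add0r.
    split; first exact/diff_derivable/smooth_near_diff.
    by rewrite deriveE//; exact: smooth_near_diff.
  exact: (is_derive_coord j (is_deriveB i1 i2)).
have cphi : {within `[0, 1], continuous phi}.
  apply: continuous_in_subspaceT => t; rewrite inE /= in_itv /= => /dphi[dt _].
  exact/differentiable_continuous/derivable1_diffP.
have dphi' (x : R) : x \in `]0, 1[%R ->
    is_derive x 1 phi (('d f (y' + x *: w) w - 'd f y0 w) 0 j).
  by rewrite in_itv /= => /andP[/ltW x0 /ltW x1]; apply: dphi; rewrite x0.
have [c] := MVT ltr01 dphi' cphi.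
rewrite in_itv /= => /andP[/ltW c0 /ltW c1]; rewrite subr0 mulr1 => E.
have -> : (f y - f y' - 'd f y0 w) 0 j = phi 1 - phi 0.
  rewrite /phi scale1r !scale0r subr0 addr0 /w [y' + _]addrC subrK.
  by rewrite !mxE; ring.
have c01 : 0 <= c <= 1 by rewrite c0.
rewrite E; have [sz Dz] := Hd _ (zd c c01).
have dz := smooth_near_diff sz; have dy0 := smooth_near_diff sf.
rewrite (le_trans (coord_norm_le _ _))//.
have bnd : m%:R * (eps / (m%:R + 1)) <= eps.
  by rewrite mulrA ler_pdivrMr ?ltr_wpDl// mulrC ler_pM2l// lerDl.
apply: le_trans (ler_wpM2r (normr_ge0 w) bnd).
apply: linear_diff_bound; first exact: ltW.
by move=> i; exact: dist_swap (deriveE _ dy0) (deriveE _ dz) (Dz i).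
Qed.

Lemma smooth_near_lipschitz m n (f : 'rV[R]_m -> 'rV[R]_n) y0 : smooth_near f y0 ->
  exists L d, [/\ 0 < L, 0 < d & forall y y', `|y - y0| < d -> `|y' - y0| < d ->
    `|f y - f y'| <= L * `|y - y'|].
Proof.
move=> sf; have [d d0 Hd] := strict_diff sf ltr01.
have [K K0 HK] := linear_bound ('d f y0).
exists (K + 1), d; split => //; first exact: ltr_wpDl.
move=> y y' yd yd'; rewrite -[f y - f y'](subrK ('d f y0 (y - y'))).
by rewrite (le_trans (ler_normD _ _))// addrC mulrDl lerD ?Hd// HK.
Qed.

(** With [B] a right inverse of the differential, a fixed point of z |-> z + (q - f (y1 + B z))
    solves the equation; strict differentiability with error (2 beta)^-1 makes this map a
    contraction. The solution is no further from [y1] than a constant times the defect, uniformly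
    for [y1] near [y0]. *)
Lemma open_mapping m n (f : 'rV[R]_m -> 'rV[R]_n) y0 : smooth_near f y0 ->
  (forall v, exists w, 'd f y0 w = v) ->
  exists C d, [/\ 0 < C, 0 < d & forall y1 q, `|y1 - y0| < d -> `|q - f y1| < d ->
    exists2 y, f y = q & `|y - y1| <= C * `|q - f y1|].
Proof.
move=> sf surj.
have [B [beta [beta0 AB BB B0 Bn]]] := linear_right_inverse surj.
have e0 : 0 < (2 * beta)^-1 by rewrite invr_gt0 mulr_gt0.
have [d d0 Hd] := strict_diff sf e0.
have c0 : 0 < 2 * beta by rewrite mulr_gt0.
(* Fixed points are sought in the ball of radius twice the defect, on which [B] has norm at most
   [2 * beta] times the defect; the radius keeps [y1 + B z] within [d] of [y0]. *)
exists (2 * beta), (d / (2 * beta + 1)).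
split; [exact: c0|by rewrite divr_gt0// ltr_wpDl// ltW|].
move=> y1 q; rewrite !ltr_pdivlMr ?ltr_wpDl ?(ltW c0)// => y1d qd.
set rho := `|q - f y1| in qd *; have rho0 : 0 <= rho by exact: normr_ge0.
have yz z : `|z| <= 2 * rho -> `|y1 + B z - y0| < d.
  move=> zr; rewrite addrAC (le_lt_trans (ler_normD _ _))//.
  have := Bn z; have := normr_ge0 (y1 - y0).
  move: y1d qd zr beta0 rho0; move: (`|y1 - y0|) (`|B z|) (`|z|) rho => a b c e; clear.
  nra.
have [|z z' zr zr'||z zr zE] := @half_contraction R n (fun z => z + (q - f (y1 + B z))) (2 * rho).
- by rewrite mulr_ge0.
- have := Hd _ _ (yz _ zr) (yz _ zr'); rewrite opprD addrACA subrr add0r BB AB => H.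
  have -> : z + (q - f (y1 + B z)) - (z' + (q - f (y1 + B z'))) =
      - (f (y1 + B z) - f (y1 + B z') - (z - z')).
    by apply/rowP => i; rewrite !mxE; ring.
  rewrite normrN (le_trans H)// ler_pdivrMl//.
  by have -> (a : R) : 2 * beta * (a / 2) = beta * a by field.
- by rewrite B0 add0r addr0 mulrC mulKf.
exists (y1 + B z).
  have /eqP : z + (q - f (y1 + B z)) = z + 0 by rewrite zE addr0.
  by rewrite (inj_eq (addrI z)) subr_eq0 => /eqP.
rewrite [y1 + _]addrC addrK (le_trans (Bn z))//.
by have -> : 2 * beta * rho = beta * (2 * rho); [ring|rewrite ler_pM2l].
Qed.

End StrictDiff.

Section Antiderivative.
Context {R : realType}.

Lemma antiderivative (g : R -> R) (s0 h : R) : continuous g -> 0 < h ->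
  exists2 G : R -> R, G s0 = 0 & forall s, `|s - s0| < h -> is_derive s 1 G (g s).
Proof.
move=> cg h0; pose a := s0 - h; pose u := s0 + h.
have ig : (@lebesgue_measure R).-integrable `[a, u] (EFin \o g).
  apply: continuous_compact_integrable; first exact: segment_compact.
  exact: continuous_subspaceT.
pose F x := (\int[@lebesgue_measure R]_(t in `[a, x]) g t)%R.
exists (fun x => F x - F s0); first by rewrite subrr.
move=> s; rewrite ltr_distl => /andP[as_ su].
have [dF F'] := continuous_FTC1_closed su ig as_ (cg s).
have dF' : is_derive s 1 F (g s) by split; [exact: dF|rewrite -derive1E].
rewrite -[g s]subr0; exact: is_deriveB.
Qed.

Lemma antiderivative_row n (g : R -> 'rV[R]_n) (s0 h : R) : continuous g -> 0 < h ->
  exists2 G : R -> 'rV[R]_n, G s0 = 0 & forall s, `|s - s0| < h -> is_derive s 1 G (g s).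
Proof.
move=> cg h0.
have H (j : 'I_n) : exists G : R -> R, G s0 = 0 /\
    forall s, `|s - s0| < h -> is_derive s 1 G (g s 0 j).
  have [|G G0 dG] := @antiderivative (fun s => g s 0 j) s0 h _ h0; last by exists G.
  move=> s; exact: (@continuous_comp _ _ _ g (fun w : 'rV[R]_n => w 0 j) s (cg s) (@coord_continuous _ _ _ _ _ _)).
have [G HG] := choice H.
exists (fun s => \row_j G j s); first by apply/rowP => j; rewrite !mxE; have [] := HG j.
move=> s sh; apply: is_derive_row => j.
have -> : (fun s => (\row_j G j s) 0 j) = G j by apply/funext => x; rewrite mxE.
by have [_] := HG j; exact.
Qed.

(** The norm on rows is the maximum norm, so the scalar mean value theorem gives the bound
    coordinatewise with the same constant. *)
Lemma mean_value_row n (G g : R -> 'rV[R]_n) (s0 h B : R) : 0 <= B ->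
  (forall s, `|s - s0| < h -> is_derive s 1 G (g s)) ->
  (forall s, `|s - s0| < h -> `|g s| <= B) ->
  forall s, `|s - s0| < h -> `|G s - G s0| <= B * `|s - s0|.
Proof.
move=> B0 dG gB s sh; apply: row_norm_le => [|j]; first by rewrite mulr_ge0.
pose phi s := G s 0 j.
have -> : (G s - G s0) 0 j = phi s - phi s0 by rewrite !mxE.
have dphi r : `|r - s0| < h -> is_derive r 1 phi (g r 0 j).
  by move=> rh; apply: is_derive_coord; exact: dG.
have cphi r : `|r - s0| < h -> {for r, continuous phi}.
  by move=> /dphi[dr _]; exact/differentiable_continuous/derivable1_diffP.
have step (x y : R) : x < y -> (forall r, x <= r <= y -> `|r - s0| < h) ->
    `|phi y - phi x| <= B * (y - x).
  move=> xy H.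
  have cw : {within `[x, y], continuous phi}.
    by apply: continuous_in_subspaceT => r; rewrite inE /= in_itv /= => /H/cphi.
  have dw r : r \in `]x, y[%R -> is_derive r 1 phi (g r 0 j).
    by rewrite in_itv /= => /andP[/ltW xr /ltW ry]; apply/dphi/H; rewrite xr.
  have [c] := MVT xy dw cw; rewrite in_itv /= => /andP[/ltW xc /ltW cy] ->.
  rewrite normrM [`|y - x|]ger0_norm ?subr_ge0 ?(ltW xy)//.
  rewrite ler_wpM2r ?subr_ge0 ?(ltW xy)// (le_trans (coord_norm_le _ _))//.
  by apply/gB/H; rewrite xc.
move: sh; rewrite ltr_distl => /andP[h1 h2].
have [ss|ss|->] := ltgtP s s0; last by rewrite !subrr normr0 mulr0.
  rewrite [`|s - s0|]ltr0_norm ?subr_lt0// opprB distrC; apply: step => // r /andP[r1 r2].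
  by rewrite ltr_distl; apply/andP; split; lra.
rewrite [`|s - s0|]gtr0_norm ?subr_gt0//; apply: step => // r /andP[r1 r2].
by rewrite ltr_distl; apply/andP; split; lra.
Qed.

Lemma norm_three (V : normedModType R) (a b c : V) (e : R) :
  `|a| < e / 3 -> `|b| < e / 3 -> `|c| < e / 3 -> `|a + (b + c)| < e.
Proof.
move=> ha hb hc; have := ler_normD a (b + c); have := ler_normD b c; lra.
Qed.

Lemma norm_tri (V : normedModType R) (a b c : V) (x y : R) :
  `|b - a| <= x -> `|b - c| <= y -> `|a - c| <= x + y.
Proof.
move=> ax by_; rewrite -(subrK b a) -addrA (le_trans (ler_normD _ _))//.
by rewrite distrC lerD.
Qed.

(** Composition with this retraction turns data controlled only on the interval of radius [d] around
    [s0] into integrands continuous on the whole line. *)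
Definition clamp (s0 d s : R) : R := Num.max (s0 - d) (Num.min s (s0 + d)).

Lemma clamp_dist s0 d s : 0 <= d -> `|clamp s0 d s - s0| <= d.
Proof.
move=> d0; rewrite ler_distl /clamp le_max lexx /=.
rewrite ge_max ge_min lexx orbT andbT; lra.
Qed.

Lemma clamp_id s0 d s : `|s - s0| <= d -> clamp s0 d s = s.
Proof.
rewrite ler_distl /clamp => /andP[s1 s2].
by rewrite (min_idPl s2) (max_idPr s1).
Qed.

Lemma clamp_continuous s0 d : continuous (clamp s0 d).
Proof.
have mx (f : R -> R) c : continuous f -> continuous (fun s => Num.max c (f s)).
  move=> cf s; have -> : (fun s => Num.max c (f s)) = fun s => (c + f s + `|c - f s|) / 2.
    by apply/funext => r; rewrite maxr_absE.
  apply: cvgM; last exact: cvg_cst.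
  apply: cvgD; first by apply: cvgD; [exact: cvg_cst|exact: cf].
  by apply: cvg_norm; apply: cvgB; [exact: cvg_cst|exact: cf].
apply: mx => s; have -> : (fun s => Num.min s (s0 + d)) = fun s => (s + (s0 + d) - `|s - (s0 + d)|) / 2.
  by apply/funext => r; rewrite minr_absE.
apply: cvgM; last exact: cvg_cst.
apply: cvgB; first by apply: cvgD; [exact: cvg_id|exact: cvg_cst].
by apply: cvg_norm; apply: cvgB; [exact: cvg_id|exact: cvg_cst].
Qed.

End Antiderivative.

(** * Picard iteration *)

Section Picard.
Context {R : realType} {n : nat}.
Context (F : R -> 'rV[R]_n -> 'rV[R]_n) (s0 : R) (a0 : 'rV[R]_n) (d r B L : R).
Context (d0 : 0 < d) (r0 : 0 <= r) (B0 : 0 <= B) (L0 : 0 <= L).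
Context (Bd : B * d <= r) (Ld : L * d <= 1 / 2).
Context (F_bound : forall s x, `|s - s0| <= d -> `|x - a0| <= r -> `|F s x| <= B).
Context (F_lip : forall s x y, `|s - s0| <= d -> `|x - a0| <= r -> `|y - a0| <= r ->
  `|F s x - F s y| <= L * `|x - y|).
Context (F_cont : forall (a : R -> 'rV[R]_n) s, `|s - s0| <= d -> `|a s - a0| <= r ->
  {for s, continuous a} -> {for s, continuous (fun s => F s (a s))}).

Let sigma := clamp s0 d.
Let g (a : R -> 'rV[R]_n) s := F (sigma s) (a (sigma s)).
(** A chosen antiderivative, meaningful when [f] is continuous. The doubled radius makes it
    differentiable at the end points of the closed interval of radius [d] too. *)
Let prim (f : R -> 'rV[R]_n) : R -> 'rV[R]_n := xget (fun=> 0) [set G : R -> 'rV[R]_n |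
  G s0 = 0 /\ forall s, `|s - s0| < 2 * d -> is_derive s 1 G (f s)].
Let T (a : R -> 'rV[R]_n) s := a0 + prim (g a) s.
Let good (a : R -> 'rV[R]_n) := forall s, `|s - s0| <= d ->
  {for s, continuous a} /\ `|a s - a0| <= r.

Let sigmaP s : `|sigma s - s0| <= d.
Proof. by apply: clamp_dist; exact: ltW. Qed.

Let d2 s : `|s - s0| <= d -> `|s - s0| < 2 * d.
Proof. by move=> /le_lt_trans; apply; rewrite ltr_pMl// ltr1n. Qed.

Let g_cont a : good a -> continuous (g a).
Proof.
move=> ga s; have [ca ra] := ga _ (sigmaP s).
apply: (@continuous_comp _ _ _ sigma (fun s => F s (a s)) s); first exact: clamp_continuous.
exact: F_cont.
Qed.

Let primP a : good a -> prim (g a) s0 = 0 /\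
  forall s, `|s - s0| < 2 * d -> is_derive s 1 (prim (g a)) (g a s).
Proof.
move=> ga; rewrite /prim; apply: (@xgetPex _ (fun=> 0) [set G : R -> 'rV[R]_n |
  G s0 = 0 /\ forall s, `|s - s0| < 2 * d -> is_derive s 1 G (g a s)]).
have dd : 0 < 2 * d by rewrite mulr_gt0.
by have [G G0 dG] := antiderivative_row s0 (g_cont ga) dd; exists G.
Qed.

Let TP a : good a -> T a s0 = a0 /\
  forall s, `|s - s0| < 2 * d -> is_derive s 1 (T a) (g a s).
Proof.
move=> ga; have [p0 dp] := primP ga; split; first by rewrite /T p0 addr0.
move=> s sd; rewrite -[g a s]add0r; apply: is_deriveD; exact: dp.
Qed.

Let T_good a : good a -> good (T a).
Proof.
move=> ga s sd; have [T0 dT] := TP ga; split.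
  by have [dTs _] := dT s (d2 sd); exact/differentiable_continuous/derivable1_diffP.
have gB r' : `|r' - s0| < 2 * d -> `|g a r'| <= B.
  by move=> _; apply: F_bound => //; have [] := ga _ (sigmaP r').
have := mean_value_row B0 dT gB (d2 sd); rewrite T0 => /le_trans; apply.
by apply: le_trans Bd; rewrite ler_wpM2l.
Qed.

Let T_contr a b e : good a -> good b -> 0 <= e ->
  (forall s, `|s - s0| <= d -> `|a s - b s| <= e) ->
  forall s, `|s - s0| <= d -> `|T a s - T b s| <= e / 2.
Proof.
move=> ga gb e0 ab s sd; have [Ta0 dTa] := TP ga; have [Tb0 dTb] := TP gb.
pose D s := T a s - T b s.
have dD r' : `|r' - s0| < 2 * d -> is_derive r' 1 D (g a r' - g b r').
  by move=> rd; apply: is_deriveB; [exact: dTa|exact: dTb].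
have gB r' : `|r' - s0| < 2 * d -> `|g a r' - g b r'| <= L * e.
  move=> _; have [_ ra] := ga _ (sigmaP r'); have [_ rb] := gb _ (sigmaP r').
  by rewrite (le_trans (F_lip (sigmaP r') ra rb))// ler_wpM2l// ab.
have Le : 0 <= L * e by rewrite mulr_ge0.
have := mean_value_row Le dD gB (d2 sd); rewrite /D Ta0 Tb0 subrr subr0.
move/le_trans; apply; apply: (@le_trans _ _ (L * e * d)); first by rewrite ler_wpM2l.
by rewrite mulrAC mulrC ler_wpM2l// -div1r.
Qed.

Let u k : R -> 'rV[R]_n := iter k T (fun=> a0).

Let u_good k : good (u k).
Proof.
elim: k => [|k IH]; last exact: T_good.
by move=> s _; split; [exact: cst_continuous|rewrite subrr normr0].
Qed.

Let u_step k s : `|s - s0| <= d -> `|u k.+1 s - u k s| <= r / 2 ^+ k.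
Proof.
elim: k s => [|k IH] s sd.
  by rewrite expr0 divr1; have [_] := u_good 1 sd.
have e0 : 0 <= r / 2 ^+ k by rewrite divr_ge0// exprn_ge0.
have := T_contr (u_good k.+1) (u_good k) e0 IH sd.
by rewrite exprSr invfM mulrA.
Qed.

Lemma picard : exists a : R -> 'rV[R]_n, a s0 = a0 /\
  forall s, `|s - s0| < d -> `|a s - a0| <= r /\ is_derive s 1 a (F s (a s)).
Proof.
(* Evaluating at [sigma s] defines the limit for every real [s], constant beyond each end of the
   interval, so its continuity can be stated globally. *)
have Hex (s : R) : exists l : 'rV[R]_n, forall k, `|u k (sigma s) - l| <= 2 * r / 2 ^+ k.
  by apply: geometric_limit => k; apply: u_step.
have [l Hl] := choice Hex.
have small e : 0 < e -> exists k, 2 * r / 2 ^+ k < e.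
  move=> e0; have q1 : `|2^-1 : R| < 1 by rewrite ger0_norm ?invr_ge0// invf_lt1// ltr1n.
  have /(@cvgrPdist_lt) /(_ _ e0) [k _ Hk] := cvg_geometric (2 * r) q1.
  exists k; have := Hk k (leqnn k); rewrite /geometric /= sub0r normrN exprVn.
  by rewrite ger0_norm ?divr_ge0 ?mulr_ge0 ?exprn_ge0.
have cl : continuous l.
  move=> s; apply/cvgrPdist_lt => e e0.
  have e3 : 0 < e / 3 by rewrite divr_gt0.
  have [k Hk] := small _ e3.
  have cu : {for s, continuous (u k \o sigma)}.
    apply: continuous_comp; first exact: clamp_continuous.
    by have [] := u_good k (sigmaP s).
  move/(@cvgrPdist_lt): cu => /(_ _ e3); apply: filterS => t /= Ht.
  have -> : l s - l t = (l s - u k (sigma s)) + ((u k (sigma s) - u k (sigma t)) + (u k (sigma t) - l t)).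
    by apply/rowP => i; rewrite !mxE; ring.
  apply: norm_three; [|exact: Ht|exact: le_lt_trans (Hl t k) Hk].
  by rewrite distrC; exact: le_lt_trans (Hl s k) Hk.
have lr s : `|l s - a0| <= r.
  apply/ler_addgt0Pr => e e0; have [k Hk] := small _ e0.
  have [_ ur] := u_good k (sigmaP s).
  by apply: le_trans (norm_tri (Hl s k) ur) _; rewrite addrC lerD2l ltW.
have lgood : good l by move=> s _; split; [exact: cl|exact: lr].
have lT s : `|s - s0| <= d -> l s = T l s.
  move=> sd; apply/eqP; rewrite -subr_eq0 -normr_le0; apply/ler_addgt0Pr => e e0.
  rewrite add0r; have [k Hk] := small _ e0.
  have p0 : 0 <= 2 * r / 2 ^+ k by rewrite divr_ge0 ?mulr_ge0 ?exprn_ge0.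
  have uls t : `|t - s0| <= d -> `|u k t - l t| <= 2 * r / 2 ^+ k.
    by move=> td; have := Hl t k; rewrite /sigma clamp_id.
  have H1 := T_contr (u_good k) lgood p0 uls sd.
  have H2 := Hl s k.+1; rewrite /sigma (clamp_id sd) in H2.
  have := norm_tri H2 H1; move/le_trans; apply; apply: le_trans (ltW Hk).
  by rewrite exprSr invfM mulrA -splitr.
have [Tl0 dTl] := TP lgood.
(* The solution is given as [T l], which is differentiable by construction and equals [l] on the
   interval. *)
exists (T l); split=> // s sd; have sd' := ltW sd.
rewrite -(lT s sd'); split; first exact: lr.
have := dTl s (d2 sd'); rewrite /g /sigma clamp_id//.
Qed.

End Picard.

Section ODE.
Context {R : realType}.

Lemma common_radius m (P : 'I_m -> R -> Prop) :
  (forall i, exists2 d, 0 < d & P i d) ->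
  (forall i d d', 0 < d' <= d -> P i d -> P i d') ->
  exists2 d, 0 < d & forall i, P i d.
Proof.
move=> HP anti.
elim: m P HP anti => [|m IH] P HP anti; first by exists 1 => // -[].
have [d1 d10 Hd1] := HP ord0.
have [d2 d20 Hd2] := IH (fun i => P (lift ord0 i)) (fun i => HP _) (fun i => anti _).
have m0 : 0 < Num.min d1 d2 by rewrite lt_min d10.
exists (Num.min d1 d2) => // i; have [j ->|->] := unliftP ord0 i.
  by apply: anti (Hd2 j); rewrite m0 ge_min lexx orbT.
by apply: anti Hd1; rewrite m0 ge_min lexx.
Qed.

Lemma continuous_sum_row (T : topologicalType) n k (F : 'I_k -> T -> 'rV[R]_n) (t : T) :
  (forall i, {for t, continuous (F i)}) ->
  {for t, continuous (fun s => \sum_i F i s)}.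
Proof.
elim: k F => [|k IH] F cF.
  rewrite (_ : (fun s => _) = cst 0); first exact: cst_continuous.
  by apply/funext => s; rewrite big_ord0.
rewrite (_ : (fun s => _) = F ord0 \+ (fun s => \sum_(i < k) F (lift ord0 i) s)).
  by apply: continuousD; [exact: cF|exact: IH].
by apply/funext => s; rewrite big_ord_recl.
Qed.

(** The field is given as a finite sum of products of a function of time and a field in space: a
    Lipschitz constant can be read off, and smoothness of the solution needs composition in the
    space variable only. *)
Lemma ode_solution m n (W : 'I_m -> 'rV[R]_n -> 'rV[R]_n) (beta : 'I_m -> R -> R)
    (s0 : R) (a0 : 'rV[R]_n) :
  (forall i, smooth_near (W i) a0) -> (forall i, smooth_near (beta i) s0) ->
  exists a : R -> 'rV[R]_n, [/\ a s0 = a0, smooth_near a s0 &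
    \forall s \near s0, is_derive (s : R) 1 a (\sum_i beta i s *: W i (a s))].
Proof.
move=> sW sb.
have [L HL] := choice (fun i => smooth_near_lipschitz (sW i)).
have [r1 r10 Hr1] : exists2 d, 0 < d & forall i : 'I_m,
    0 < L i /\ (forall x y, `|x - a0| < d -> `|y - a0| < d -> `|W i x - W i y| <= L i * `|x - y|) /\
    (forall x, `|x - a0| < d -> smooth_near (W i) x).
  apply: common_radius => [i|i d d' /andP[_ dd] [Li [lip sm]]].
    have [d [Li d0 lip]] := HL i.
    have /nbhs_ballP[d1 d10 Hd1] := smooth_near_near (sW i).
    exists (Num.min d d1); first by rewrite lt_min d0.
    split; [exact: Li|split=> [x y|x]]; rewrite !lt_min.
      by move=> /andP[xd _] /andP[yd _]; exact: lip.
    by move=> /andP[_ xd]; apply: Hd1; rewrite -ball_normE /= distrC.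
  split; [exact: Li|split=> [x y xd yd|x xd]].
    by apply: lip; exact: lt_le_trans dd.
  by apply: sm; exact: lt_le_trans dd.
have [h h0 Hh] : exists2 d, 0 < d & forall i : 'I_m, forall s, `|s - s0| < d ->
    smooth_near (beta i) s /\ `|beta i s| <= `|beta i s0| + 1.
  apply: common_radius => [i|i d d' /andP[_ dd] H s sd]; last first.
    by apply: H; exact: lt_le_trans dd.
  have /(@cvgrPdist_lt) /(_ _ ltr01) cb := smooth_near_cont (sb i).
  have /nbhs_ballP[d d0 Hd] : \forall s \near s0,
      smooth_near (beta i) s /\ `|beta i s0 - beta i s| < 1.
    by apply: filterS2 (smooth_near_near (sb i)) cb => s.
  exists d => // s sd; have [|sbs bs] := Hd s; first by rewrite -ball_normE /= distrC.
  split => //; rewrite -[beta i s](subrK (beta i s0)) addrC (le_trans (ler_normD _ _))//.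
  by rewrite lerD2l distrC ltW.
pose F s x := \sum_i beta i s *: W i x.
pose b i := `|beta i s0| + 1.
have b0 i : 0 <= b i by rewrite addr_ge0.
pose Lip := \sum_i b i * L i.
pose B := \sum_i b i * (`|W i a0| + L i * r1).
have L0 i : 0 <= L i by have [/ltW] := Hr1 i.
have Lip0 : 0 <= Lip by apply: sumr_ge0 => i _; rewrite mulr_ge0.
have B0 : 0 <= B.
  by apply: sumr_ge0 => i _; rewrite mulr_ge0// addr_ge0// mulr_ge0// ltW.
pose r := r1 / 2.
have r0 : 0 < r by rewrite divr_gt0.
have rr1 : r < r1 by rewrite /r; lra.
(* Three requirements: times stay where the coefficients are controlled, the solution stays in the
   ball of radius [r], and the Picard map contracts by 1/2. The added 1 keeps denominators
   positive. *)
pose d := Num.min (h / 2) (Num.min (r / (B + 1)) (1 / 2 / (Lip + 1))).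
have B1 : 0 < B + 1 by rewrite ltr_wpDl.
have L1 : 0 < Lip + 1 by rewrite ltr_wpDl.
have d0 : 0 < d by rewrite !lt_min !divr_gt0.
have dh : d < h.
  by apply: (@le_lt_trans _ _ (h / 2)); [rewrite ge_min lexx|lra].
have Bd : B * d <= r.
  have : d <= r / (B + 1) by rewrite !ge_min lexx orbT.
  rewrite ler_pdivlMr// mulrC => /(le_trans _); apply.
  by rewrite ler_wpM2r ?(ltW d0)// lerDl.
have Ld : Lip * d <= 1 / 2.
  have : d <= 1 / 2 / (Lip + 1) by rewrite !ge_min lexx !orbT.
  rewrite ler_pdivlMr// mulrC => /(le_trans _); apply.
  by rewrite ler_wpM2r ?(ltW d0)// lerDl.
have sdh s : `|s - s0| <= d -> `|s - s0| < h by move=> /le_lt_trans; apply.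
have xr x : `|x - a0| <= r -> `|x - a0| < r1 by move=> /le_lt_trans; apply.
have a0r : `|a0 - a0| < r1 by rewrite subrr normr0.
have Fb s x : `|s - s0| <= d -> `|x - a0| <= r -> `|F s x| <= B.
  move=> /sdh sd /xr xd; rewrite (le_trans (ler_norm_sum _ _ _))// ler_sum// => i _.
  have [_ bs] := Hh i s sd; have [Li [lip _]] := Hr1 i.
  rewrite normrZ ler_pM// -[W i x](subrK (W i a0)) addrC (le_trans (ler_normD _ _))//.
  by rewrite lerD2l (le_trans (lip _ _ xd a0r))// ler_wpM2l// ltW.
have Fl s x y : `|s - s0| <= d -> `|x - a0| <= r -> `|y - a0| <= r ->
    `|F s x - F s y| <= Lip * `|x - y|.
  move=> /sdh sd /xr xd /xr yd; rewrite /F -sumrB (le_trans (ler_norm_sum _ _ _))//.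
  rewrite /Lip mulr_suml ler_sum// => i _; rewrite -scalerBr normrZ -mulrA.
  by have [_ bs] := Hh i s sd; have [Li [lip _]] := Hr1 i; rewrite ler_pM// lip.
have Fc (a : R -> 'rV[R]_n) s : `|s - s0| <= d -> `|a s - a0| <= r ->
    {for s, continuous a} -> {for s, continuous (fun s => F s (a s))}.
  move=> /sdh sd /xr ad ca; apply: continuous_sum_row => i.
  have [/smooth_near_cont cb _] := Hh i s sd; have [_ [_ sm]] := Hr1 i.
  apply: continuousZ; first exact: cb.
  exact: (@continuous_comp _ _ _ a (W i) s ca (smooth_near_cont (sm _ ad))).
have [a [as0 Ha]] := picard d0 (ltW r0) B0 Lip0 Bd Ld Fb Fl Fc.
pose U := [set s : R | `|s - s0| < d].
have oU : open U.
  have -> : U = ball s0 d.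
    by apply/seteqP; split=> s; rewrite -ball_normE /U /= distrC.
  exact: ball_open.
have Us0 : U s0 by rewrite /U /= subrr normr0.
exists a; split => //.
(* Bootstrapping: if [a] is k times differentiable then so is the right-hand side, which is the
   derivative of [a]. *)
- apply: (smooth_on_near oU) => //; elim=> [|k IH].
    by move=> s /Ha[_ [da _]]; exact/differentiable_continuous/derivable1_diffP.
  split=> [s /Ha[_ [da _]]|v]; first exact/derivable1_diffP.
  apply: (Ck_on_eq (f := fun s => v *: F s (a s))) => //.
    move=> s /Ha[_ [da Da]].
    have dfa : differentiable a s by exact/derivable1_diffP.
    rewrite [RHS]deriveE// -[v in RHS]mulr1 -[v * 1]/(v *: (1 : R)) linearZ /=.
    by rewrite -deriveE// Da.
  apply: Ck_on_scale => //; first exact: Ck_on_cst.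
  apply: Ck_on_sum => // i; apply: Ck_on_scale => //.
    have sbU : smooth_on U (beta i).
      by apply: near_smooth_on => s Us; have [] := Hh i s (lt_trans Us dh).
    exact: sbU.
  apply: (Ck_on_comp (U' := [set x | `|x - a0| < r1]) (@has_basis_rV R n)) IH _ => //.
    by move=> s /Ha[/xr].
  have sWU : smooth_on [set x | `|x - a0| < r1] (W i).
    by apply: near_smooth_on => x xr1; have [_ [_]] := Hr1 i; exact.
  exact: sWU.
- have : \forall s \near s0, U s by exact: open_nbhs_nbhs.
  by apply: filterS => s /Ha[_ []].
Qed.

End ODE.

Lemma diff_pairl {R : realType} (V W : normedModType R) (z : W) (c v : V) :
  'd (fun b : V => (b, z)) c v = (v, 0).
Proof.
have di : differentiable (@id V) c by exact: ex_diff.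
have dc : differentiable (cst z : V -> W) c by exact: differentiable_cst.
have E := diff_pair di dc.
apply: (etrans (congr1 (fun F : V -> V * W => F v) E)) => /=.
by congr pair; rewrite diff_val.
Qed.

(** * Horizontal lifts *)

Section LieGroups.
Context {R : realType} {d : nat} {G : lieGroupType R d}.

Lemma smooth_mulgr (h : G) : smooth_map setT (fun x : G => (x * h)%g).
Proof.
exact: (smooth_map2_comp mulg_smooth (@smooth_map_id _ _ _) (smooth_map_cst h)).
Qed.

(** Differentiate the identity x * x^-1 = 1 at x = 1. *)
Lemma tangent_invg1 (v : 'rV[R]_d) : tangent_map (fun x : G => x^-1%g) 1%g v = - v.
Proof.
pose o : G := 1%g; have io := chart_img_base o.
have sc : msmooth (chart_inv o) (chart o o) by exact: msmooth_chart_inv.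
have si := invg_smooth (s := G).
have sic : msmooth ((fun x : G => x^-1%g) \o chart_inv o) (chart o o) by exact: msmooth_map.
have E : (fun a : 'rV[R]_d => (chart_inv o a * (chart_inv o a)^-1)%g) = fun=> o.
  by apply/funext => a; rewrite mulgV.
have E0 : mdiff (fun a : 'rV[R]_d => (chart_inv o a * (chart_inv o a)^-1)%g) (chart o o) v = 0.
  by rewrite E mdiff_cst.
have := etrans (esym E0) (mdiff_map2 v (mulg_smooth (s := G)) sc sic).
have E1 : ((fun x : G => x^-1%g) \o chart_inv o) (chart o o) = o.
  by rewrite /= chart_inv_base invg1.
rewrite E1 -[mdiff (chart_inv o) _ _]/(coord_field o v (chart o o)) coord_field_base chart_inv_base.
have -> : (fun x : G => x * o)%g = (fun x => x) by apply/funext => x; rewrite mulg1.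
have -> : (fun x : G => o * x)%g = (fun x => x) by apply/funext => x; rewrite mul1g.
rewrite !tangent_map_id -tangent_mapE => /esym/eqP.
by rewrite addrC addr_eq0 => /eqP.
Qed.

(** The equation x' x^-1 = xi with x(s) = 1, read in the chart at 1. The relation persists near [s]
    and not only at [s], as a horizontal lift requires. *)
Lemma right_invariant_ode (xi : R -> 'rV[R]_d) (s : R) : smooth_near xi s ->
  exists a : R -> 'rV[R]_d, [/\ a s = chart (1%g : G) 1%g, smooth_near a s,
    is_derive s 1 a (xi s) &
    \forall r \near s, velocity (fun r => chart_inv (1%g : G) (a r)) r =
      tangent_map (fun x : G => (x * chart_inv 1%g (a r))%g) 1%g (xi r)].
Proof.
move=> sxi; pose o : G := 1%g; pose c0 := chart o o.
have io : chart_img o c0 by exact: chart_img_base.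
pose m (ba : 'rV[R]_d * 'rV[R]_d) := chart o (chart_inv o ba.1 * chart_inv o ba.2)%g.
have si1 (z : 'rV[R]_d * 'rV[R]_d) : chart_img o z.1 -> msmooth (fun z : 'rV[R]_d * 'rV[R]_d => chart_inv o z.1) z.
  move=> iz; apply: (msmooth_precomp (f := fst) (@has_basis_rV R d)) (smooth_near_fst z) _.
  exact: msmooth_chart_inv.
have si2 (z : 'rV[R]_d * 'rV[R]_d) : chart_img o z.2 -> msmooth (fun z : 'rV[R]_d * 'rV[R]_d => chart_inv o z.2) z.
  move=> iz; apply: (msmooth_precomp (f := snd) (@has_basis_rV R d)) (smooth_near_snd z) _.
  exact: msmooth_chart_inv.
have cio : chart_inv o c0 = o by exact: chart_inv_base.
have sm a : chart_img o a -> smooth_near m (c0, a).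
  move=> ia; have smul := msmooth_map2 (mulg_smooth (s := G)) (si1 (c0, a) io) (si2 (c0, a) ia).
  apply: (msmooth_chart smul); rewrite /= cio mul1g.
  by have [] := chart_invP ia.
(* The right-invariant vector field of the i-th basis vector, in coordinates: a partial derivative
   of multiplication in its first argument at 1, hence smooth. *)
pose W (i : 'I_d) (a : 'rV[R]_d) := 'D_(delta_mx 0 i, 0) m (c0, a).
have sW i : smooth_near (W i) c0.
  apply: (@smooth_near_comp _ _ _ _ (fun a => (c0, a)) ('D_(delta_mx 0 i, 0) m)).
  - exact: has_basis_prod (@has_basis_rV R d) (@has_basis_rV R d).
  - by apply: smooth_near_pair; [exact: smooth_near_cst|exact: smooth_near_id].
  - exact/smooth_near_derive/sm.
have [a [as_ sa Ha]] := ode_solution sW (fun i => smooth_near_coord i sxi).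
pose D z v := 'd (chart o \o ((fun x : G => (x * chart_inv o z)%g) \o chart_inv o)) c0 v : 'rV[R]_d.
have WD i z : chart_img o z -> W i z = D z (delta_mx 0 i).
  move=> iz; rewrite /W deriveE; last exact/smooth_near_diff/sm.
  have dp : differentiable (fun b : 'rV[R]_d => (b, z)) c0.
    by apply: differentiable_pair; [exact: ex_diff|exact: differentiable_cst].
  have dm : differentiable m (c0, z) by exact/smooth_near_diff/sm.
  rewrite /D -[X in 'd X c0 _]/(m \o (fun b => (b, z))) diff_comp//=.
  by congr ('d m (c0, z) _); rewrite diff_pairl.
have Wsum (v z : 'rV[R]_d) : chart_img o z -> \sum_i v 0 i *: W i z = D z v.
  move=> iz; rewrite /D [X in _ = 'd _ _ X](row_sum_delta v) linear_sum.
  by apply: eq_bigr => i _; rewrite linearZ /= WD.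
have ira : \forall r \near s, chart_img o (a r).
  have ca := smooth_near_cont sa; apply: ca; rewrite as_; exact: near_chart_img.
exists a; split; [exact: as_|exact: sa| |].
  have := nbhs_singleton Ha; rewrite as_ (Wsum (xi s))// /D cio.
  have -> : (fun x : G => x * o)%g = id by apply/funext => x; rewrite mulg1.
  by have := coord_field_base o (xi s); rewrite /coord_field cio => ->.
have := smooth_near_near sa; move: ira Ha; apply: filterS3 => r ir da sar.
have sci : msmooth (chart_inv o) (a r) by exact: msmooth_chart_inv.
have sx : msmooth (chart_inv o \o a) r.
  exact: msmooth_precomp (@has_basis_rV R d) sar sci.
rewrite (velocityE sx) mdiff_precomp//; last exact: smooth_near_diff.
rewrite -deriveE; last exact: smooth_near_diff.
have [_ ->] := da; rewrite Wsum// tangent_mapE.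
have sR : msmooth ((fun x : G => (x * chart_inv o (a r))%g) \o chart_inv o) c0.
  by apply: msmooth_map; [exact: smooth_mulgr|exact: msmooth_chart_inv].
have [dr cr] := chart_invP ir.
rewrite [RHS](mdiff_chart _ sR (x := o)) /= cio mul1g ?cr//.
Qed.

Lemma msmooth_chart_inv_comp (a : R -> 'rV[R]_d) (s : R) (x : G) :
  smooth_near a s -> chart_img x (a s) -> msmooth (fun r => chart_inv x (a r)) s.
Proof.
move=> sa ia; apply: (msmooth_precomp (f := a) (@has_basis_rV R d) sa).
exact: msmooth_chart_inv.
Qed.

End LieGroups.

(** * Principal connections *)

Section Connections.
Context {R : realType} {m d k : nat} {M : manifoldType R m} {G : lieGroupType R d}
  {P : manifoldType R k}.
Variables (proj : P -> M) (act : P -> G -> P) (theta : P -> 'rV[R]_k -> 'rV[R]_d).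
Hypotheses (bundle : principal_bundle proj act) (conn : principal_connection act theta).

Local Notation "p ~ q" := (horizontally_joined theta p q) (at level 70).

Lemma smooth_proj : smooth_map setT proj. Proof. by have [[]] := bundle. Qed.

Lemma smooth_act : smooth_map2 setT act. Proof. by have [[]] := bundle. Qed.

Lemma act1 p : act p 1%g = p. Proof. by have [_ []] := bundle. Qed.

Lemma actM p g h : act p (g * h)%g = act (act p g) h.
Proof. by have [_ [_ ->]] := bundle. Qed.

Lemma smooth_actr g : smooth_map setT (act^~ g).
Proof. exact: (smooth_map2_comp smooth_act (@smooth_map_id _ _ _) (smooth_map_cst g)). Qed.

Lemma smooth_actl p : smooth_map setT (act p).
Proof. exact: (smooth_map2_comp smooth_act (smooth_map_cst p) (@smooth_map_id _ _ _)). Qed.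

Lemma theta_lin p : linear (theta p). Proof. by have [] := conn. Qed.

Lemma thetaZ p a v : theta p (a *: v) = a *: theta p v.
Proof.
have th0 : theta p 0 = 0.
  have := theta_lin p 1 0 0; rewrite !scale1r addr0 => /eqP.
  by rewrite -[eqbLHS]addr0 (can_eq (addKr _)) => /eqP <-.
by have := theta_lin p a v 0; rewrite th0 !addr0.
Qed.

Lemma thetaD p v w : theta p (v + w) = theta p v + theta p w.
Proof. by have := theta_lin p 1 v w; rewrite !scale1r. Qed.

Lemma thetaN p v : theta p (- v) = - theta p v.
Proof. by rewrite -scaleN1r thetaZ scaleN1r. Qed.

Lemma theta_sum p j (F : 'I_j -> 'rV[R]_k) : theta p (\sum_i F i) = \sum_i theta p (F i).
Proof.
elim: j F => [|j IH] F; first by rewrite !big_ord0 -(scale0r 0) thetaZ scale0r.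
by rewrite !big_ord_recl thetaD IH.
Qed.

(** Smoothness of [theta] is known on coordinate fields of a fixed chart, so the velocity is
    expanded in these, with smooth coefficients. *)
Lemma smooth_theta_velocity (e : R -> P) (s : R) : msmooth e s ->
  smooth_near (fun r => theta (e r) (velocity e r)) s.
Proof.
move=> se; have dx := chart_dom_base (e s); set x := e s in dx.
have sxe := msmooth_chart se dx; pose a := chart x \o e.
apply: (eq_smooth_near (f := fun r => \sum_(i < k) ('D_1 a r) 0 i *:
   theta (chart_inv x (a r)) (coord_field x (delta_mx 0 i) (a r)))).
  have := near_chart_dom (msmooth_cont se) dx; have := msmooth_near se.
  apply: filterS2 => r ser dr; rewrite (velocityE ser) (mdiff_chart _ ser dr).
  rewrite coord_field_sum theta_sum; apply: eq_bigr => i _; rewrite thetaZ /a /= chartK//.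
  by congr (fun_of_matrix _ _ _ *: _); rewrite deriveE//; exact: msmooth_diff.
apply: smooth_near_sum => i; apply: smooth_near_scale.
  exact/smooth_near_coord/smooth_near_derive.
have ia : chart_img x (a s) by exact: chart_img_base.
apply: (@smooth_near_comp _ _ _ _ a (fun b => theta (chart_inv x b) (coord_field x (delta_mx 0 i) b))) => //.
  exact: has_basis_rV.
have [_ sth _ _] := conn; apply: smooth_on_near (sth x _) ia; exact: chart_img_open.
Qed.

(** Differentiate p (x g) = (p x) g at x = 1. It turns a right-invariant motion in G into a
    translated fundamental field, whose value under [theta] is known. *)
Lemma tangent_actr_fundamental p g xi :
  tangent_map (act^~ g) p (fundamental_field act xi p) =
  tangent_map (act p) g (tangent_map (fun x : G => (x * g)%g) 1%g xi).
Proof.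
have E1 : act p \o (fun x : G => (x * g)%g) = act^~ g \o act p.
  by apply/funext => x /=; rewrite actM.
have := tangent_map_comp 1%g xi (smooth_mulgr g) (smooth_actl p).
rewrite E1 (tangent_map_comp 1%g xi (smooth_actl p) (smooth_actr g)) act1 mul1g.
by move=> <-.
Qed.

Lemma hjoined_refl (p : P) : p ~ p.
Proof.
have H := @joined_seg R k P (fun x v => theta x v = 0) (fun=> p) 0 1.
apply: H => [|t _|t _]; [exact: ltr01|exact: msmooth_cst|].
by rewrite (velocityE (msmooth_cst p t)) mdiff_cst scaler0 -(scale0r 0) thetaZ scale0r.
Qed.

Lemma hjoined_trans p q r : p ~ q -> q ~ r -> p ~ r.
Proof.
have h2 : 0 < (2^-1 : R) < 1 by apply/andP; split; lra.
pose K (x : P) v := theta x v = 0.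
by apply: (@joined_cat _ _ P K K K _ _ _ _ h2) => x v xv; rewrite /K thetaZ xv scaler0.
Qed.

Lemma hjoined_sym p q : p ~ q -> q ~ p.
Proof. pose K (x : P) v := theta x v = 0.
by apply: (@joined_rev _ _ P K K) => x v xv; rewrite /K thetaN xv oppr0. Qed.

Lemma hjoined_act g p q : p ~ q -> act p g ~ act q g.
Proof.
pose K (x : P) v := theta x v = 0.
apply: (@joined_map _ _ _ P P (act^~ g) K K _ _ (smooth_actr g)) => x v xv.
by have [_ _ H _] := conn; rewrite /K H xv /Ad tangent_map0.
Qed.

(* The lift of e is r |-> e r . x r, where x solves x' x^-1 = - theta(e'). *)
Lemma horizontal_lift (e : R -> P) (s : R) : msmooth e s ->
  exists a : R -> 'rV[R]_d, [/\ a s = chart (1%g : G) 1%g, smooth_near a s,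
    is_derive s 1 a (- theta (e s) (velocity e s)) &
    \forall r \near s, e s ~ act (e r) (chart_inv (1%g : G) (a r))].
Proof.
move=> se; have sxi : smooth_near (fun r => - theta (e r) (velocity e r)) s.
  rewrite (_ : (fun r => _) = fun r => (-1 : R) *: theta (e r) (velocity e r)); last first.
    by apply/funext => r; rewrite scaleN1r.
  apply: smooth_near_scale; [exact: smooth_near_cst|exact: smooth_theta_velocity].
have [a [as_ sa da Ha]] := right_invariant_ode (G := G) sxi.
exists a; split => //.
pose x r := chart_inv (1%g : G) (a r).
have ira : \forall r \near s, chart_img (1%g : G) (a r).
  have ca := smooth_near_cont sa; apply: ca; rewrite as_.
  exact/near_chart_img/chart_img_base.
pose h r := act (e r) (x r).
have Hh : \forall r \near s, msmooth h r /\ theta (h r) (velocity h r) = 0.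
  have se' := msmooth_near se; have sa' := smooth_near_near sa.
  near=> r; have ir : chart_img (1%g : G) (a r) by near: r.
  have Hr : velocity (fun r => chart_inv (1%g : G) (a r)) r =
      tangent_map (fun z : G => (z * chart_inv 1%g (a r))%g) 1%g (- theta (e r) (velocity e r)).
    by near: r.
  have ser : msmooth e r by near: r.
  have sar : smooth_near a r by near: r.
  have sx : msmooth x r by exact: msmooth_chart_inv_comp.
  have sh : msmooth h r by exact: msmooth_map2 smooth_act ser sx.
  split; first exact: sh.
  rewrite (velocityE sh) (mdiff_map2 (1 : R) smooth_act ser sx) -(velocityE sx) -(velocityE ser).
  (* The velocity of [h] is the translate by [x r] of e' minus the fundamental field of theta(e');
     the latter difference lies in the kernel of [theta], and equivariance keeps its translate
     there. *)
  rewrite (Hr : velocity x r = _) -tangent_actr_fundamental -tangent_mapD.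
  have [_ _ -> thf] := conn; rewrite thetaD thf.
  by rewrite subrr /Ad tangent_map0.
have hs : h s = e s by rewrite /h /x as_ chart_inv_base act1.
have /nbhs_ballP[r0 /= r00 Hr] := Hh.
apply/nbhs_ballP; exists r0 => // r sr /=; rewrite -/(x r) -/(h r) -hs.
have near_seg t : Num.min r s <= t <= Num.max r s -> msmooth h t /\ theta (h t) (velocity h t) = 0.
  move=> /andP[t1 t2]; apply: Hr; move: sr; rewrite /ball /= !ltr_distlC => /andP[].
  by move: t1 t2; rewrite ge_min le_max => /orP[] ? /orP[] ? ? ?; lra.
have [->|rs] := eqVneq r s; first exact: hjoined_refl.
case: (minmaxP rs) => -[E1 [E2 lrs]]; move: near_seg; rewrite E1 E2 => Hseg.
  apply: hjoined_sym; apply: (joined_seg (Phi := fun x v => theta x v = 0) lrs) => t.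
    by move=> /Hseg[].
  by move=> /andP[/ltW t1 /ltW t2]; rewrite thetaZ (Hseg t _).2 ?scaler0 ?t1.
apply: (joined_seg (Phi := fun x v => theta x v = 0) lrs) => t.
  by move=> /Hseg[].
by move=> /andP[/ltW t1 /ltW t2]; rewrite thetaZ (Hseg t _).2 ?scaler0 ?t1.
Unshelve. all: by end_near. Qed.

End Connections.

(** * Regularity of the metrics, compactness and horizontal reachability in P *)

Section Bundles.
Context {R : realType} {m d k : nat} {M : manifoldType R m} {G : lieGroupType R d}
  {P : manifoldType R k}.
Variables (proj : P -> M) (act : P -> G -> P) (theta : P -> 'rV[R]_k -> 'rV[R]_d).
Hypotheses (bundle : principal_bundle proj act) (conn : principal_connection act theta).

Lemma connection_regular (gM : M -> 'rV[R]_m -> 'rV[R]_m -> R)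
    (gG : G -> 'rV[R]_d -> 'rV[R]_d -> R) (a : R) :
  regular_metric gM -> regular_metric gG -> 0 <= a ->
  regular_metric (connection_metric proj gM (gG 1%g) theta a).
Proof.
move=> rM rG a0; have sp := smooth_proj bundle; split.
- move=> x v b w z; rewrite /connection_metric tangent_mapD tangent_mapZ.
  rewrite (theta_lin conn) !metricDr// !metricZr//.
  by ring.
- by move=> x v w; rewrite /connection_metric metricC// (metricC _ (theta x v)).
- move=> x v; have [_ _ pM _] := rM; have [_ _ pG _] := rG.
  by rewrite addr_ge0// mulr_ge0.
- move=> x v w b ib; have si : msmooth (proj \o chart_inv x) b.
    by apply: msmooth_map sp _; exact: msmooth_chart_inv.
  have cM := metric_mdiff_continuous (v := v) (w := w) rM si.
  have cth z : {for b, continuous (fun b => theta (chart_inv x b) (coord_field x z b))}.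
    by have [_ /(_ x z 0%N) H _ _] := conn; exact: H.
  (* The fixed inner product [gG 1%g] is presented as [gG] at a constant base point with moving
     vectors, to which [metric_continuous] applies. *)
  pose o : G := 1%g; pose fM b := gM ((proj \o chart_inv x) b)
    (mdiff (proj \o chart_inv x) b v) (mdiff (proj \o chart_inv x) b w).
  pose fG b := gG (chart_inv o (chart o o))
     (coord_field o (theta (chart_inv x b) (coord_field x v b)) (chart o o))
     (coord_field o (theta (chart_inv x b) (coord_field x w b)) (chart o o)).
  have cG : {for b, continuous fG}.
    apply: (metric_continuous (a := fun=> chart o o) rG); [exact: chart_img_base|exact: cst_continuous|exact: cth..].
  have cS : {for b, continuous (fun b => a * fM b + fG b)}.
    by apply: continuousD; [apply: continuousM; [exact: cst_continuous|exact: cM]|exact: cG].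
  have E z : chart_img x z -> connection_metric proj gM (gG 1%g) theta a (chart_inv x z)
     (coord_field x v z) (coord_field x w z) = a * fM z + fG z.
    move=> iz; rewrite /connection_metric !tangent_map_mdiff//.
    by rewrite /fG !coord_field_base chart_inv_base.
  rewrite /prop_for /continuous_at E//; apply: cvg_trans cS.
  have nE : \forall z \near b, a * fM z + fG z = connection_metric proj gM (gG 1%g) theta a
      (chart_inv x z) (coord_field x v z) (coord_field x w z).
    by have := near_chart_img ib; apply: filterS => z /E.
  exact: near_eq_cvg nE.
Qed.

Lemma continuous_section (U : set M) (sigma : M -> G -> P) x g :
  open U -> smooth_map2 [set xg | U xg.1] sigma -> U x ->
  {for (x, g), continuous (fun xg => sigma xg.1 xg.2)}.
Proof.
move=> oU ss Ux; have [cs _] := ss x g.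
have := cs (chart x x, chart g g); rewrite /= !chart_inv_base.
move=> cc'; have {cc'}cc := cc' (And3 (chart_img_base x) (chart_img_base g) Ux).
pose ch (yh : M * G) := (chart x yh.1, chart g yh.2).
have c1 : {for (x, g), continuous (fun yh : M * G => chart x yh.1)}.
  apply: (@continuous_comp _ _ _ fst (chart x)); first exact: cvg_fst.
  exact/chart_cont/chart_dom_base.
have c2 : {for (x, g), continuous (fun yh : M * G => chart g yh.2)}.
  apply: (@continuous_comp _ _ _ snd (chart g)); first exact: cvg_snd.
  exact/chart_cont/chart_dom_base.
have cch : {for (x, g), continuous ch} by exact: (cvg_pair c1 c2).
have cS := @continuous_comp _ _ _ ch _ (x, g) cch cc.
have nd : \forall yh \near (x, g), chart_dom x yh.1 /\ chart_dom g yh.2.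
  exists (chart_dom x, chart_dom g); last by case=> y h [].
  by split; apply: open_nbhs_nbhs; split; [exact: chart_dom_open|exact: chart_dom_base|exact: chart_dom_open|exact: chart_dom_base].
have E yh : chart_dom x yh.1 -> chart_dom g yh.2 ->
    (fun ab => sigma (chart_inv x ab.1) (chart_inv g ab.2)) (ch yh) = sigma yh.1 yh.2.
  by move=> d1 d2; rewrite /= !chartK.
rewrite /prop_for /continuous_at -E; [|exact: chart_dom_base..].
apply: cvg_trans cS; apply: near_eq_cvg.
by apply: filterS nd => yh [d1 d2]; exact: E.
Qed.

(** The covering property is applied to M and, over each point of M, to G: a local trivialization
    turns neighbourhoods of the points of a compact fibre into a neighbourhood of the base point. *)
Lemma bundle_compact : compact [set: M] -> compact [set: G] -> compact [set: P].
Proof.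
move=> /compact_near_coveringP cM /compact_near_coveringP cG.
apply/compact_near_coveringP => I F Pr FF H.
suff : \forall i \near F, [set: M] `<=` [set x | forall p, proj p = x -> Pr i p].
  by apply: filterS => i Hi p _; exact: Hi (proj p) Logic.I p erefl.
apply: cM => x _; have [_ _ _ _ /(_ x)] := bundle.
move=> [U [phi [sigma [[oU Ux] [_ ss] sK _ _]]]].
have Hg : \forall yi \near filter_prod (nbhs x) F, [set: G] `<=` [set g | Pr yi.2 (sigma yi.1 g)].
  apply: cG => g _; have [[V J] [/= Vn FJ] VJ] := H (sigma x g) Logic.I.
  have := (continuous_section (g := g) oU ss Ux) V Vn; move=> [[A B] [/= nA nB] AB].
  exists (B, A `*` J); first by split => //=; exists (A, J).
  move=> [h [y i]] [/= Bh [Ay Ji]]; apply: (VJ (_, i)); split => //=.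
  exact: (AB (y, h)).
have nU : \forall y \near x, U y by exact: open_nbhs_nbhs.
have [[A J] [/= nA FJ] AJ] := Hg.
exists (A `&` U, J); first by split => //; exact: filterI.
move=> [y i] [/= [Ay Uy] Ji] p py; have := AJ (y, i) (conj Ay Ji) (phi p) Logic.I.
by rewrite /= -py sK // py.
Qed.

Lemma fibre_transitive p q : proj p = proj q -> exists g, q = act p g.
Proof.
have [_ _ _ projA /(_ (proj q))] := bundle.
move=> [U [phi [sigma [[_ Uq] _ sK _ phiA]]]] pq.
exists ((phi p)^-1 * phi q)%g; have E : phi (act p ((phi p)^-1 * phi q)%g) = phi q by rewrite phiA ?pq// mulgA mulgV mul1g.
by rewrite -[RHS]sK ?projA ?pq// E sK.
Qed.

(** The set [A] of points with a reachable translate is locally constant by horizontal lifting and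
    is a union of fibres. It therefore descends to an open and closed subset [B] of M, nonempty
    since it contains the image of [u]. *)
Lemma hjoined_all (gM : M -> 'rV[R]_m -> 'rV[R]_m -> R)
    (gG : G -> 'rV[R]_d -> 'rV[R]_d -> R) (u p : P) : connected [set: M] ->
  regular_metric gM -> regular_metric gG ->
  exists g, horizontally_joined theta u (act p g).
Proof.
move=> cM rM rG; have rg := connection_regular rM rG (@ler01 R).
set g1 := connection_metric _ _ _ _ _ in rg.
pose A p := exists g, horizontally_joined theta u (act p g).
have loc q r K : len_le g1 K q r -> A q -> A r.
  move=> [_ [c [s [ps <- <- _]]]].
  (* The relation ignores the length; only the induction along the curve is used. *)
  apply: (@length_subadditive _ _ _ g1 (fun p q _ => A p -> A q) rg _ _ _
     c s (curve_length g1 c + 1)) => //.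
  - by move=> x y z _ _ xy yz /xy.
  - move=> e t _ se _; have [a [_ _ _ Ha]] := horizontal_lift bundle conn se.
    apply: filterS Ha => b Hr _; split=> [[g Hg]|[g Hg]].
      exists (chart_inv (1%g : G) (a b) * g)%g; rewrite (actM bundle).
      exact (hjoined_trans conn Hg (hjoined_act bundle conn g Hr)).
    pose x := chart_inv (1%g : G) (a b); exists (x^-1 * g)%g.
    have := hjoined_act bundle conn (x^-1 * g)%g Hr.
    rewrite -(actM bundle) mulgA mulgV mul1g => /(hjoined_sym conn).
    by move=> H; exact: (hjoined_trans conn Hg H).
  - by rewrite ltrDl.
have nearA q : \forall r \near q, A q <-> A r.
  by apply: filterS (near_len_le q rg (@ltr01 R)) => r [H1 H2]; split; apply: loc; eassumption.
have fib q r : proj q = proj r -> A q -> A r.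
  move=> qr [g Hg]; have [h rh] := fibre_transitive (esym qr).
  by exists (h * g)%g; rewrite (actM bundle) -rh.
pose B : set M := [set x | exists2 q, proj q = x & A q].
have nearB x : \forall y \near x, B x <-> B y.
  have [_ _ _ _ /(_ x)] := bundle.
  move=> [U [phi [sigma [[oU Ux] [_ ss] _ sP _]]]].
  have cs := continuous_section (g := 1%g) oU ss Ux.
  have [[V W] [/= nV nW] VW] := cs _ (nearA (sigma x 1%g)).
  have nU : \forall y \near x, U y by exact: open_nbhs_nbhs.
  apply: filterS2 nV nU => y Vy Uy.
  have Axy : A (sigma x 1%g) <-> A (sigma y 1%g).
    exact: (VW (y, 1%g) (conj Vy (nbhs_singleton nW))).
  have BA z : U z -> B z <-> A (sigma z 1%g).
    move=> Uz; have [pz _] := sP z 1%g Uz; split=> [[q qz]|Az]; last by exists (sigma z 1%g).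
    by apply: fib; rewrite pz.
  by rewrite !BA.
have oB : open B.
  by rewrite openE => x Bx; apply: filterS (nearB x) => y [+ _]; exact.
have oC : open (~` B).
  by rewrite openE => x Bx; apply: filterS (nearB x) => y [_ H] /H.
have BT : B = setT.
  apply: cM.
  - exists (proj u), u => //; exists 1%g; rewrite (act1 bundle); exact: hjoined_refl conn u.
  - by exists B; rewrite ?setTI.
  - by exists B; rewrite ?setTI // -openC.
have [q qp Aq] : B (proj p) by rewrite BT.
exact: fib qp Aq.
Qed.

End Bundles.

(** * Comparison of the distances *)

Section RiemannianSubmersions.
Context {R : realType} {n l : nat} {N : manifoldType R n} {Q : manifoldType R l}.

(** Orthogonal projection off the kernel of [A], obtained by solving the normal equations for a
    basis [K] of that kernel. *)
Lemma orthogonal_part (g : N -> 'rV[R]_n -> 'rV[R]_n -> R) (x : N)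
    (A : {linear 'rV[R]_n -> 'rV[R]_l}) v : riemannian_metric g ->
  exists w, A w = A v /\ forall z, A z = 0 -> g x w z = 0.
Proof.
move=> mg; have rg := riemannian_regular mg; have [_ _ pg _] := mg.
pose K := row_base (kermx (lin1_mx A)); pose r := \rank (kermx (lin1_mx A)).
have KA i : A (row i K) = 0.
  apply: etrans (esym (mul_rV_lin1 A _)) _; apply/sub_kermxP.
  by rewrite (submx_trans (row_sub _ _))// eq_row_base.
have AK z : A z = 0 -> exists c : 'rV_r, z = \sum_i c 0 i *: row i K.
  move=> Az; have : (z <= K)%MS.
    by rewrite eq_row_base; apply/sub_kermxP; rewrite mul_rV_lin1.
  by move=> /submxP[c ->]; exists c; rewrite mulmx_sum_row.
pose Gr : 'M[R]_r := \matrix_(i, j) g x (row i K) (row j K).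
have GrE (c : 'rV_r) j : (c *m Gr) 0 j = g x (\sum_i c 0 i *: row i K) (row j K).
  rewrite mxE metric_suml//; apply: eq_bigr => i _.
  by rewrite metricZl// mxE.
(* A null vector of the Gram matrix gives a combination of basis vectors of norm zero, which
   vanishes by positive definiteness. *)
have uGr : Gr \in unitmx.
  rewrite -row_free_unit; apply: inj_row_free => c cG.
  have c0 : \sum_i c 0 i *: row i K = 0.
    apply/eqP; apply: contraT => /(pg x) /lt0r_neq0 /eqP[].
    rewrite metric_sumr//.
    by apply: big1 => j _; rewrite metricZr// -GrE cG mxE mulr0.
  by apply: (row_free_inj (row_base_free (kermx (lin1_mx A)))); rewrite mul0mx mulmx_sum_row.
pose b : 'rV_r := \row_j g x v (row j K).
pose c := b *m invmx Gr.
pose y := \sum_i c 0 i *: row i K.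
have Ay : A y = 0 by rewrite linear_sum; apply: big1 => i _; rewrite linearZ /= KA scaler0.
exists (v - y); split; first by rewrite linearB /= Ay subr0.
move=> z /AK[e ->]; rewrite metric_sumr//; apply: big1 => i _; rewrite metricZr//.
rewrite metricDl// -scaleN1r metricZl// -GrE /c mulmxKV// mxE.
by rewrite mulN1r subrr mulr0.
Qed.

Variables (gN : N -> 'rV[R]_n -> 'rV[R]_n -> R) (gQ : Q -> 'rV[R]_l -> 'rV[R]_l -> R)
  (rho : N -> Q).
Hypotheses (mN : riemannian_metric gN) (subm : riemannian_submersion gN gQ rho).

(** Pythagoras: only the part of [v] orthogonal to the kernel is seen by rho, and there rho is
    isometric. *)
Lemma submersion_contract x v :
  gQ (rho x) (tangent_map rho x v) (tangent_map rho x v) <= gN x v v.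
Proof.
have rN := riemannian_regular mN; have [_ H] := subm.
have [w [wv wo]] := orthogonal_part x ('d (chart (rho x) \o rho \o chart_inv x) (chart x x)) v mN.
have wv' : tangent_map rho x w = tangent_map rho x v by [].
rewrite -wv' H//; have -> : v = w + (v - w) by rewrite addrC subrK.
have o : gN x w (v - w) = 0 by apply: wo; rewrite linearB /= wv subrr.
move: (v - w) o => y o; rewrite metricDl// !metricDr// (metricC _ y w)// o addr0 add0r lerDl.
by have [_ _ + _] := rN; exact.
Qed.

Lemma horizontal_vector x z : exists2 w, tangent_map rho x w = z & gN x w w = gQ (rho x) z z.
Proof.
have [[_ surj] H] := subm; have [v vz] := surj x z.
have [w [wv wo]] := orthogonal_part x ('d (chart (rho x) \o rho \o chart_inv x) (chart x x)) v mN.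
have wv' : tangent_map rho x w = z by rewrite -vz.
by exists w; rewrite // -wv' H.
Qed.

End RiemannianSubmersions.

(** * Lower bound: projection to Q does not increase lengths *)

Section Collapse.
Context {R : realType} {d m k l : nat} {G : lieGroupType R d} {M : manifoldType R m}
  {P : manifoldType R k} {Q : manifoldType R l}.
Variables (proj : P -> M) (act : P -> G -> P) (gG : G -> 'rV[R]_d -> 'rV[R]_d -> R)
  (gM : M -> 'rV[R]_m -> 'rV[R]_m -> R) (theta : P -> 'rV[R]_k -> 'rV[R]_d) (u : P)
  (rho : G -> Q) (gQ : Q -> 'rV[R]_l -> 'rV[R]_l -> R).
Hypotheses (bundle : principal_bundle proj act) (gG_bi : bi_invariant_metric gG)
  (gM_riem : riemannian_metric gM) (conn : principal_connection act theta)
  (Q_quot : homogeneous_space (holonomy act theta u) rho)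
  (gQ_riem : riemannian_metric gQ) (gQ_subm : riemannian_submersion gG gQ rho)
  (Mconnected : connected [set: M]).

Local Notation "p ~ q" := (horizontally_joined theta p q) (at level 70).
Local Notation gP := (connection_metric proj gM (gG 1%g) theta).

Lemma gG_riem : riemannian_metric gG. Proof. by have [] := gG_bi. Qed.

Lemma gG_regular : regular_metric gG. Proof. exact/riemannian_regular/gG_riem. Qed.

Lemma gP_regular a : 0 <= a -> regular_metric (gP a).
Proof.
by apply: (connection_regular bundle conn); [exact: riemannian_regular|exact: gG_regular].
Qed.

Lemma lift_all p : exists g, u ~ act p g.
Proof.
by apply: (hjoined_all bundle conn u p Mconnected (riemannian_regular gM_riem) gG_regular).
Qed.

(** Translating u ~ p g by g^-1 g' gives u g^-1 g' ~ p g', so u ~ p g' means that g^-1 g' is a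
    holonomy. The correspondence is thus the graph of a map from P to Q. *)
Lemma rho_hjoined p g g' : u ~ act p g -> (u ~ act p g' <-> rho g = rho g').
Proof.
move=> ug; have [_ _ /(_ g g') ->] := Q_quot.
have := hjoined_act bundle conn (g^-1 * g')%g ug.
rewrite -(actM bundle) mulgA mulgV mul1g => H; split=> [ug'|h].
  exact (hjoined_trans conn ug' (hjoined_sym conn H)).
exact (hjoined_trans conn h H).
Qed.

(** The lift multiplies g on the left by x, so the motion of x is carried to x g by a right
    translation, an isometry by bi-invariance. *)
Lemma len_le_rho K g g' h : len_le gG K g g' ->
  len_le gQ K (rho (g * h)%g) (rho (g' * h)%g).
Proof.
have [[sr _] _] := gQ_subm.
apply: (len_le_map (f := rho \o (fun x : G => (x * h)%g))).
  exact: smooth_map_comp (smooth_mulgr h) sr.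
move=> x v; rewrite tangent_map_comp//; last exact: smooth_mulgr.
have [_ _ /(_ h x v v) <-] := gG_bi.
exact: (submersion_contract gG_riem gQ_subm).
Qed.

Lemma curve_quotient_le (a : R) c s K g g' : 0 <= a -> piecewise_smooth c s ->
  curve_length (gP a) c < K -> u ~ act (c 0) g -> u ~ act (c 1) g' ->
  len_le gQ K (rho g) (rho g').
Proof.
move=> a0 ps cK; have rP := gP_regular a0; have rQ := riemannian_regular gQ_riem.
pose Psi p p' L := forall g g', u ~ act p g -> u ~ act p' g' -> len_le gQ L (rho g) (rho g').
suff : Psi (c 0) (c 1) K by exact.
apply: (@length_subadditive _ _ _ (gP a) Psi rP _ _ _ c s K ps cK).
- move=> x y z L L' xy yz h h' xh zh'; have [hy yhy] := lift_all y.
  by apply: len_le_trans rQ (xy h hy _ _) (yz hy h' _ _).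
- by move=> x y L L' H LL h h' H1 H2; exact: len_le_mono (H _ _ H1 H2) LL.
move=> e t L se spL.
have [x [xt sx dx Hx]] := horizontal_lift bundle conn se.
have spG : Num.sqrt (gG 1%g (- theta (e t) (velocity e t)) (- theta (e t) (velocity e t))) < L.
  apply: le_lt_trans spL; rewrite metricN2//; last exact: gG_regular.
  apply: ler_wsqrtr; rewrite /connection_metric lerDr mulr_ge0//.
  by have [_ _ + _] := riemannian_regular gM_riem; exact.
have := len_le_derive gG_regular xt dx spG; move: Hx.
apply: filterS2 => r Hr Hl rt; have {Hl} Hl := Hl rt.
have key h h' : u ~ act (e t) h -> u ~ act (e r) h' -> len_le gQ (L * `|r - t|) (rho h) (rho h').
  move=> uh uh'; have /(_ h) := len_le_rho _ Hl; rewrite mul1g.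
  have uxh : u ~ act (e r) (chart_inv 1%g (x r) * h)%g.
    by rewrite (actM bundle); exact (hjoined_trans conn uh (hjoined_act bundle conn h Hr)).
  (* Both [h'] and x(r) h bring [e r] to a point reachable from [u], so they have the same image in
     Q. *)
  by have /(_ uh') <- := (rho_hjoined h' uxh).1.
by split => h h' H1 H2; [exact: key|apply: len_le_rev rQ _; exact: key].
Qed.

Lemma quotient_dist_le (a : R) p p' g g' : 0 <= a -> (exists K, len_le (gP a) K p p') ->
  u ~ act p g -> u ~ act p' g' ->
  riemannian_dist gQ (rho g) (rho g') <= riemannian_dist (gP a) p p'.
Proof.
move=> a0 [K [_ [c [s [ps c0 c1 _]]]]] H H'; apply: lb_le_inf.
  by exists (curve_length (gP a) c), c, s; split.
move=> _ [e [r [pe e0 e1 ->]]]; apply/ler_addgt0Pr => eps eps0.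
apply: len_le_dist; first exact: riemannian_regular.
by apply: (curve_quotient_le a0 pe); rewrite ?ltrDl ?e0 ?e1.
Qed.

End Collapse.

Section SubmersionCurve.
Context {R : realType}.

(** Since [D] is o(b - s), the domination makes [A] o(b - s) as well. *)
Lemma is_derive_dominated n l (A : R -> 'rV[R]_n) (D : R -> 'rV[R]_l) (C s : R) :
  D s = 0 -> is_derive s 1 D 0 -> A s = 0 ->
  (\forall b \near s, `|A b| <= C * `|D b|) -> is_derive s 1 A 0.
Proof.
move=> Ds [dD DD] As HA.
have cD : (fun h : R => h^-1 *: ((D \o shift s) (h *: 1) - D s)) @ 0^' --> (0 : 'rV[R]_l).
  by rewrite -DD; exact: dD.
have cA : (fun h : R => h^-1 *: ((A \o shift s) (h *: 1) - A s)) @ 0^' --> (0 : 'rV[R]_n).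
  apply/cvgr0Pnorm_lt => eps e0.
  have C0 : 0 < `|C| + 1 by rewrite ltr_wpDl.
  have e1 : 0 < eps / (`|C| + 1) by rewrite divr_gt0.
  have /cvgr0Pnorm_lt /(_ _ e1) nD := cD.
  have nA : \forall h \near (0 : R)^', `|A (h + s)| <= C * `|D (h + s)|.
    have /nbhs_ballP[r /= r0 Hr] := HA.
    apply/nbhs_ballP; exists r => // h; rewrite /ball /= sub0r normrN => hr _.
    by apply: Hr; rewrite /ball /= distrC addrK.
  apply: filterS2 nD nA => h; rewrite Ds As !subr0 /= -[h *: 1]/(h * 1) mulr1 !normrZ.
  rewrite ltr_pdivlMr// => hD hA.
  apply: le_lt_trans hD; rewrite -mulrA ler_wpM2l//; apply: (le_trans hA).
  by rewrite mulrC ler_wpM2l// (le_trans (ler_norm C))// lerDl.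
by split; [exact: cvgP cA|exact: cvg_lim cA].
Qed.

Lemma is_derive_diff_comp (V W : normedModType R) (f : R -> V) (g : V -> W) (s : R) (v : V) :
  is_derive s 1 f v -> differentiable g (f s) -> is_derive s 1 (g \o f) ('d g (f s) v).
Proof.
move=> [/derivable1_diffP df <-] dg; have dgf := differentiable_comp df dg.
split; first exact: diff_derivable.
apply: (etrans (deriveE _ dgf)); apply: (etrans (congr1 (fun F : R -> W => F 1) (diff_comp df dg))).
by congr ('d g (f s) _); rewrite deriveE.
Qed.

(* The straight line with direction w0 covers e up to an error o(b - s), which
   the open mapping theorem corrects. *)
Lemma submersion_curve n l (N : manifoldType R n) (Q : manifoldType R l)
    (rho : N -> Q) (e : R -> Q) (s : R) (x : N) w0 :
  smooth_map setT rho -> (forall z, exists v, tangent_map rho x v = z) ->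
  msmooth e s -> rho x = e s -> tangent_map rho x w0 = velocity e s ->
  exists a : R -> 'rV[R]_n, [/\ a s = chart x x, is_derive s 1 a w0 &
    \forall b \near s, rho (chart_inv x (a b)) = e b].
Proof.
move=> sr surj se xs w0s; pose y0 := chart x x; pose phi := chart (e s) \o (rho \o chart_inv x).
have sci : msmooth (rho \o chart_inv x) y0.
  by apply: msmooth_map sr _; exact/msmooth_chart_inv/chart_img_base.
have E0 : (rho \o chart_inv x) y0 = e s by rewrite /= chart_inv_base.
have dx : chart_dom (e s) ((rho \o chart_inv x) y0) by rewrite E0; exact: chart_dom_base.
have sphi : smooth_near phi y0 by exact: msmooth_chart sci dx.
have dphi v : 'd phi y0 v = tangent_map rho x v by rewrite /tangent_map xs.
have [|C [dl [C0 dl0 HO]]] := open_mapping sphi.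
  by move=> z; have [v vz] := surj z; exists v; rewrite dphi.
pose q b := chart (e s) (e b); pose y1 (b : R) := y0 + (b - s) *: w0.
pose D b := q b - phi (y1 b).
have y1s : y1 s = y0 by rewrite /y1 subrr scale0r addr0.
have phis : phi y0 = q s by rewrite /phi /q /= chart_inv_base xs.
have Ds : D s = 0 by rewrite /D y1s phis subrr.
have dy1 : is_derive s 1 y1 w0.
  have E : y1 = (fun t : R => (y0 - s *: w0) + t *: w0).
    by apply/funext => t; rewrite /y1 scalerBl addrAC addrA.
  have [sl dl1] := diff_line (y0 - s *: w0) w0 s.
  by rewrite E; split; [exact/diff_derivable/smooth_near_diff|rewrite deriveE//; exact: smooth_near_diff].
have dq : is_derive s 1 q (velocity e s).
  have dch := msmooth_diff se (chart_dom_base _).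
  by split; [exact: diff_derivable|rewrite deriveE//= (velocityE se)].
have dpy : is_derive s 1 (phi \o y1) (velocity e s).
  have d2 : differentiable phi (y1 s) by rewrite y1s; exact: smooth_near_diff.
  have E : 'd phi y0 w0 = velocity e s := etrans (dphi w0) w0s.
  have [dd DD] := is_derive_diff_comp dy1 d2; split; first exact: dd.
  by apply: (etrans DD); rewrite y1s; exact: E.
have dD : is_derive s 1 D 0 by rewrite -(subrr (velocity e s)); exact: is_deriveB.
pose good b y := phi y = q b /\ `|y - y1 b| <= C * `|D b|.
(* A choice with default 0; near [s] the open mapping theorem provides an admissible value. *)
pose a b := xget 0 [set y | good b y].
have cy : {for s, continuous y1}.
  by apply/differentiable_continuous/derivable1_diffP; have [] := dy1.
have cD : {for s, continuous D}.
  by apply/differentiable_continuous/derivable1_diffP; have [] := dD.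
have near_good : \forall b \near s, good b (a b).
  have n1 : \forall b \near s, `|y1 b - y0| < dl.
    have /cvgrPdist_lt /(_ _ dl0) := cy; rewrite y1s.
    by apply: filterS => b; rewrite distrC.
  have n2 : \forall b \near s, `|D b| < dl.
    have /cvgrPdist_lt /(_ _ dl0) := cD; rewrite Ds.
    by apply: filterS => b; rewrite sub0r normrN.
  apply: filterS2 n1 n2 => b b1 b2; have [y yq yC] := HO _ (q b) b1 b2.
  by apply: (xgetPex 0 (P := [set y | good b y])); exists y.
(* The defect vanishes at [s], so the linear estimate forces the chosen value there. *)
have as_ : a s = y0.
  have [_] := nbhs_singleton near_good.
  by rewrite Ds normr0 mulr0 normr_le0 subr_eq0 y1s => /eqP.
have da : is_derive s 1 a w0.
  have dA : is_derive s 1 (fun b => a b - y1 b) 0.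
    apply: (is_derive_dominated (C := C) Ds dD); first by rewrite as_ y1s subrr.
    by apply: filterS near_good => b [].
  have := is_deriveD dA dy1; rewrite add0r.
  by rewrite (_ : (fun b => _) + y1 = a) //; apply/funext => b; rewrite /= -[LHS]/(_ + _) subrK.
exists a; split; [exact: as_|exact: da|].
have ca : {for s, continuous a}.
  by apply/differentiable_continuous/derivable1_diffP; have [] := da.
have nd : \forall b \near s, chart_dom (e s) (rho (chart_inv x (a b))).
  apply: (near_chart_dom (c := (rho \o chart_inv x) \o a)); last by rewrite /= as_.
  by apply: continuous_comp ca _; rewrite as_; exact: msmooth_cont.
have ne := near_chart_dom (msmooth_cont se) (chart_dom_base (e s)).
apply: filterS3 near_good nd ne => b [ph _] d1 d2.
by rewrite -(chartK _ _ d1) -(chartK _ _ d2); congr (chart_inv _ _).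
Qed.

End SubmersionCurve.

(** * Upper bound: lifting from Q to P in the limit *)

Section CollapseUpper.
Context {R : realType} {d m k l : nat} {G : lieGroupType R d} {M : manifoldType R m}
  {P : manifoldType R k} {Q : manifoldType R l}.
Variables (proj : P -> M) (act : P -> G -> P) (gG : G -> 'rV[R]_d -> 'rV[R]_d -> R)
  (gM : M -> 'rV[R]_m -> 'rV[R]_m -> R) (theta : P -> 'rV[R]_k -> 'rV[R]_d) (u : P)
  (rho : G -> Q) (gQ : Q -> 'rV[R]_l -> 'rV[R]_l -> R) (T : R) (f : R -> R).
Hypotheses (bundle : principal_bundle proj act) (gG_bi : bi_invariant_metric gG)
  (gM_riem : riemannian_metric gM) (conn : principal_connection act theta)
  (Q_quot : homogeneous_space (holonomy act theta u) rho)
  (gQ_riem : riemannian_metric gQ) (gQ_subm : riemannian_submersion gG gQ rho)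
  (Gconnected : connected [set: G])
  (f_gt0 : \forall t \near T^'-, 0 < f t) (f_lim : f t @[t --> T^'-] --> (0 : R)).

Local Notation "p ~ q" := (horizontally_joined theta p q) (at level 70).
Local Notation gP := (connection_metric proj gM (gG 1%g) theta).

Let gP_reg a : 0 <= a -> regular_metric (gP a).
Proof. exact: (gP_regular bundle gG_bi gM_riem conn). Qed.

(** The threshold for [t] may depend on the points and on [eps], which makes the relation additive
    by halving [eps]. Uniformity in the points is recovered later by compactness. *)
Definition eventually_le (L : R) (p q : P) : Prop :=
  forall eps, 0 < eps -> \forall t \near T^'-, len_le (gP (f t)) (L + eps) p q.

Lemma eventually_le_trans L L' p q r : eventually_le L p q -> eventually_le L' q r ->
  eventually_le (L + L') p r.
Proof.
move=> pq qr eps e0; have e2 : 0 < eps / 2 by rewrite divr_gt0.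
apply: filterS3 (pq _ e2) (qr _ e2) f_gt0 => t pqt qrt ft.
apply: len_le_mono (len_le_trans (gP_reg (ltW ft)) pqt qrt) _.
by rewrite addrACA -splitr.
Qed.

Lemma eventually_le_mono L L' p q : L <= L' -> eventually_le L p q -> eventually_le L' p q.
Proof.
move=> LL pq eps e0; apply: filterS (pq _ e0) => t pqt.
by apply: len_le_mono pqt _; rewrite lerD2r.
Qed.

Lemma eventually_le_sym L p q : eventually_le L p q -> eventually_le L q p.
Proof.
move=> pq eps e0; apply: filterS2 (pq _ e0) f_gt0 => t pqt ft.
exact: len_le_rev (gP_reg (ltW ft)) pqt.
Qed.

Lemma horizontal_eventually_le p q : p ~ q -> eventually_le 0 p q.
Proof.
move=> [c [s [ps c0 c1 Hc]]] eps e0.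
have rg := gP_reg (@ler01 R).
have [_ [B HB]] := tame_speed rg ps.
(* [B] bounds the speed for f = 1. Along a horizontal path only the base term remains, so
   [f t * B ^+ 2 <= eps ^+ 2] is wanted; the summand 1 avoids division by zero. *)
have eB : 0 < eps ^+ 2 / (B ^+ 2 + 1) by rewrite divr_gt0 ?exprn_gt0// ltr_wpDl// sqr_ge0.
have nf : \forall t \near T^'-, f t < eps ^+ 2 / (B ^+ 2 + 1).
  have /cvgrPdist_lt /(_ _ eB) := f_lim; apply: filterS => t.
  by rewrite sub0r normrN; apply: le_lt_trans; exact: ler_norm.
apply: filterS2 nf f_gt0 => t ft ft0; rewrite add0r; split; first exact: e0.
exists c, s; split => // r r01 rs.
have := Hc r r01 rs; move=> th0.
have := HB r; case/andP: r01 => r0 r1; rewrite r0 (ltW r1) => /(_ erefl).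
rewrite /speed /connection_metric th0 metric0r; last exact: gG_regular.
rewrite !addr0 mul1r.
set y := gM _ _ _ => yB.
have y0 : 0 <= y by have [_ _ + _] := riemannian_regular gM_riem; exact.
have yB2 : y <= B ^+ 2.
  have B0 : 0 <= B by apply: le_trans yB; exact: normr_ge0.
  rewrite -(sqr_sqrtr y0) lerXn2r// ?nnegrE ?sqrtr_ge0//.
  by rewrite -[leLHS]ger0_norm// sqrtr_ge0.
have BB : 0 < B ^+ 2 + 1 by rewrite ltr_wpDl// sqr_ge0.
rewrite ltr_pdivlMr// in ft; apply: le_trans (ltW ft).
by rewrite ler_wpM2l ?ltW// (le_lt_trans yB2)// ltrDl.
Qed.

(** The image curves are vertical, so [a] has no influence; [theta] maps their velocity to - x'
    x^-1, whose norm is that of x' by right invariance. *)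
Lemma fibre_len_le K x y a : len_le gG K x y ->
  len_le (gP a) K (act u x^-1%g) (act u y^-1%g).
Proof.
have si := invg_smooth (s := G); have sa := smooth_actl bundle u.
apply: (len_le_map (f := act u \o (fun x : G => x^-1%g))).
  exact: smooth_map_comp si sa.
move=> {}x v; set F := act u \o _.
(* Writing u z^-1 as q (z x^-1)^-1 moves the differentiation to the identity of G, where inversion
   has differential -1. *)
pose q := F x; have FE : F = (act q \o (fun x : G => x^-1%g)) \o (fun z : G => z * x^-1)%g.
  apply/funext => z; rewrite /F /q /F /= -(actM bundle).
  by rewrite invgM invgK mulgA mulVg mul1g.
have sR := smooth_mulgr x^-1%g.
have sai : smooth_map setT (act q \o (fun x : G => x^-1%g)).
  exact: smooth_map_comp si (smooth_actl bundle q).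
have TE : tangent_map F x v = - fundamental_field act (tangent_map (fun z : G => z * x^-1)%g x v) q.
  rewrite FE (tangent_map_comp x v sR sai) mulgV.
  rewrite (tangent_map_comp _ _ si (smooth_actl bundle q)) invg1 tangent_invg1.
  by rewrite -scaleN1r tangent_mapZ scaleN1r.
rewrite /connection_metric -/q TE (thetaN conn); have [_ _ _ ->] := conn.
have -> : tangent_map proj (F x) (- fundamental_field act (tangent_map (fun z : G => z * x^-1)%g x v) q) = 0.
  rewrite -TE -(tangent_map_comp x v (smooth_map_comp si sa) (smooth_proj bundle)).
  rewrite (_ : proj \o F = fun=> proj u) ?tangent_map_cst//.
  by apply/funext => z; rewrite /F /=; have [_ _ _ -> _] := bundle.
rewrite metric0r; last exact: riemannian_regular.
rewrite mulr0 add0r metricN2; last exact: gG_regular.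
by have [_ _ /(_ x^-1%g x v v)] := gG_bi; rewrite mulgV => ->.
Qed.

Lemma fibre_joined p g g' : u ~ act p g -> rho g = rho g' -> p ~ act u g'^-1%g.
Proof.
move=> ug gg'; have ug' := (rho_hjoined bundle conn Q_quot g' ug).2 gg'.
have := hjoined_act bundle conn g'^-1%g ug'; rewrite -(actM bundle) mulgV (act1 bundle).
exact: (hjoined_sym conn).
Qed.

Lemma curve_eventually_le c s K p p' g g' : piecewise_smooth c s ->
  curve_length gQ c < K -> rho g = c 0 -> rho g' = c 1 ->
  u ~ act p g -> u ~ act p' g' -> eventually_le K p p'.
Proof.
move=> ps cK; have rQ := riemannian_regular gQ_riem; move: p p' g g'.
pose Psi q q' L := forall p p' g g', rho g = q -> rho g' = q' ->
  u ~ act p g -> u ~ act p' g' -> eventually_le L p p'.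
suff : Psi (c 0) (c 1) K by exact.
have [[sr surj] rho_surj _] := Q_quot.
apply: (@length_subadditive _ _ _ gQ Psi rQ _ _ _ c s K ps cK).
- move=> x y z L L' xy yz p p' g g' gx gz pg pg'; have [h hy] := rho_surj y.
  have uh : u ~ act (act u h^-1%g) h.
    by rewrite -(actM bundle) mulVg (act1 bundle); exact: hjoined_refl conn u.
  exact: eventually_le_trans (xy p _ g h gx hy pg uh) (yz _ p' h g' hy gz uh pg').
- move=> x y L L' H LL p p' g g' H1 H2 H3 H4.
  exact: eventually_le_mono LL (H _ _ _ _ H1 H2 H3 H4).
move=> e t L se spL; have [g0 g0e] := rho_surj (e t).
have [w0 w0e w0g] := horizontal_vector (gG_riem gG_bi) gQ_subm g0 (velocity e t).
have [x [xt dx Hx]] := submersion_curve sr (surj g0) se g0e w0e.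
have gL : Num.sqrt (gG g0 w0 w0) < L by rewrite w0g g0e.
have := len_le_derive (gG_regular gG_bi) xt dx gL; move: Hx.
apply: filterS2 => r rr Hl rt; have {Hl}Hl := Hl rt.
have key p p' g g' : rho g = e t -> rho g' = e r -> u ~ act p g -> u ~ act p' g' ->
    eventually_le (L * `|r - t|) p p'.
  move=> ge ge' ug ug'.
  (* A horizontal path to the fibre of [u], a short path inside that fibre and a horizontal path
     back; only the middle one costs length in the limit. *)
  have H1 := fibre_joined ug (etrans ge (esym g0e)).
  have H2 := fibre_joined ug' (etrans ge' (esym rr)).
  have H3 : eventually_le (L * `|r - t|) (act u g0^-1%g) (act u (chart_inv g0 (x r))^-1%g).
    move=> eps e0; apply: nearW => b; apply: len_le_mono (fibre_len_le (f b) Hl) _.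
    by rewrite lerDl ltW.
  have := eventually_le_trans (horizontal_eventually_le H1) H3.
  move=> /eventually_le_trans /(_ (eventually_le_sym (horizontal_eventually_le H2))).
  by rewrite add0r addr0.
split=> p p' g g' ge ge' ug ug'; first exact: key ge ge' ug ug'.
exact/eventually_le_sym/(key _ _ _ _ ge' ge ug' ug).
Qed.

(** Connectedness of G enters to produce some path in Q between the two cosets, so that the infimum
    is approached by lengths. *)
Lemma quotient_eventually_le p p' g g' : u ~ act p g -> u ~ act p' g' ->
  eventually_le (riemannian_dist gQ (rho g) (rho g')) p p'.
Proof.
move=> ug ug' eps e0; have e2 : 0 < eps / 2 by rewrite divr_gt0.
have [K Kg] := connected_len_le g g' Gconnected (gG_regular gG_bi).
have := len_le_rho gG_bi gQ_subm 1%g Kg; rewrite !mulg1 => -[_ [c [s [ps c0 c1 _]]]].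
have [|_ [c' [s' [ps' c0' c1' ->]]] cd] := inf_lt _
   (ltr_pwDr e2 (lexx (riemannian_dist gQ (rho g) (rho g')))).
  by exists (curve_length gQ c), c, s; split.
have := curve_eventually_le ps' cd (esym c0') (esym c1') ug ug'.
by move=> /(_ _ e2); apply: filterS => t; rewrite -addrA -splitr.
Qed.

End CollapseUpper.

(** * The Gromov-Hausdorff limit *)

Lemma dist_triangle {R : realType} n (N : manifoldType R n)
    (g : N -> 'rV[R]_n -> 'rV[R]_n -> R) p q r : regular_metric g ->
  (exists K, len_le g K p q) -> (exists K, len_le g K q r) ->
  riemannian_dist g p r <= riemannian_dist g p q + riemannian_dist g q r.
Proof.
move=> rg [K pq] [K' qr]; apply/ler_addgt0Pr => eps e0.
have e2 : 0 < eps / 2 by rewrite divr_gt0.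
have pq' : len_le g (riemannian_dist g p q + eps / 2) p q.
  by apply: dist_len_le rg pq _; rewrite ltrDl.
have qr' : len_le g (riemannian_dist g q r + eps / 2) q r.
  by apply: dist_len_le rg qr _; rewrite ltrDl.
have := len_le_dist rg (len_le_trans rg pq' qr').
by rewrite addrACA -splitr.
Qed.

(** A point of [X] makes every correspondence nonempty; the supremum over an empty one would be
    -oo. *)
Lemma GH_dist_ge0 {R : realType} (X Y : Type) (dX : X -> X -> R) (dY : Y -> Y -> R) :
  X -> (0 <= GH_dist dX dY)%E.
Proof.
move=> x; apply: mule_ge0; first by rewrite lee_fin invr_ge0.
apply: le_ereal_inf_tmp => _ [C [CX _] <-]; have [y xy] := CX x.
apply: (@le_trans _ _ (`|dX x x - dY y y|)%:E); first by rewrite lee_fin.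
by apply: ereal_sup_ubound; exists (x, y), (x, y).
Qed.

Lemma GH_dist_le {R : realType} (X Y : Type) (dX : X -> X -> R) (dY : Y -> Y -> R)
    (C : set (X * Y)) (eps : R) : correspondence C ->
  (forall a b, C a -> C b -> `|dX a.1 b.1 - dY a.2 b.2| <= eps) ->
  (GH_dist dX dY <= (2^-1 * eps)%:E)%E.
Proof.
move=> cC H; rewrite EFinM; apply: lee_wpmul2l; first by rewrite lee_fin invr_ge0.
apply: (@le_trans _ _ (distortion dX dY C)).
  by apply: ereal_inf_lbound; exists C.
apply: ge_ereal_sup => _ [a [b [Ca Cb ->]]]; rewrite lee_fin; exact: H.
Qed.

(** Convergence to 0 in the extended reals includes eventual finiteness, which the bound for
    [eps = 1] supplies. *)
Lemma cvge0_of_le {R : realType} (I : Type) (F : set_system I) {FF : ProperFilter F}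
    (h : I -> \bar R) : (forall t, (0 <= h t)%E) ->
  (forall eps : R, 0 < eps -> \forall t \near F, (h t <= eps%:E)%E) ->
  h t @[t --> F] --> (0 : \bar R)%E.
Proof.
move=> h0 H; apply/fine_cvgP; split.
  apply: filterS (H 1 ltr01) => t ht; rewrite ge0_fin_numE//.
  by apply: le_lt_trans ht _; rewrite ltry.
apply/cvgrPdist_le => eps e0; apply: filterS (H eps e0) => t ht /=.
rewrite sub0r normrN ger0_norm; last exact: fine_ge0.
rewrite -lee_fin fineK// ge0_fin_numE//.
by apply: le_lt_trans ht _; rewrite ltry.
Qed.

Theorem corollary1 (R : realType) (d m k l : nat)
  (G : lieGroupType R d) (M : manifoldType R m) (P : manifoldType R k)
  (Gcompact : compact [set: G]) (Gconnected : connected [set: G])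
  (Mcompact : compact [set: M]) (Mconnected : connected [set: M])
  (proj : P -> M) (act : P -> G -> P) (bundle : principal_bundle proj act)
  (gG : G -> 'rV[R]_d -> 'rV[R]_d -> R) (gG_bi : bi_invariant_metric gG)
  (gM : M -> 'rV[R]_m -> 'rV[R]_m -> R) (gM_riem : riemannian_metric gM)
  (T : R) (T_gt0 : 0 < T)
  (f : R -> R) (f_cont : {within `[0, T[, continuous f})
  (f_gt0 : forall t, 0 <= t < T -> 0 < f t)
  (theta : P -> 'rV[R]_k -> 'rV[R]_d)
  (theta_conn : principal_connection act theta)
  (u : P) (hol_closed : closed (holonomy act theta u))
  (* Q is G/Hol_u(theta), and gQ is the metric g_T *)
  (Q : manifoldType R l) (rho : G -> Q)
  (Q_quot : homogeneous_space (holonomy act theta u) rho)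
  (gQ : Q -> 'rV[R]_l -> 'rV[R]_l -> R) (gQ_riem : riemannian_metric gQ)
  (gQ_inv : G_invariant_metric rho gQ)
  (gQ_subm : riemannian_submersion gG gQ rho)
  (f_lim : f t @[t --> T^'-] --> (0 : R)) :
  GH_dist
    (riemannian_dist (connection_metric proj gM (gG 1%g) theta (f t)))
    (riemannian_dist gQ) @[t --> T^'-] --> (0 : \bar R)%E.
Proof.
have f_pos : \forall t \near T^'-, 0 < f t.
  have n0 : \forall t \near T^'-, 0 < t by exact: nbhs_left_gt.
  have nT : \forall t \near T^'-, t < T by exact: nbhs_left_lt.
  by apply: filterS2 n0 nT => t t0 tT; apply: f_gt0; rewrite ltW.
have f_lt1 : \forall t \near T^'-, f t < 1.
  have /cvgrPdist_lt /(_ _ ltr01) := f_lim; apply: filterS => t.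
  by rewrite sub0r normrN; apply: le_lt_trans; exact: ler_norm.
pose gP := connection_metric proj gM (gG 1%g) theta.
have rQ := riemannian_regular gQ_riem.
have rP a : 0 <= a -> regular_metric (gP a) by exact: (gP_regular bundle gG_bi gM_riem theta_conn).
have reach (p : P) : exists g, horizontally_joined theta u (act p g).
  exact: (lift_all u bundle gG_bi gM_riem theta_conn Mconnected p).
have Qpath g g' : exists K, len_le gQ K (rho g) (rho g').
  have [K Kg] := connected_len_le g g' Gconnected (gG_regular gG_bi).
  by have := len_le_rho gG_bi gQ_subm 1%g Kg; rewrite !mulg1; exists K.
pose C : set (P * Q) := [set pq | exists2 g, rho g = pq.2 & horizontally_joined theta u (act pq.1 g)].
have corrC : correspondence C.
  split=> [p|q]; first by have [g ug] := reach p; exists (rho g), g.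
  have [_ /(_ q)[g <-] _] := Q_quot; exists (act u g^-1%g), g => //=.
  by rewrite -(actM bundle) mulVg (act1 bundle); exact: hjoined_refl theta_conn u.
apply: cvge0_of_le => [t|eps e0]; first exact: GH_dist_ge0 u.
(* Five such errors occur: moving each of the two points costs one in P and one in Q, and the bound
   at the fixed pair costs the fifth. *)
have e6 : 0 < eps / 6 by rewrite divr_gt0.
have /compact_near_coveringP cPP := compact_setX (bundle_compact bundle Mcompact Gcompact) (bundle_compact bundle Mcompact Gcompact).
(* Compactness in its near-covering form: an estimate valid near each pair of points for [t] near
   [T] holds for all pairs at once. *)
have key : \forall t \near T^'-, [set: P] `*` [set: P] `<=` [set pp | forall g g',
    horizontally_joined theta u (act pp.1 g) -> horizontally_joined theta u (act pp.2 g') ->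
    `|riemannian_dist (gP (f t)) pp.1 pp.2 - riemannian_dist gQ (rho g) (rho g')| <= eps].
  apply: (cPP _ _ (fun t pp => forall g g',
    horizontally_joined theta u (act pp.1 g) -> horizontally_joined theta u (act pp.2 g') ->
    `|riemannian_dist (gP (f t)) pp.1 pp.2 - riemannian_dist gQ (rho g) (rho g')| <= eps)).
  move=> [p0 p0'] _.
  have [g0 ug0] := reach p0; have [g0' ug0'] := reach p0'.
  have nt := quotient_eventually_le bundle gG_bi gM_riem theta_conn Q_quot gQ_riem gQ_subm
    Gconnected f_pos f_lim ug0 ug0' e6.
  pose close (p q : P) := len_le (gP 1) (eps / 6) p q /\ len_le (gP 1) (eps / 6) q p.
  have np p : \forall q \near p, close p q.
    by apply: near_len_le => //; exact: rP.
  (* For [f t < 1] the metric is dominated by the one for f = 1, so one neighbourhood of each point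
     serves all such [t]. *)
  have shrink t K p q : 0 < f t < 1 -> len_le (gP 1) K p q -> len_le (gP (f t)) K p q.
    move=> /andP[_ /ltW f1] [K0 J]; split; first exact: K0.
    apply: joined_sub J => x v; apply: le_trans; rewrite /gP /connection_metric.
    rewrite lerD2r ler_wpM2r//.
    by have [_ _ + _] := riemannian_regular gM_riem; exact.
  exists ([set pp | close p0 pp.1 /\ close p0' pp.2],
    [set t | [/\ 0 < f t, f t < 1 & len_le (gP (f t))
       (riemannian_dist gQ (rho g0) (rho g0') + eps / 6) p0 p0']]).
    split => /=; last first.
      by apply: filterS3 f_pos f_lt1 nt => t ft0 ft1 Ht; split.
    by exists (close p0, close p0'); [split; exact: np|case=> p p' []].
  move=> [[p p'] t] [/= [[p0p pp0] [p0p' pp0']] [ft0 ft1 lt0]] g g' ug ug'.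
  have ft : 0 < f t < 1 by rewrite ft0.
  move/(shrink _ _ _ _ ft) in p0p; move/(shrink _ _ _ _ ft) in pp0.
  move/(shrink _ _ _ _ ft) in p0p'; move/(shrink _ _ _ _ ft) in pp0'.
  have rt := rP _ (ltW ft0).
  have lpp := len_le_trans rt (len_le_trans rt pp0 lt0) p0p'.
  have low K q q' h h' : len_le (gP (f t)) K q q' ->
      horizontally_joined theta u (act q h) -> horizontally_joined theta u (act q' h') ->
      riemannian_dist gQ (rho h) (rho h') <= riemannian_dist (gP (f t)) q q'.
    move=> qq' uh uh'; apply: (quotient_dist_le bundle gG_bi gM_riem theta_conn Q_quot
      gQ_riem gQ_subm Mconnected (ltW ft0) _ uh uh'); by exists K.
  have H1 := low _ _ _ _ _ lpp ug ug'.
  have H2 := len_le_dist rt lpp.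
  have H3 := le_trans (low _ _ _ _ _ p0p ug0 ug) (len_le_dist rt p0p).
  have H4 := le_trans (low _ _ _ _ _ pp0' ug' ug0') (len_le_dist rt pp0').
  have H5 := dist_triangle rQ (Qpath g0 g) (Qpath g g0').
  have H6 := dist_triangle rQ (Qpath g g') (Qpath g' g0').
  (* The lower bound [H1] fixes the sign of the difference, leaving only the upper estimate. *)
  rewrite ger0_norm ?subr_ge0//.
  move: H1 H2 H3 H4 H5 H6; rewrite /=.
  move: (riemannian_dist _ p p') (riemannian_dist gQ (rho g) (rho g'))
   (riemannian_dist gQ (rho g0) (rho g0')) (riemannian_dist gQ (rho g0) (rho g))
   (riemannian_dist gQ (rho g') (rho g0')) (riemannian_dist gQ (rho g) (rho g0')) e0.
  by clear; move=> *; lra.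
apply: filterS key => t Ht.
apply: le_trans (GH_dist_le corrC (eps := eps) _) _; last first.
  by rewrite lee_fin ler_piMl ?(ltW e0)// invf_le1 ?ler1n// ltr0n.
move=> [p q] [p' q'] [g /= <- ug] [g' /= <- ug'].
by apply: (Ht (p, p')).
Qed.
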